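(* The space $\mathrm{TFAB}_\omega$ of torsion-free abelian groups with domain $\omega$ is faithfully Borel complete. Furthermore, the space $\mathrm{Graphs}_\omega$ of graphs with domain $\omega$ is $\mathfrak{L}_{\omega_1,\omega}$-interpretable in the space $\mathrm{TFAB}_\omega$.
   Context: $\mathfrak{L}_{\omega_1,\omega}$ denotes infinitary logic allowing countable conjunctions and disjunctions and finite strings of quantifiers. For an $\mathfrak{L}_{\omega_1,\omega}$-theory in a countable vocabulary, the set $\mathbf{K}_\omega$ of its models with domain $\omega$ is a standard Borel space, being a Borel subset of the Polish space of all structures with domain $\omega$ in that vocabulary. $\mathrm{Graphs}_\omega$ is the space of graphs (one symmetric irreflexive binary relation $R$) with domain $\omega$. $\mathrm{TFAB}_\omega$ is the space of torsion-free abelian groups with domain $\omega$, in the vocabulary $\{0,+,-\}$. A Borel reduction $\mathbf{F}$ from $\mathrm{Graphs}_\omega$ into $\mathbf{K}_\omega$ is a Borel map $\mathbf{F}:\mathrm{Graphs}_\omega\to\mathbf{K}_\omega$ such that for all $H_1,H_2\in\mathrm{Graphs}_\omega$: $H_1\cong H_2$ if and only if $\mathbf{F}(H_1)\cong\mathbf{F}(H_2)$. A subset of $\mathrm{Graphs}_\omega$ is invariant if it is closed under isomorphism. $\mathbf{K}_\omega$ is faithfully Borel complete if there is a Borel reduction $\mathbf{F}$ from $\mathrm{Graphs}_\omega$ into $\mathbf{K}_\omega$ such that for every invariant Borel subset $X$ of $\mathrm{Graphs}_\omega$, the closure under isomorphism (within $\mathbf{K}_\omega$) of the image $\mathbf{F}[X]$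 is Borel. An $\mathfrak{L}_{\omega_1,\omega}$-interpretation scheme $\Gamma$ of graphs in abelian groups consists of an integer $n\geq 1$ and $\mathfrak{L}_{\omega_1,\omega}$-formulas without parameters in the vocabulary $\{0,+,-\}$: a domain formula $\partial_\Gamma(\bar x)$, an equality formula $\phi_{=}(\bar x,\bar y)$ and an edge formula $\phi_R(\bar x,\bar y)$, where $\bar x,\bar y$ are $n$-tuples of variables. It interprets a graph $H$ in a group $G$ if there is a surjection $f_\Gamma:\{\bar a\in G^n: G\models\partial_\Gamma(\bar a)\}\to H$ such that for all $\bar a,\bar b$ in its domain, $f_\Gamma(\bar a)=f_\Gamma(\bar b)$ iff $G\models\phi_{=}(\bar a,\bar b)$, and $H\models f_\Gamma(\bar a)\,R\,f_\Gamma(\bar b)$ iff $G\models\phi_R(\bar a,\bar b)$. That $\mathrm{Graphs}_\omega$ is $\mathfrak{L}_{\omega_1,\omega}$-interpretable in $\mathrm{TFAB}_\omega$ means that there are a single such scheme $\Gamma$ and a Borel reduction $\mathbf{F}$ from $\mathrm{Graphs}_\omega$ into $\mathrm{TFAB}_\omega$ such that, for every $H\in\mathrm{Graphs}_\omega$, $\Gamma$ interprets $H$ in $\mathbf{F}(H)$. *)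

(* Defs.v *)
From HB Require Import structures.
From mathcomp Require Import all_boot.
From mathcomp Require Import all_classical topology measurable_structure.

Set Implicit Arguments.
Unset Strict Implicit.
Unset Printing Implicit Defensive.

Local Open Scope classical_set_scope.

Record vocabulary := Vocabulary {
  fsym : countType;
  farity : fsym -> nat;
  rsym : countType;
  rarity : rsym -> nat }.

(* Structures with domain omega, as points of the Polish space
   prod_f omega^(omega^(arity f)) * prod_r 2^(omega^(arity r));
   nat and bool carry the discrete topology. *)
Definition structure (L : vocabulary) : Type :=
  (prod_topology (fun f : fsym L => {ptws (farity f).-tuple nat -> nat}) *
   prod_topology (fun r : rsym L => {ptws (rarity r).-tuple nat -> bool}))%type.

Definition finterp (L : vocabulary) (M : structure L) (f : fsym L) :
  (farity f).-tuple nat -> nat := M.1 f.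
Arguments finterp {L} M f a : rename.

Definition rinterp (L : vocabulary) (M : structure L) (r : rsym L) :
  (rarity r).-tuple nat -> bool := M.2 r.
Arguments rinterp {L} M r a : rename.

Definition isomorphic (L : vocabulary) (M N : structure L) : Prop :=
  exists2 g : nat -> nat, bijective g &
    (forall (f : fsym L) (a : (farity f).-tuple nat),
        g (finterp M f a) = finterp N f (map_tuple g a)) /\
    (forall (r : rsym L) (a : (rarity r).-tuple nat),
        rinterp M r a = rinterp N r (map_tuple g a)).

(* Terms and L_{omega_1,omega}-formulas whose free variables are among
   x_0, ..., x_(n-1); a quantifier binds x_0 (de Bruijn) and shifts the
   others. *)
Inductive term (L : vocabulary) (n : nat) : Type :=
| Var of 'I_n
| App (f : fsym L) of ('I_(farity f) -> term L n).

Inductive formula (L : vocabulary) (n : nat) : Type :=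
| Equal of term L n & term L n
| Rel (r : rsym L) of ('I_(rarity r) -> term L n)
| Not of formula L n
| Conj of (nat -> formula L n)
| Disj of (nat -> formula L n)
| All of formula L n.+1
| Ex of formula L n.+1.

Fixpoint eval (L : vocabulary) (M : structure L) (n : nat) (a : n.-tuple nat)
    (t : term L n) : nat :=
  match t with
  | Var i => tnth a i
  | App f ts => finterp M f [tuple eval M a (ts i) | i < farity f]
  end.

Fixpoint sat (L : vocabulary) (M : structure L) (n : nat) (phi : formula L n)
    : n.-tuple nat -> Prop :=
  match phi with
  | Equal t u => fun a => eval M a t = eval M a u
  | Rel r ts => fun a => rinterp M r [tuple eval M a (ts i) | i < rarity r]
  | Not psi => fun a => ~ sat M psi a
  | Conj psi => fun a => forall k, sat M (psi k) a
  | Disj psi => fun a => exists k, sat M (psi k) a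
  | All psi => fun a => forall x : nat, sat M psi [tuple of x :: a]
  | Ex psi => fun a => exists x : nat, sat M psi [tuple of x :: a]
  end.

Definition borel (T : topologicalType) : set (set T) := <<s @open T >>.

Definition borel_map (T U : topologicalType) (F : T -> U) : Prop :=
  forall Y : set U, borel Y -> borel (F @^-1` Y).

Definition graph_vocabulary : vocabulary :=
  @Vocabulary void (fun=> 0) unit (fun=> 2).

Definition edge (H : structure graph_vocabulary) (x y : nat) : bool :=
  rinterp H tt [tuple x; y].

Definition Graphs_omega : set (structure graph_vocabulary) :=
  [set H | symmetric (edge H) /\ irreflexive (edge H)].

Inductive group_symbol := Zero | Add | Opp.

Definition group_symbol_encode (s : group_symbol) : option bool :=
  match s with Zero => None | Add => Some true | Opp => Some false end.

Definition group_symbol_decode (b : option bool) : group_symbol :=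
  match b with None => Zero | Some true => Add | Some false => Opp end.

Lemma group_symbol_encodeK : cancel group_symbol_encode group_symbol_decode.
Proof. by case. Qed.

HB.instance Definition _ :=
  Countable.copy group_symbol (can_type group_symbol_encodeK).

Definition group_arity (s : group_symbol) : nat :=
  match s with Zero => 0 | Add => 2 | Opp => 1 end.

Definition group_vocabulary : vocabulary :=
  @Vocabulary group_symbol group_arity void (fun=> 0).

Definition zero (G : structure group_vocabulary) : nat :=
  finterp G Zero [tuple].

Definition add (G : structure group_vocabulary) (x y : nat) : nat :=
  finterp G Add [tuple x; y].

Definition opp (G : structure group_vocabulary) (x : nat) : nat :=
  finterp G Opp [tuple x].

Definition is_abelian_group (G : structure group_vocabulary) : Prop :=
  [/\ associative (add G), commutative (add G),
      left_id (zero G) (add G) & left_inverse (zero G) (opp G) (add G)].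

Definition is_torsion_free (G : structure group_vocabulary) : Prop :=
  forall (n : nat) (x : nat), (0 < n)%N ->
    iter n (add G x) (zero G) = zero G -> x = zero G.

Definition TFAB_omega : set (structure group_vocabulary) :=
  [set G | is_abelian_group G /\ is_torsion_free G].

(* Below, a set K of structures is also used as a type (the coercion set_type);
   as such it carries the subspace topology, so that borel refers to the Borel
   structure of K itself. *)

Definition borel_reduction (L : vocabulary) (K : set (structure L))
    (F : Graphs_omega -> K) : Prop :=
  borel_map F /\
  forall H1 H2 : Graphs_omega,
    isomorphic (val H1) (val H2) <-> isomorphic (val (F H1)) (val (F H2)).

Definition invariant (L : vocabulary) (K : set (structure L)) (X : set K)
    : Prop :=
  forall M N : K, isomorphic (val M) (val N) -> X M -> X N.

Definition iso_closure (L : vocabulary) (K : set (structure L)) (X : set K)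
    : set K :=
  [set N | exists2 M : K, X M & isomorphic (val M) (val N)].

Definition faithfully_borel_complete (L : vocabulary) (K : set (structure L))
    : Prop :=
  exists F : Graphs_omega -> K, borel_reduction F /\
    forall X : set Graphs_omega,
      borel X -> invariant X -> borel (iso_closure (F @` X)).

(* In eq_formula and edge_formula the first scheme_dim variables stand for the
   first tuple and the last scheme_dim variables for the second. *)
Record interpretation_scheme (L : vocabulary) := InterpretationScheme {
  scheme_dim : nat;
  scheme_dim_ge1 : (1 <= scheme_dim)%N;
  dom_formula : formula L scheme_dim;
  eq_formula : formula L (scheme_dim + scheme_dim);
  edge_formula : formula L (scheme_dim + scheme_dim) }.

Definition scheme_domain (L : vocabulary) (Gamma : interpretation_scheme L)
    (G : structure L) : set ((scheme_dim Gamma).-tuple nat) :=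
  [set a | sat G (dom_formula Gamma) a].
Arguments scheme_domain {L} Gamma G.

Definition interprets (L : vocabulary) (Gamma : interpretation_scheme L)
    (H : structure graph_vocabulary) (G : structure L) : Prop :=
  exists2 f : (scheme_dim Gamma).-tuple nat -> nat,
    set_surj (scheme_domain Gamma G) [set: nat] f &
    forall a b : (scheme_dim Gamma).-tuple nat,
      scheme_domain Gamma G a -> scheme_domain Gamma G b ->
      (f a = f b <-> sat G (eq_formula Gamma) [tuple of a ++ b]) /\
      (edge H (f a) (f b) <-> sat G (edge_formula Gamma) [tuple of a ++ b]).

Definition graphs_interpretable_in (L : vocabulary) (K : set (structure L))
    : Prop :=
  exists (Gamma : interpretation_scheme L) (F : Graphs_omega -> K),
    borel_reduction F /\
    forall H : Graphs_omega, interprets Gamma (val H) (val (F H)).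

(* Main.v *)
(* The group of a graph H is a group of rational vectors over a basis made of the
   truncations, to each level k, of automorphisms of the tree of finite integer
   sequences, and of the eventually constant branches of that tree. The limit of a
   branch encodes a label (u, v), a pair of vertices of H. Each of countably many
   partial maps on the basis (level, restriction and translation of truncated
   automorphisms, their value against a branch, the two labels, u = v, adjacency of
   u and v) is assigned a prime p: e_b - e_b' is made divisible by all powers of p
   when the map identifies b and b', and so is e_b when the map kills b. Such a
   divisibility then says that the associated linear map vanishes, so that these
   relations are definable. The multiples of the e_b with b of level k are definable
   because a group ring of a left-ordered group has no units but the monomials (the
   unique product argument); hence so are the multiples of branches and, with the
   branches labelled (u, u) as vertices, the graph H.

   Automorphisms of the tree extend every finite partial matching of branches with
   prescribed labels, up to sign, so that tuples of the same L_{omega_1,omega} type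
   are conjugate. Hence a countable group M is isomorphic to the group of its own
   vertex graph, compatibly with vertices, exactly when the relation of having the
   same type is a back-and-forth system: a Borel condition on M. Thus the
   isomorphism closure of the image of a Borel invariant set X is the Borel set of
   those M satisfying this condition whose vertex graph lies in X. *)

From HB Require Import structures.
From mathcomp Require Import all_boot all_order all_algebra.
From mathcomp Require Import all_classical topology measurable_structure.
From mathcomp Require Import zify.
Require Import Defs.

Set Implicit Arguments.
Unset Strict Implicit.
Unset Printing Implicit Defensive.

Local Open Scope classical_set_scope.

(** * Borel predicates *)

(** The construction balances two demands: enough definable structure to recover [H], and enough
    automorphisms for types to determine orbits. Tree automorphisms compose with the truncated maps
    on the left, while the relations coded by primes use truncation, right translation and
    evaluation; hence every automorphism that respects labels acts on the group. A label is read off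
    the limit of a branch, so that no finite part of the branch restricts it and partial matchings
    extend one level at a time. A prime records only which basis vectors a map identifies, so a map
    from a level to itself is not directly visible. This is why the levels form an infinite tower:
    translation inside level [k] is obtained by comparing two projections of one lift to level
    [k.+1]. Vectors are recovered only up to a rational scalar. A frame and a point sharing their
    scalar pin it down: no partial map kills both, so the scalar is an integer, and a condition on
    prime divisors leaves 1 or -1. The sign remains, inversion being an automorphism. *)

Definition bpred (T : topologicalType) (P : T -> Prop) : Prop :=
  borel [set t | P t].

Section BorelPredicates.
Variable T : topologicalType.
Implicit Types P Q : T -> Prop.

Lemma bpred_ext P Q : (forall t, P t <-> Q t) -> bpred P -> bpred Q.
Proof. by move=> PQ; congr borel; apply/seteqP; split=> t /PQ. Qed.

Lemma bpred_open P : open [set t | P t] -> bpred P.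
Proof. exact: sub_sigma_algebra. Qed.

Lemma bpred_not P : bpred P -> bpred (fun t => ~ P t).
Proof. by move=> /sigma_algebraCD; rewrite setTD. Qed.

Lemma bpred_exn (P : nat -> T -> Prop) :
  (forall n, bpred (P n)) -> bpred (fun t => exists n, P n t).
Proof.
move=> bP; have := sigma_algebra_bigcup bP; apply: bpred_ext => t.
by split=> [[n _ Pn]|[n Pn]]; exists n.
Qed.

Lemma bpred_cst (A : Prop) : bpred (fun _ : T => A).
Proof.
have [a|na] := pselect A.
  by apply: (@bpred_ext (fun=> True)); [|apply: bpred_open; exact: openT].
by apply: (@bpred_ext (fun=> False)); [|apply: bpred_open; exact: open0].
Qed.

Lemma bpred_ex (I : countType) (P : I -> T -> Prop) :
  (forall i, bpred (P i)) -> bpred (fun t => exists i, P i t).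
Proof.
move=> bP; pose P' n t := if unpickle n is Some i then P i t else False.
apply: (@bpred_ext (fun t => exists n, P' n t)) => [t|].
  split=> [[n]|[i Pi]]; rewrite /P'.
    by case: unpickle => // i Pi; exists i.
  by exists (pickle i); rewrite pickleK.
apply: bpred_exn => n; rewrite /P'.
by case: unpickle => [i|]; [exact: bP|exact: bpred_cst].
Qed.

Lemma bpred_all (I : countType) (P : I -> T -> Prop) :
  (forall i, bpred (P i)) -> bpred (fun t => forall i, P i t).
Proof.
move=> bP; apply: (@bpred_ext (fun t => ~ exists i, ~ P i t)) => [t|].
  by split=> [nP i|Pi [i]]; [apply: contrapT => nPi; apply: nP; exists i|exact].
by apply: bpred_not; apply: bpred_ex => i; exact: bpred_not.
Qed.

Lemma bpred_or P Q : bpred P -> bpred Q -> bpred (fun t => P t \/ Q t).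
Proof.
move=> bP bQ; apply: (@bpred_ext (fun t => exists b : bool, if b then P t else Q t)).
  by move=> t; split=> [[[]]|[]]; [left|right|exists true|exists false].
by apply: bpred_ex => -[].
Qed.

Lemma bpred_and P Q : bpred P -> bpred Q -> bpred (fun t => P t /\ Q t).
Proof.
move=> bP bQ; apply: (@bpred_ext (fun t => ~ (~ P t \/ ~ Q t))) => [t|].
  by rewrite not_orE !notK.
by apply: bpred_not; apply: bpred_or; exact: bpred_not.
Qed.

Lemma bpred_imp P Q : bpred P -> bpred Q -> bpred (fun t => P t -> Q t).
Proof.
move=> bP bQ; apply: (@bpred_ext (fun t => ~ P t \/ Q t)) => [t|].
  by rewrite implyE.
by apply: bpred_or => //; exact: bpred_not.
Qed.

Lemma bpred_iff P Q : bpred P -> bpred Q -> bpred (fun t => P t <-> Q t).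
Proof. by move=> bP bQ; apply: bpred_and; exact: bpred_imp. Qed.

(** Splitting on the countably many values of [u] reduces a nested Borel dependence to fixed
    arguments; this is the substitution rule of all later Borel computations. *)
Lemma bpred_comp (I : countType) (u : T -> I) (P : I -> T -> Prop) :
  (forall i, bpred (fun t => u t = i)) -> (forall i, bpred (P i)) ->
  bpred (fun t => P (u t) t).
Proof.
move=> bu bP; apply: (@bpred_ext (fun t => exists i, u t = i /\ P i t)).
  by move=> t; split=> [[i [-> //]]|]; exists (u t).
by apply: bpred_ex => i; apply: bpred_and.
Qed.

End BorelPredicates.

Lemma borel_map_open (T U : topologicalType) (F : T -> U) :
  (forall A : set U, open A -> borel (F @^-1` A)) -> borel_map F.
Proof.
move=> oF; apply: smallest_sub => //; split.
- by rewrite /= preimage_set0; exact: sigma_algebra0.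
- by move=> A; rewrite /= setTD preimage_setC => /bpred_not.
- by move=> A bA; rewrite /= preimage_bigcup; exact: sigma_algebra_bigcup.
Qed.

Lemma bpred_preimage (T U : topologicalType) (F : T -> U) (P : U -> Prop) :
  borel_map F -> bpred P -> bpred (fun t => P (F t)).
Proof. by move=> bF /bF. Qed.

Lemma borel_map_comp (T U V : topologicalType) (F : T -> U) (G : U -> V) :
  borel_map F -> borel_map G -> borel_map (G \o F).
Proof. by move=> bF bG Y /bG/bF. Qed.

Lemma borel_map_val (T : topologicalType) (K : set T) :
  borel_map (fun x : K => val x).
Proof. by apply: borel_map_open => A oA; apply: bpred_open; exists A. Qed.

Lemma borel_map_set_type (T U : topologicalType) (K : set U) (F : T -> K) :
  borel_map (fun t => val (F t)) -> borel_map F.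
Proof.
move=> bF; apply: borel_map_open => _ [A oA <-].
by apply: (bF A); apply: bpred_open.
Qed.

(** * The space of structures is second countable *)

Section SecondCountable.
Variable L : vocabulary.

Let cond : countType :=
  (({f : fsym L & (farity f).-tuple nat} * nat) +
   ({r : rsym L & (rarity r).-tuple nat} * bool))%type.

Definition meets (M : structure L) (c : cond) : Prop :=
  match c with
  | inl (existT f a, n) => finterp M f a = n
  | inr (existT r a, b) => rinterp M r a = b
  end.

Definition meets_all M (l : seq cond) := forall c, c \in l -> meets M c.

Lemma prod_topology_cvg (I : Type) (T : I -> topologicalType)
    (F : set_system (prod_topology T)) (f : prod_topology T) : Filter F ->
  (forall i A, open A -> A (f i) -> F [set g | A (g i)]) -> F --> f.
Proof.
move=> FF oF; apply/cvg_sup => i A [_ [[C oC <-] Cf CA]].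
exact: filterS CA (oF i C oC Cf).
Qed.

(** The sets containing all structures that agree with [M] on some finite list of atomic values form
    a filter, which converges to [M] in each coordinate and therefore contains every open
    neighbourhood of [M]. *)
Lemma open_structure (A : set (structure L)) (M : structure L) : open A -> A M ->
  exists2 l, meets_all M l & forall N, meets_all N l -> A N.
Proof.
move=> oA AM.
pose F : set_system (structure L) := fun B =>
  exists2 l, meets_all M l & forall N, meets_all N l -> B N.
have FF : Filter F.
  split=> [|B C [l Ml lB] [l' Ml' lC]|B C BC [l Ml lB]].
  - by exists [::].
  - exists (l ++ l') => [c|N Nl]; first by rewrite mem_cat => /orP[/Ml|/Ml'].
    by split; [apply: lB|apply: lC] => c cl; apply: Nl; rewrite mem_cat cl ?orbT.
  - by exists l => // N /lB /BC.
have c1 : (fun N : structure L => N.1) @ F --> M.1.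
  apply: prod_topology_cvg => f B oB BM.
  suff cF : (fun N : structure L => N.1 f) @ F --> M.1 f.
    by apply: cF; exact: open_nbhs_nbhs.
  apply: (@prod_topology_cvg _ (fun=> nat)) => a C oC CM; exists [:: inl (Tagged _ a, finterp M f a)].
    by move=> c; rewrite inE => /eqP->.
  by move=> N /(_ _ (mem_head _ _)) /= e; rewrite /= -[N.1 f a]/(finterp N f a) e.
have c2 : (fun N : structure L => N.2) @ F --> M.2.
  apply: prod_topology_cvg => f B oB BM.
  suff cF : (fun N : structure L => N.2 f) @ F --> M.2 f.
    by apply: cF; exact: open_nbhs_nbhs.
  apply: (@prod_topology_cvg _ (fun=> bool)) => a C oC CM; exists [:: inr (Tagged _ a, rinterp M f a)].
    by move=> c; rewrite inE => /eqP->.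
  by move=> N /(_ _ (mem_head _ _)) /= e; rewrite /= -[N.2 f a]/(rinterp N f a) e.
have [[B C] [/= nB nC] BCA] : nbhs M A by exact: open_nbhs_nbhs.
suff : F A by [].
apply: (@filterS _ F FF _ _ _ (@filterI _ F FF _ _ (c1 _ nB) (c2 _ nC))).
by move=> N [? ?]; apply: BCA.
Qed.

Lemma open_meets c : open [set M : structure L | meets M c].
Proof.
case: c => [[[f a] n]|[[r a] b]].
- pose K (i : fsym L) : topologicalType := {ptws (farity i).-tuple nat -> nat}.
  have c1 : continuous (fun M : structure L => M.1 : prod_topology K).
    by move=> M; exact: cvg_fst.
  have c2 : continuous (fun M : structure L => M.1 f : K f).
    by move=> M; exact: (@continuous_comp _ _ _ (fun M : structure L => M.1 : prod_topology K)
      (fun g => g f) M (c1 M) (@proj_continuous _ K f _)).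
  have /continuousP c3 : continuous (fun M : structure L => finterp M f a).
    move=> M; exact: (@continuous_comp _ _ _ (fun M : structure L => M.1 f : K f)
      (fun g : K f => g a) M (c2 M) (@proj_continuous _ (fun=> nat) a _)).
  exact: (c3 [set n] (discrete_open _)).
- pose K (i : rsym L) : topologicalType := {ptws (rarity i).-tuple nat -> bool}.
  have c1 : continuous (fun M : structure L => M.2 : prod_topology K).
    by move=> M; exact: cvg_snd.
  have c2 : continuous (fun M : structure L => M.2 r : K r).
    by move=> M; exact: (@continuous_comp _ _ _ (fun M : structure L => M.2 : prod_topology K)
      (fun g => g r) M (c1 M) (@proj_continuous _ K r _)).
  have /continuousP c3 : continuous (fun M : structure L => rinterp M r a).
    move=> M; exact: (@continuous_comp _ _ _ (fun M : structure L => M.2 r : K r)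
      (fun g : K r => g a) M (c2 M) (@proj_continuous _ (fun=> bool) a _)).
  exact: (c3 [set b] (discrete_open _)).
Qed.

(** There are countably many finite lists of conditions, so an open set is a countable union of
    basic ones and single atomic values suffice as tests. *)
Lemma borel_map_structure (T : topologicalType) (F : T -> structure L) :
  (forall c, bpred (fun t => meets (F t) c)) -> borel_map F.
Proof.
move=> bF; apply: borel_map_open => A oA.
apply: (@bpred_ext _ (fun t => exists l : seq cond,
    (forall N, meets_all N l -> A N) /\ meets_all (F t) l)) => [t|].
  split=> [[l [lA]]|At]; first exact: lA.
  by have [l ? ?] := open_structure oA At; exists l.
apply: bpred_ex => l; apply: bpred_and; first exact: bpred_cst.
by apply: bpred_all => c; apply: bpred_imp; [exact: bpred_cst|exact: bF].
Qed.

End SecondCountable.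

(** * Definable predicates *)

Section Formulas.
Variable L : vocabulary.

Lemma bpred_eval n (a : n.-tuple nat) (u : term L n) (m : nat) :
  bpred (fun M : structure L => eval M a u = m).
Proof.
elim: u m => [i|f ts IH] m; first by rewrite /=; exact: bpred_cst.
apply: (@bpred_ext _ (fun M => exists b : (farity f).-tuple nat,
   (forall i, eval M a (ts i) = tnth b i) /\ finterp M f b = m)) => [M|].
  split=> /= [[b [eb <-]]|<-].
    by congr (finterp M f _); apply: eq_from_tnth => i; rewrite tnth_mktuple eb.
  by eexists; split=> [i|//]; rewrite tnth_mktuple.
apply: bpred_ex => b; apply: bpred_and; first by apply: bpred_all => i; exact: IH.
apply: bpred_open.
exact: (@open_meets L (inl (Tagged (fun f : fsym L => (farity f).-tuple nat) b, m))).
Qed.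

Lemma bpred_sat n (phi : formula L n) (a : n.-tuple nat) :
  bpred (fun M : structure L => sat M phi a).
Proof.
elim: phi a => {n} [n t u|n r ts|n psi IH|n psi IH|n psi IH|n psi IH|n psi IH] a /=.
- apply: (@bpred_comp _ _ (fun M : structure L => eval M a t)
    (fun i M => i = eval M a u)); first exact: bpred_eval.
  move=> i; apply: bpred_ext (bpred_eval a u i) => M.
  by split=> ->.
- apply: (@bpred_comp _ _ (fun M : structure L => [tuple eval M a (ts i) | i < rarity r])
    (fun b M => rinterp M r b : Prop)) => b; last first.
    apply: bpred_open.
    exact: (@open_meets L (inr (Tagged (fun r : rsym L => (rarity r).-tuple nat) b, true))).
  apply: (@bpred_ext _ (fun M => forall i, eval M a (ts i) = tnth b i)) => [M|].
    split=> [eb|<- i]; last by rewrite tnth_mktuple.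
    by apply: eq_from_tnth => i; rewrite tnth_mktuple eb.
  by apply: bpred_all => i; exact: bpred_eval.
- by apply: bpred_not; exact: IH.
- by apply: bpred_all => k; exact: IH.
- by apply: bpred_ex => k; exact: IH.
- by apply: bpred_all => x; exact: IH.
- by apply: bpred_ex => x; exact: IH.
Qed.

Section Isomorphism.
Variables (M N : structure L) (g : nat -> nat).
Hypothesis bij_g : bijective g.
Hypothesis fg : forall (f : fsym L) (a : (farity f).-tuple nat),
  g (finterp M f a) = finterp N f (map_tuple g a).
Hypothesis rg : forall (r : rsym L) (a : (rarity r).-tuple nat),
  rinterp M r a = rinterp N r (map_tuple g a).

Lemma eval_iso n (a : n.-tuple nat) (u : term L n) :
  eval N (map_tuple g a) u = g (eval M a u).
Proof.
elim: u => [i|f ts IH] /=; first by rewrite tnth_map.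
rewrite fg; congr (finterp N f _); apply: eq_from_tnth => i.
by rewrite tnth_mktuple IH tnth_map tnth_mktuple.
Qed.

Lemma sat_iso n (phi : formula L n) (a : n.-tuple nat) :
  sat M phi a <-> sat N phi (map_tuple g a).
Proof.
have [h hg gh] := bij_g.
have cons m (b : m.-tuple nat) x :
    [tuple of x :: map_tuple g b] = map_tuple g [tuple of h x :: b].
  by apply: val_inj; rewrite /= gh.
elim: phi a => {n} [n t u|n r ts|n psi IH|n psi IH|n psi IH|n psi IH|n psi IH] a /=.
- by rewrite !eval_iso; split=> [->//|]; exact: (can_inj hg).
- rewrite rg; suff -> : map_tuple g [tuple eval M a (ts i) | i < rarity r] =
    [tuple eval N (map_tuple g a) (ts i) | i < rarity r] by [].
  by apply: eq_from_tnth => i; rewrite [RHS]tnth_mktuple eval_iso tnth_map tnth_mktuple.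
- by rewrite IH.
- by split=> + k => /(_ k); rewrite IH.
- by split=> -[k]; rewrite ?IH => ?; exists k; rewrite ?IH.
- split=> + x; first by move=> /(_ (h x)); rewrite IH cons.
  by move=> /(_ (g x)); rewrite IH cons hg.
- split=> -[x sx]; last by exists (h x); rewrite IH -cons.
  by exists (g x); move: sx; rewrite IH cons hg.
Qed.

End Isomorphism.
End Formulas.

Notation gstruct := (structure group_vocabulary).

Section Definable.

Definition definable n (P : gstruct -> n.-tuple nat -> Prop) :=
  exists phi : formula group_vocabulary n, forall M a, sat M phi a <-> P M a.

Definition defterm n (t : gstruct -> n.-tuple nat -> nat) :=
  exists u : term group_vocabulary n, forall M a, eval M a u = t M a.

(** Quantifying over all contexts [n] and all terms builds substitution into definability, so that
    no substitution on formulas has to be defined. *)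
Definition def1 (P : gstruct -> nat -> Prop) :=
  forall n t, defterm t -> @definable n (fun M a => P M (t M a)).

Definition def2 (P : gstruct -> nat -> nat -> Prop) :=
  forall n t1 t2, defterm t1 -> defterm t2 ->
    @definable n (fun M a => P M (t1 M a) (t2 M a)).

Lemma defterm_nth n (i : 'I_n) : defterm (fun _ (a : n.-tuple nat) => tnth a i).
Proof. by exists (Var _ i). Qed.

Lemma defterm_head n : defterm (fun _ (b : n.+1.-tuple nat) => thead b).
Proof. exact: defterm_nth. Qed.

Fixpoint shift_term n (u : term group_vocabulary n) : term group_vocabulary n.+1 :=
  match u with
  | Var i => Var _ (lift ord0 i)
  | App f ts => App (fun i => shift_term (ts i))
  end.

Lemma defterm_behead n (t : gstruct -> n.-tuple nat -> nat) : defterm t ->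
  defterm (fun M (b : n.+1.-tuple nat) => t M (behead_tuple b)).
Proof.
case=> u tu; exists (shift_term u) => M b; rewrite -tu {t tu}.
elim: u => [i|f ts IH] /=; first by rewrite !(tnth_nth 0) /= nth_behead.
by congr (finterp M f _); apply: eq_from_tnth => i; rewrite !tnth_mktuple IH.
Qed.

Lemma defterm_zero n : @defterm n (fun M _ => zero M).
Proof.
exists (@App group_vocabulary n Zero (fun i => match i with Ordinal _ h => False_rect _ (notF h) end)).
by move=> M a /=; congr (finterp M Zero _); exact: (tuple0 _).
Qed.

Lemma defterm_add n t1 t2 : @defterm n t1 -> @defterm n t2 ->
  defterm (fun M a => add M (t1 M a) (t2 M a)).
Proof.
move=> [u1 tu1] [u2 tu2].
exists (@App group_vocabulary n Add (fun i => if val i == 0 then u1 else u2)) => M a /=.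
rewrite -tu1 -tu2; congr (finterp M Add _); apply: val_inj => /=.
by rewrite !enum_ordSl enum_ord0.
Qed.

Lemma defterm_opp n t : @defterm n t -> defterm (fun M a => opp M (t M a)).
Proof.
move=> [u tu]; exists (@App group_vocabulary n Opp (fun=> u)) => M a /=.
rewrite -tu; congr (finterp M Opp _); apply: val_inj => /=.
by rewrite !enum_ordSl enum_ord0.
Qed.

Section Connectives.
Variable n : nat.
Implicit Types P Q : gstruct -> n.-tuple nat -> Prop.

Lemma definable_ext P Q : (forall M a, P M a <-> Q M a) -> definable P -> definable Q.
Proof. by move=> PQ [phi hphi]; exists phi => M a; rewrite hphi. Qed.

Lemma definable_eq t1 t2 : defterm t1 -> defterm t2 ->
  @definable n (fun M a => t1 M a = t2 M a).
Proof. by move=> [u1 h1] [u2 h2]; exists (Equal u1 u2) => M a /=; rewrite h1 h2. Qed.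

Lemma definable_not P : definable P -> definable (fun M a => ~ P M a).
Proof. by move=> [phi h]; exists (Not phi) => M a /=; rewrite h. Qed.

Lemma definable_exn (P : nat -> gstruct -> n.-tuple nat -> Prop) :
  (forall k, definable (P k)) -> definable (fun M a => exists k, P k M a).
Proof.
move=> /choice[phi h]; exists (Disj phi) => M a /=.
by split=> -[k /h ?]; exists k.
Qed.

Lemma definable_cst (A : Prop) : @definable n (fun _ _ => A).
Proof.
have z : @definable n (fun M a => zero M = zero M).
  by apply: definable_eq; exact: defterm_zero.
have [a|na] := pselect A; first by apply: definable_ext z.
by apply: definable_ext (definable_not z) => M a; split.
Qed.

Lemma definable_exc (I : countType) (P : I -> gstruct -> n.-tuple nat -> Prop) :
  (forall i, definable (P i)) -> definable (fun M a => exists i, P i M a).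
Proof.
move=> dP; pose P' k M a := if unpickle k is Some i then P i M a else False.
apply: (@definable_ext (fun M a => exists k, P' k M a)) => [M a|].
  split=> [[k]|[i Pi]]; rewrite /P'; first by case: unpickle => // i; exists i.
  by exists (pickle i); rewrite pickleK.
apply: definable_exn => k; rewrite /P'.
by case: unpickle => [i|]; [exact: dP|exact: definable_cst].
Qed.

Lemma definable_allc (I : countType) (P : I -> gstruct -> n.-tuple nat -> Prop) :
  (forall i, definable (P i)) -> definable (fun M a => forall i, P i M a).
Proof.
move=> dP; apply: (@definable_ext (fun M a => ~ exists i, ~ P i M a)) => [M a|].
  by split=> [nP i|Pi [i]]; [apply: contrapT => nPi; apply: nP; exists i|exact].
by apply: definable_not; apply: definable_exc => i; exact: definable_not.
Qed.

Lemma definable_or P Q : definable P -> definable Q ->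
  definable (fun M a => P M a \/ Q M a).
Proof.
move=> dP dQ.
apply: (@definable_ext (fun M a => exists b : bool, if b then P M a else Q M a)).
  by move=> M a; split=> [[[]]|[]]; [left|right|exists true|exists false].
by apply: definable_exc => -[].
Qed.

Lemma definable_and P Q : definable P -> definable Q ->
  definable (fun M a => P M a /\ Q M a).
Proof.
move=> dP dQ; apply: (@definable_ext (fun M a => ~ (~ P M a \/ ~ Q M a))).
  by move=> M a; rewrite not_orE !notK.
by apply: definable_not; apply: definable_or; exact: definable_not.
Qed.

Lemma definable_imp P Q : definable P -> definable Q ->
  definable (fun M a => P M a -> Q M a).
Proof.
move=> dP dQ; apply: (@definable_ext (fun M a => ~ P M a \/ Q M a)) => [M a|].
  by rewrite implyE.
by apply: definable_or => //; exact: definable_not.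
Qed.

Let cons_eta M (x : nat) (a : n.-tuple nat) (P : gstruct -> n.-tuple nat -> nat -> Prop) :
  P M (behead_tuple [tuple of x :: a]) (thead [tuple of x :: a]) = P M a x.
Proof. by congr P; exact: val_inj. Qed.

Lemma definable_ex (P : gstruct -> n.-tuple nat -> nat -> Prop) :
  @definable n.+1 (fun M b => P M (behead_tuple b) (thead b)) ->
  definable (fun M a => exists x, P M a x).
Proof.
move=> [phi h]; exists (Ex phi) => M a /=.
by split=> -[x]; rewrite ?h => Px; exists x; move: Px; rewrite ?h cons_eta.
Qed.

Lemma definable_all (P : gstruct -> n.-tuple nat -> nat -> Prop) :
  @definable n.+1 (fun M b => P M (behead_tuple b) (thead b)) ->
  definable (fun M a => forall x, P M a x).
Proof.
move=> [phi h]; exists (All phi) => M a /=.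
by split=> + x => /(_ x); rewrite ?h cons_eta.
Qed.

End Connectives.

Lemma def1_bpred P : def1 P -> forall x, bpred (fun M => P M x).
Proof.
move=> dP x; have [phi h] := dP 1 _ (defterm_head 0).
by apply: bpred_ext (bpred_sat phi [tuple x]) => M; rewrite h.
Qed.

Lemma def2_bpred P : def2 P -> forall x y, bpred (fun M => P M x y).
Proof.
move=> dP x y.
have [phi h] := dP 2 _ _ (defterm_head 1) (defterm_behead (defterm_head 0)).
by apply: bpred_ext (bpred_sat phi [tuple x; y]) => M; rewrite h.
Qed.

Definition giso (M N : gstruct) (g : nat -> nat) : Prop :=
  [/\ bijective g, g (zero M) = zero N,
    forall x y, g (add M x y) = add N (g x) (g y) &
    forall x, g (opp M x) = opp N (g x)].

Lemma giso_finterp M N g : giso M N g ->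
  forall (f : fsym group_vocabulary) (a : (farity f).-tuple nat),
    g (finterp M f a) = finterp N f (map_tuple g a).
Proof.
move=> [_ g0 gD gN] f; case: f => /= a.
- by rewrite (tuple0 a) -[LHS]/(g (zero M)) g0; congr finterp; exact: val_inj.
- case/tupleP: a => x a; case/tupleP: a => y a; rewrite (tuple0 a).
  have -> : [tuple of x :: [tuple of y :: [tuple]]] = [tuple x; y] by exact: val_inj.
  by rewrite -[LHS]/(g (add M x y)) gD; congr finterp; exact: val_inj.
- case/tupleP: a => x a; rewrite (tuple0 a).
  have -> : [tuple of x :: [tuple]] = [tuple x] by exact: val_inj.
  by rewrite -[LHS]/(g (opp M x)) gN; congr finterp; exact: val_inj.
Qed.

Lemma gisoP M N : isomorphic M N <-> exists g, giso M N g.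
Proof.
split=> [[g bg [fg _]]|[g ig]].
  exists g; split=> // [|x y|x].
  - by rewrite /zero (fg Zero); congr finterp; exact: val_inj.
  - by rewrite /add (fg Add); congr finterp; exact: val_inj.
  - by rewrite /opp (fg Opp); congr finterp; exact: val_inj.
by exists g; [case: ig|split=> [|[]//]; exact: giso_finterp].
Qed.

Lemma giso_sat M N g n (phi : formula group_vocabulary n) a : giso M N g ->
  sat M phi a <-> sat N phi (map_tuple g a).
Proof.
move=> ig; apply: sat_iso; [by case: ig|exact: giso_finterp|by case].
Qed.

Lemma def1_giso P M N g x : def1 P -> giso M N g -> P M x <-> P N (g x).
Proof.
move=> dP ig; have [phi h] := dP 1 _ (defterm_head 0).
by have := giso_sat phi [tuple x] ig; rewrite !h.
Qed.

Lemma def2_giso P M N g x y : def2 P -> giso M N g -> P M x y <-> P N (g x) (g y).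
Proof.
move=> dP ig.
have [phi h] := dP 2 _ _ (defterm_head 1) (defterm_behead (defterm_head 0)).
by have := giso_sat phi [tuple x; y] ig; rewrite !h.
Qed.

End Definable.

(** * Enumerations and back-and-forth *)

Section Enumeration.
Implicit Types S : nat -> Prop.

Definition next S (m : nat) : nat :=
  if pselect (exists n, `[< m <= n /\ S n >]) is left h then ex_minn h else 0.

Lemma nextP S m n : next S m = n <->
  [/\ m <= n, S n & forall j, m <= j -> j < n -> ~ S j] \/
  n = 0 /\ ~ exists j, m <= j /\ S j.
Proof.
rewrite /next; case: pselect => [h|h].
  case: ex_minnP => k /asboolP[mk Sk] kmin; split=> [<-|[[mn Sn nmin]|[_ []]]].
  - left; split=> // j mj jk Sj; suff : k <= j by rewrite leqNgt jk.
    by apply: kmin; apply/asboolP.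
  - apply/eqP; rewrite eqn_leq kmin /=; last exact/asboolP.
    by rewrite leqNgt; apply/negP => /(nmin _ mk).
  - by exists k.
split=> [<-|[[mn Sn _]|[-> //]]].
  by right; split=> // -[j jS]; apply: h; exists j; apply/asboolP.
by case: h; exists n; apply/asboolP.
Qed.

(** The increasing enumeration is canonical, hence depends on [S] in a Borel way; an enumeration
    obtained by choice would not. *)
Fixpoint enum_of S (i : nat) : nat :=
  if i is j.+1 then next S (enum_of S j).+1 else next S 0.

Definition unbounded S := forall m, exists n, m <= n /\ S n.

Section Unbounded.
Variable S : nat -> Prop.
Hypothesis uS : unbounded S.

Lemma next_unbounded m :
  [/\ m <= next S m, S (next S m) & forall j, m <= j -> j < next S m -> ~ S j].
Proof. by have /nextP[|[_ []]] := erefl (next S m). Qed.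

Lemma enum_ofP i : S (enum_of S i).
Proof. by case: i => [|i] /=; [have [] := next_unbounded 0|have [] := next_unbounded (enum_of S i).+1]. Qed.

Lemma enum_of_lt i j : i < j -> enum_of S i < enum_of S j.
Proof.
elim: j => // j IH; rewrite ltnS leq_eqVlt => /predU1P[->|/IH h]; last apply: ltn_trans h _.
  by have [] := next_unbounded (enum_of S j).+1.
by have [] := next_unbounded (enum_of S j).+1.
Qed.

Lemma enum_of_inj : injective (enum_of S).
Proof.
by move=> i j e; case: (ltngtP i j) => // /enum_of_lt; rewrite e ltnn.
Qed.

Lemma enum_of_surj n : S n -> exists i, enum_of S i = n.
Proof.
move=> Sn; have ge i : i <= enum_of S i.
  by elim: i => // i IH; exact: leq_ltn_trans IH (enum_of_lt (ltnSn i)).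
have ex : exists i, n <= enum_of S i by exists n.
exists (ex_minn ex); case: ex_minnP => i ni imin; apply/eqP; rewrite eqn_leq ni andbT.
case: i imin ni => [|i] imin _.
  have [_ _ nS] := next_unbounded 0; rewrite leqNgt; apply/negP => lt.
  exact: nS lt Sn.
have [_ _ nS] := next_unbounded (enum_of S i).+1; rewrite leqNgt; apply/negP => lt.
by apply: (nS n) => //; rewrite ltnNge; apply/negP => /imin; rewrite ltnn.
Qed.

End Unbounded.

Section BorelEnumeration.
Variables (T : topologicalType) (S : T -> nat -> Prop).
Hypothesis bS : forall n, bpred (fun t => S t n).

Lemma bpred_next m n : bpred (fun t => next (S t) m = n).
Proof.
apply: (bpred_ext (fun t => iff_sym (nextP (S t) m n))).
apply: bpred_or; last first.
  apply: bpred_and; [exact: bpred_cst|apply: bpred_not].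
  by apply: bpred_ex => j; apply: bpred_and; [exact: bpred_cst|].
apply: (@bpred_ext _ (fun t => m <= n /\ S t n /\ forall j, m <= j -> j < n -> ~ S t j)).
  by move=> t; split=> [[? []]|[]].
apply: bpred_and; first exact: bpred_cst.
apply: bpred_and => //; apply: bpred_all => j.
do 2!(apply: bpred_imp; first exact: bpred_cst); exact: bpred_not.
Qed.

Lemma bpred_enum_of i n : bpred (fun t => enum_of (S t) i = n).
Proof.
elim: i n => [|i IH] n /=; first exact: bpred_next.
apply: (@bpred_comp _ _ (fun t => enum_of (S t) i) (fun m t => next (S t) m.+1 = n)) => // m.
exact: bpred_next.
Qed.

End BorelEnumeration.
End Enumeration.

(** Dependent choice that meets the [n]-th requirement at step [n]; used both for isomorphisms of
    groups and for automorphisms of the tree. *)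
Lemma chain (St : Type) (V : St -> Prop) (R : St -> St -> Prop)
    (D : nat -> St -> Prop) (s0 : St) : V s0 ->
  (forall n s, V s -> exists s', [/\ V s', R s s' & D n s']) ->
  exists u : nat -> St, u 0 = s0 /\
    forall n, [/\ V (u n), R (u n) (u n.+1) & D n (u n.+1)].
Proof.
move=> V0 step.
have /choice[f hf] : forall p : nat * St, exists s',
    V p.2 -> [/\ V s', R p.2 s' & D p.1 s'].
  move=> [n s]; have [/(step n)[s' hs']|nV] := pselect (V s); first by exists s'.
  by exists s.
pose u := fix u n := if n is m.+1 then f (m, u m) else s0.
have Vu n : V (u n) by elim: n => //= n /(hf (n, _))[].
by exists u; split=> // n; split=> //; have [] := hf (n, u n) (Vu n).
Qed.

Lemma giso_additive M N g : is_abelian_group M -> is_abelian_group N ->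
  bijective g -> (forall x y, g (add M x y) = add N (g x) (g y)) -> giso M N g.
Proof.
move=> [_ _ l0 lV] [NA NC Nl0 NlV] bg gD.
have cancel0 y : add N y y = y -> y = zero N.
  by move=> e; rewrite -(NlV y) -{3}e NA NlV Nl0.
have g0 : g (zero M) = zero N by apply: cancel0; rewrite -gD l0.
split=> // x; rewrite -[LHS]Nl0 -(NlV (g x)) -NA (NC (g x)) -gD lV g0.
by rewrite NC Nl0.
Qed.

Section BackAndForth.
Variables (M N : gstruct) (I : seq nat -> seq nat -> Prop).

Hypothesis I0 : I [::] [::].
Hypothesis forth : forall s t, I s t -> forall x, exists y, I (x :: s) (y :: t).
Hypothesis back : forall s t, I s t -> forall y, exists x, I (x :: s) (y :: t).
Hypothesis atomic : forall s t, I s t -> forall p q r,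
  p \in zip s t -> q \in zip s t -> r \in zip s t ->
  (p.1 = q.1 <-> p.2 = q.2) /\ (add M p.1 q.1 = r.1 <-> add N p.2 q.2 = r.2).

Lemma back_and_forth :
  exists2 g, bijective g & forall x y, g (add M x y) = add N (g x) (g y).
Proof.
pose V (p : seq nat * seq nat) := I p.1 p.2.
pose R (p q : seq nat * seq nat) := {subset zip p.1 p.2 <= zip q.1 q.2}.
pose D n (p : seq nat * seq nat) :=
  (exists y, (n, y) \in zip p.1 p.2) /\ (exists x, (x, n) \in zip p.1 p.2).
have [|u [_ hu]] := @chain _ V R D ([::], [::]) I0.
  move=> n [s t] /forth /(_ n)[y] /back /(_ n)[x] st.
  exists ([:: x, n & s], [:: n, y & t]); split=> //=.
    by move=> p pst; rewrite !inE pst !orbT.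
  by split; [exists y|exists x]; rewrite !inE eqxx ?orbT.
(* The graph of the isomorphism is the union of the finite matchings; three of its pairs always lie
   in a common stage, where [atomic] applies. *)
pose G p := exists n, p \in zip (u n).1 (u n).2.
have mono m n : m <= n -> {subset zip (u m).1 (u m).2 <= zip (u n).1 (u n).2}.
  move=> /subnK <-; elim: (n - m) => // k IH p /IH; rewrite addSn.
  by have [_ /(_ p)] := hu (k + m).
have total x : exists y, G (x, y).
  by have [_ _ [[y xy] _]] := hu x; exists y, x.+1.
have surj y : exists x, G (x, y).
  by have [_ _ [_ [x xy]]] := hu y; exists x, y.+1.
have at3 p q r : G p -> G q -> G r ->
    (p.1 = q.1 <-> p.2 = q.2) /\ (add M p.1 q.1 = r.1 <-> add N p.2 q.2 = r.2).
  move=> [i pi] [j qj] [k rk]; pose n := i + j + k.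
  have [Vn _ _] := hu n; apply: (atomic Vn).
  - by apply: mono pi; rewrite /n; lia.
  - by apply: mono qj; rewrite /n; lia.
  - by apply: mono rk; rewrite /n; lia.
have [g hg] := choice total; have [h hh] := choice surj.
have e1 p q : G p -> G q -> (p.1 = q.1 <-> p.2 = q.2).
  by move=> Gp Gq; have [] := at3 _ _ _ Gp Gq Gp.
exists g; first exists h.
- by move=> x; apply/(e1 (h (g x), g x) (x, g x)).
- by move=> y; apply/(e1 (h y, g (h y)) (h y, y)).
- by move=> x y; have [_ [+ _]] := at3 _ _ _ (hg x) (hg y) (hg (add M x y)) => ->.
Qed.

End BackAndForth.

(** * Formulas in the language of groups *)

(** A letter is a tree node together with the integer added to the entry that follows this node; see
    [act]. *)
Definition word := seq (seq int * int).

(** [Proj l d w] starts from level [l + d.+1], so its source is strictly above its target for every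
    value of the parameters. This allows the partial map to be the identity on the target. *)
Inductive rel_index :=
| SortY of nat
| SortX
| Proj of nat & nat & word
| Att of nat & word
| Lab1
| Lab2
| Diag
| EdgeU.

Definition rel_index_encode (i : rel_index) : nat + (nat * nat * word) + (nat * word) + nat :=
  match i with
  | SortY k => inl (inl (inl k))
  | Proj l d w => inl (inl (inr (l, d, w)))
  | Att k w => inl (inr (k, w))
  | SortX => inr 0
  | Lab1 => inr 1
  | Lab2 => inr 2
  | Diag => inr 3
  | EdgeU => inr 4
  end.

Definition rel_index_decode (x : nat + (nat * nat * word) + (nat * word) + nat) : rel_index :=
  match x with
  | inl (inl (inl k)) => SortY k
  | inl (inl (inr (l, d, w))) => Proj l d w
  | inl (inr (k, w)) => Att k w
  | inr 0 => SortX
  | inr 1 => Lab1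
  | inr 2 => Lab2
  | inr 3 => Diag
  | inr _ => EdgeU
  end.

Lemma rel_index_encodeK : cancel rel_index_encode rel_index_decode.
Proof. by case. Qed.

HB.instance Definition _ := Countable.copy rel_index (can_type rel_index_encodeK).

Fixpoint prime_seq (n : nat) : nat :=
  if n is m.+1 then s2val (prime_above (prime_seq m)) else 2.

Lemma prime_prime_seq n : prime (prime_seq n).
Proof. by case: n => //= n; case: prime_above. Qed.

Lemma prime_seq_inj : injective prime_seq.
Proof.
have lt n d : prime_seq n < prime_seq (n + d.+1).
  elim: d => [|d IH]; rewrite addnS /=; case: prime_above => //= p; first by rewrite addn0.
  by move=> + _; exact: ltn_trans.
by move=> m n e; case: (ltngtP m n) => // /subnKC h; [have := lt m (n - m.+1)|
  have := lt n (m - n.+1)]; rewrite addnS -addSn h e ltnn.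
Qed.

Definition rel_prime (i : rel_index) : nat := prime_seq (pickle i).

Section Predicates.
Variable M : gstruct.

Definition nsm (n x : nat) : nat := iter n (add M x) (zero M).

Definition zsm (z : int) (x : nat) : nat :=
  match z with Posz n => nsm n x | Negz n => opp M (nsm n.+1 x) end.

Definition sb (x y : nat) : nat := add M x (opp M y).

(** The multiplier [m] clears denominators, so that the condition is equivalent to the vanishing of
    a rational linear map. *)
Definition divisible (i : rel_index) (x : nat) : Prop :=
  exists m, 0 < m /\ forall n, exists c, nsm (rel_prime i ^ n) c = nsm m x.

(** Expresses that [z] is the sum of the [r] times the right translate of [x] by [w]. Each summand
    is reached through a lift [u] one level higher: its plain projection is [r] times [x], its
    translated projection is the increment [sb z y]. *)
Fixpoint translate_sum (k : nat) (l : seq (int * word)) (x z : nat) : Prop :=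
  if l is (r, w) :: l' then
    exists y u, translate_sum k l' x y /\ divisible (SortY k) (sb z y) /\
      divisible (SortY k.+1) u /\
      divisible (Proj k 0 [::]) (sb u (zsm r x)) /\ divisible (Proj k 0 w) (sb u (sb z y))
  else z = zero M.

(** In the rational group ring of level [k], this says that right multiples of [x] exhaust the level
    up to denominators, that is, that [x] is right invertible. *)
Definition frame (k x : nat) : Prop :=
  x <> zero M /\ divisible (SortY k) x /\
  forall z, divisible (SortY k) z ->
    exists m, 0 < m /\ exists l, translate_sum k l x (nsm m z).

(** All levels are required because a sum of several branches is only detected at a level where
    these branches have separated. *)
Definition point (x : nat) : Prop :=
  x <> zero M /\ divisible SortX x /\
  forall k, exists m, 0 < m /\
    exists y, frame k y /\ divisible (Att k [::]) (sb (nsm m x) y).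

(** The two nonzero multipliers are there because points are only definable up to a rational
    scalar. *)
Definition similar (i : rel_index) (x y : nat) : Prop :=
  exists m m' : int, m <> 0%R /\ m' <> 0%R /\ divisible i (sb (zsm m x) (zsm m' y)).

Definition vertex (x : nat) : Prop := point x /\ divisible Diag x.

Definition adjacent (x y : nat) : Prop :=
  exists z, point z /\ divisible EdgeU z /\ similar Lab1 z x /\ similar Lab2 z y.

End Predicates.

Section PredicateDefinability.

Lemma defterm_nsm k n t : @defterm n t -> defterm (fun M a => nsm M k (t M a)).
Proof.
by move=> dt; elim: k => [|k IH]; [exact: defterm_zero|exact: (defterm_add dt IH)].
Qed.

Lemma defterm_zsm z n t : @defterm n t -> defterm (fun M a => zsm M z (t M a)).
Proof.
by case: z => k dt; [exact: defterm_nsm|exact: (defterm_opp (defterm_nsm k.+1 dt))].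
Qed.

Lemma defterm_sb n t u : @defterm n t -> @defterm n u ->
  defterm (fun M a => sb M (t M a) (u M a)).
Proof. by move=> dt du; exact: (defterm_add dt (defterm_opp du)). Qed.

Ltac dterm := repeat first [ assumption | apply: defterm_head | apply: defterm_zero
  | apply: defterm_nsm | apply: defterm_zsm | apply: defterm_sb | refine (@defterm_behead _ (fun=> @thead _ nat) _)
  | refine (@defterm_behead _ (fun _ b => thead (behead_tuple b)) _)
  | match goal with
    | t : gstruct -> tuple_of ?n nat -> nat |-
        defterm (fun M a => ?t M (behead_tuple (behead_tuple (behead_tuple a)))) =>
        refine (@defterm_behead _ (fun M (b : n.+2.-tuple nat) =>
          t M (behead_tuple (behead_tuple b))) _)
    | t : gstruct -> tuple_of ?n nat -> nat |-
        defterm (fun M a => ?t M (behead_tuple (behead_tuple a))) =>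
        refine (@defterm_behead _ (fun M (b : n.+1.-tuple nat) => t M (behead_tuple b)) _)
    | |- defterm (fun M a => ?t M (behead_tuple a)) => refine (@defterm_behead _ t _)
    end ].

Lemma def_divisible i : def1 (fun M x => divisible M i x).
Proof.
move=> n t dt; apply: definable_exc => m; apply: definable_and; first exact: definable_cst.
by apply: definable_allc => k; apply: definable_ex; apply: definable_eq; dterm.
Qed.

Lemma def_translate_sum k l : def2 (fun M x z => translate_sum M k l x z).
Proof.
elim: l => [|[r w] l IH] n t u dt du /=; first by apply: definable_eq; dterm.
do 2!apply: definable_ex; apply: definable_and; first by apply: IH; dterm.
by do 3!(apply: definable_and; first by apply: def_divisible; dterm);
  apply: def_divisible; dterm.
Qed.

Lemma def_frame k : def1 (fun M x => frame M k x).
Proof.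
move=> n t dt; apply: definable_and.
  by apply: definable_not; apply: definable_eq; dterm.
apply: definable_and; first exact: def_divisible.
apply: definable_all; apply: definable_imp; first by apply: def_divisible; dterm.
apply: definable_exc => m; apply: definable_and; first exact: definable_cst.
by apply: definable_exc => l; apply: def_translate_sum; dterm.
Qed.

Lemma def_point : def1 point.
Proof.
move=> n t dt; apply: definable_and.
  by apply: definable_not; apply: definable_eq; dterm.
apply: definable_and; first exact: def_divisible.
apply: definable_allc => k; apply: definable_exc => m.
apply: definable_and; first exact: definable_cst.
apply: definable_ex; apply: definable_and; first by apply: def_frame; dterm.
by apply: def_divisible; dterm.
Qed.

Lemma def_similar i : def2 (fun M x y => similar M i x y).
Proof.
move=> n t u dt du; apply: definable_exc => m; apply: definable_exc => m'.
do 2!(apply: definable_and; first exact: definable_cst).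
by apply: def_divisible; dterm.
Qed.

Lemma def_vertex : def1 vertex.
Proof.
by move=> n t dt; apply: definable_and; [exact: def_point|exact: def_divisible].
Qed.

Lemma def_adjacent : def2 adjacent.
Proof.
move=> n t u dt du; apply: definable_ex; apply: definable_and.
  by apply: def_point; dterm.
apply: definable_and; first by apply: def_divisible; dterm.
by apply: definable_and; apply: def_similar; dterm.
Qed.

End PredicateDefinability.

Import Order.TTheory GRing.Theory Num.Theory.

(** * Vectors and the group of a family of partial maps *)

Section Vectors.
Local Open Scope ring_scope.

(** Polynomials serve as finitely supported rational vectors, with ['X^b] for the basis vector
    [e_b]: they form a countable type, and only their linear structure matters. [lin f] is the
    linear extension of [f]. *)
Definition lin (f : nat -> {poly rat}) (a : {poly rat}) : {poly rat} :=
  \sum_(b < size a) a`_b *: f b.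

Lemma lin_widen f (a : {poly rat}) n : (size a <= n)%N -> lin f a = \sum_(b < n) a`_b *: f b.
Proof.
move=> an; rewrite /lin -(big_mkord xpredT (fun b => a`_b *: f b)).
rewrite -(big_mkord xpredT (fun b => a`_b *: f b)) [RHS](big_cat_nat _ an) //=.
rewrite [X in _ = _ + X]big_nat_cond [X in _ = _ + X]big1 ?addr0 // => b /andP[/andP[ab _] _].
by rewrite nth_default // scale0r.
Qed.

Lemma lin_is_linear f : linear (lin f).
Proof.
move=> c a b; pose n := maxn (size (c *: a + b)) (maxn (size a) (size b)).
rewrite !(@lin_widen f _ n) ?leq_max ?leqnn ?orbT // scaler_sumr -big_split /=.
by apply: eq_bigr => i _; rewrite coefD coefZ scalerDl scalerA.
Qed.

HB.instance Definition _ f :=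
  GRing.isLinear.Build rat {poly rat} {poly rat} _ (lin f) (lin_is_linear f).

Lemma linXn f c : lin f 'X^c = f c.
Proof.
rewrite /lin size_polyXn big_ord_recr /= coefXn eqxx scale1r big1 ?add0r //.
by move=> i _; rewrite coefXn ltn_eqF // scale0r.
Qed.

Lemma eq_lin f g : f =1 g -> lin f =1 lin g.
Proof. by move=> fg a; apply: eq_bigr => b _; rewrite fg. Qed.

Lemma eq_in_lin f g (a : {poly rat}) : (forall b, a`_b != 0 -> f b = g b) -> lin f a = lin g a.
Proof.
move=> fg; apply: eq_bigr => b _.
by have [->|/fg->//] := eqVneq a`_b 0; rewrite !scale0r.
Qed.

Lemma lin_id a : lin (fun b => 'X^b) a = a.
Proof.
by rewrite /lin -[RHS]coefK poly_def.
Qed.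

Lemma lin_comp f g a : lin f (lin g a) = lin (fun b => lin f (g b)) a.
Proof. by rewrite {2}/lin linear_sum; apply: eq_bigr => b _; rewrite linearZ. Qed.

Lemma linB f g a : lin (fun b => f b - g b) a = lin f a - lin g a.
Proof. by rewrite -sumrB; apply: eq_bigr => b _; rewrite scalerBr. Qed.

Lemma lin0 a : lin (fun=> 0) a = 0.
Proof. by apply: big1 => b _; rewrite scaler0. Qed.

Definition vec (o : option nat) : {poly rat} := oapp (fun c => 'X^c) 0 o.

Lemma coef_vec o c : (vec o)`_c = (o == Some c)%:R.
Proof.
case: o => [b|] /=; last by rewrite coef0.
by rewrite coefXn eq_sym.
Qed.

Definition intpoly (a : {poly rat}) : bool := a \is a polyOver (@Num.int rat).

Lemma intpoly_vec o : intpoly (vec o).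
Proof.
by apply/polyOverP => i; rewrite coef_vec; case: eqP.
Qed.

Lemma clear_denominators (s : seq rat) :
  exists2 m, (0 < m)%N & forall q, q \in s -> m%:R * q \is a Num.int.
Proof.
elim: s => [|q s [m m0 hm]]; first by exists 1%N.
exists (m * `|denq q|)%N; first by rewrite muln_gt0 m0 absz_gt0 denq_neq0.
move=> r; rewrite inE natrM => /predU1P[->|/hm rm]; last first.
  by rewrite -mulrA (mulrC _ r) mulrA; apply: rpredM => //; exact: natr_int.
rewrite -mulrA; apply: rpredM; first exact: natr_int.
rewrite pmulrn gez0_abs ?denq_ge0 // -{2}(divq_num_den q) mulrCA divff ?mulr1 ?rpred_int //.
by rewrite intr_eq0 denq_neq0.
Qed.

Lemma intpoly_multiple (a : {poly rat}) : exists2 m, (0 < m)%N & intpoly (m%:R *: a).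
Proof.
have [m m0 hm] := clear_denominators a; exists m => //.
apply/polyOverP => i; rewrite coefZ.
have [ai|ai] := ltnP i (size a); first by apply: hm; exact: mem_nth.
by rewrite nth_default // mulr0.
Qed.

End Vectors.

(** * Rationals integral at a prime *)

Section LocalIntegers.
Local Open Scope ring_scope.

(** For a prime [p], membership in the localization of the integers at [p]. *)
Definition pint (p : nat) (q : rat) : Prop :=
  exists2 d, coprime d p & d%:R * q \is a Num.int.

Lemma pint_int p q : q \is a Num.int -> pint p q.
Proof. by move=> qi; exists 1%N; rewrite ?coprime1n // mul1r. Qed.

Lemma pintD p q r : pint p q -> pint p r -> pint p (q + r).
Proof.
move=> [d dp di] [e ep ei]; exists (d * e)%N; first by rewrite coprimeMl dp.
rewrite mulrDr natrM mulrAC -(mulrA _ _ r).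
by apply: rpredD; apply: rpredM => //; exact: natr_int.
Qed.

Lemma pint_sum (I : eqType) p (s : seq I) (F : I -> rat) :
  (forall i, i \in s -> pint p (F i)) -> pint p (\sum_(i <- s) F i).
Proof.
elim: s => [|i s IH] h; first by rewrite big_nil; apply: pint_int; exact: rpred0.
rewrite big_cons; apply: pintD; first by apply: h; rewrite mem_head.
by apply: IH => j js; apply: h; rewrite inE js orbT.
Qed.

Let nat_of_int (q : rat) : q \is a Num.int -> exists2 z : nat, `|q| = z%:R & True.
Proof.
by move=> /intrP[z ->]; exists `|z|%N => //; rewrite pmulrn abszE intr_norm.
Qed.

Let frac_abs (q : rat) : `|q| * `|denq q|%N%:R = `|numq q|%N%:R.
Proof.
rewrite !pmulrn !abszE !intr_norm -normrM; congr `|_|.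
by rewrite -{1}(divq_num_den q) divfK // intr_eq0 denq_neq0.
Qed.

Lemma pint_divisible0 p q : prime p ->
  (forall n, exists2 r, pint p r & q = (p ^ n)%:R * r) -> q = 0.
Proof.
(* The numerator itself is a large enough exponent: [p ^ n] would divide [n], although it exceeds
   [n]. *)
move=> pp hq; apply: contrapT => /eqP q0; pose n := `|numq q|%N.
have [r [d dp /nat_of_int[t tE _]] qE] := hq n.
have : (d * `|numq q| = p ^ n * t * `|denq q|)%N.
  apply/eqP; rewrite -(eqr_nat rat) !natrM -frac_abs -tE mulrA; apply/eqP; congr (_ * _).
  by rewrite {1}qE !normrM !normr_nat mulrCA.
move=> /(congr1 (dvdn (p ^ n))); rewrite -mulnA [RHS]dvdn_mulr // Gauss_dvdr; last first.
  by rewrite coprime_sym; exact: coprimeXr.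
move=> /dvdn_leq; rewrite absz_gt0 numq_eq0 q0 => /(_ isT).
by rewrite leqNgt ltn_expl // prime_gt1.
Qed.

Lemma int_of_pint q : (forall p, prime p -> pint p q) -> q \is a Num.int.
Proof.
move=> hq; suff d1 : `|denq q|%N == 1%N.
  rewrite -(divq_num_den q); suff -> : denq q = 1 by rewrite divr1 rpred_int.
  by rewrite -(gez0_abs (denq_ge0 q)) (eqP d1).
rewrite eqn_leq absz_gt0 denq_neq0 andbT leqNgt; apply/negP => /pdivP[p pp pden].
have [d dp /nat_of_int[t tE _]] := hq p pp.
have : (d * `|numq q| = t * `|denq q|)%N.
  apply/eqP; rewrite -(eqr_nat rat) !natrM -frac_abs -tE mulrA; apply/eqP.
  by rewrite normrM normr_nat.
move=> /(congr1 (dvdn p)); rewrite [RHS]dvdn_mull // Gauss_dvdr 1?coprime_sym // => pnum.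
have := coprime_num_den q; rewrite /coprime => /eqP g1.
by have := dvdn_gcd p `|numq q| `|denq q|; rewrite pnum pden g1 Euclid_dvd1.
Qed.

End LocalIntegers.

(** * The group generated by prescribed divisibilities *)

Section GeneratedGroup.
Local Open Scope ring_scope.
Variable kap : rel_index -> nat -> option nat.

(* (z, i, n, b, o) codes the vector (z / p_i ^ n) (e_b - e_o). *)
Definition gen : Type := int * rel_index * nat * nat * option nat.

Definition gvec (g : gen) : {poly rat} :=
  let: (z, i, n, b, o) := g in
  (z%:~R / (rel_prime i ^ n)%:R) *: (vec (Some b) - vec o).

(** When [o] is [None] the second alternative reads [kap i b = None], which is the case where [e_b]
    itself becomes divisible. *)
Definition gvalid (g : gen) : Prop :=
  let: (z, i, n, b, o) := g in n = 0%N \/ kap i b = obind (kap i) o.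

Definition spanned (a : {poly rat}) : Prop :=
  exists2 l : seq gen, (forall g, g \in l -> gvalid g) & a = \sum_(g <- l) gvec g.

Lemma spanned0 : spanned 0.
Proof. by exists [::]; rewrite ?big_nil. Qed.

Lemma spannedD a b : spanned a -> spanned b -> spanned (a + b).
Proof.
move=> [l hl ->] [l' hl' ->]; exists (l ++ l'); last by rewrite big_cat.
by move=> g; rewrite mem_cat => /orP[/hl|/hl'].
Qed.

Lemma spannedN a : spanned a -> spanned (- a).
Proof.
move=> [l hl ->].
exists [seq (let: (z, i, n, b, o) := g in (- z, i, n, b, o)) | g <- l].
  by move=> _ /mapP[[[[[z i] n] b] o] /hl h ->].
rewrite big_map -sumrN; apply: eq_bigr => -[[[[z i] n] b] o] _ /=.
by rewrite mulrNz mulNr scaleNr.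
Qed.

Lemma spanned_sum (I : Type) (s : seq I) (F : I -> {poly rat}) :
  (forall i, spanned (F i)) -> spanned (\sum_(i <- s) F i).
Proof. by move=> sF; elim/big_rec: _ => [|i a _]; [exact: spanned0|exact: spannedD]. Qed.

Lemma spannedMn a n : spanned a -> spanned (a *+ n).
Proof.
by move=> sa; elim: n => [|n IH]; [rewrite mulr0n; exact: spanned0|rewrite mulrS; exact: spannedD].
Qed.

Lemma spanned_gvec g : gvalid g -> spanned (gvec g).
Proof.
by move=> vg; exists [:: g]; rewrite ?big_seq1 // => h; rewrite inE => /eqP->.
Qed.

Lemma spanned_intpoly a : intpoly a -> spanned a.
Proof.
move=> /polyOverP ia; rewrite -[a]lin_id; apply: spanned_sum => b.
have /intrP[z ->] := ia b.
have := @spanned_gvec (z, SortX, 0%N, b : nat, None) (or_introl erefl).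
by rewrite /= subr0 expn0 divr1.
Qed.

Definition klin (i : rel_index) : {poly rat} -> {poly rat} := lin (fun b => vec (kap i b)).

Lemma klinXn i b : klin i 'X^b = vec (kap i b).
Proof. exact: linXn. Qed.

HB.instance Definition _ i := GRing.Linear.copy (klin i) (lin (fun b => vec (kap i b))).

(** Generators divided by powers of [p] are killed by [lin f], and all other denominators are
    coprime to [p]. Taking [f] arbitrary also covers the primes attached to no relation, where [f]
    is the standard basis. *)
Lemma spanned_pint p f a c : prime p -> (forall b, intpoly (f b)) ->
  (forall i b o, rel_prime i = p -> kap i b = obind (kap i) o -> f b = oapp f 0 o) ->
  spanned a -> pint p (lin f a)`_c.
Proof.
move=> pp fint fp [l hl ->]; rewrite linear_sum coef_sum; apply: pint_sum => g /hl.
case: g => [[[[z i] n] b] o] /= vg; rewrite linearZ coefZ.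
have fo : lin f (vec o) = oapp f 0 o by case: o {vg} => [o|] /=; rewrite ?linXn ?linear0.
rewrite linearB /= linXn fo.
have fbo : (f b - oapp f 0 o)`_c \is a Num.int.
  rewrite coefB; apply: rpredB; first by have /polyOverP := fint b.
  by case: o {vg fo} => [o|] /=; [have /polyOverP := fint o|rewrite coef0; exact: rpred0].
case: vg => [->|vg].
  by apply: pint_int; rewrite expn0 divr1; apply: rpredM => //; exact: rpred_int.
have [ip|ip] := eqVneq (rel_prime i) p.
  by rewrite (fp i b o) // subrr coef0 mulr0; apply: pint_int; exact: rpred0.
have qp : prime (rel_prime i) by exact: prime_prime_seq.
exists (rel_prime i ^ n)%N; first by apply: coprimeXl; rewrite prime_coprime // dvdn_prime2.
rewrite mulrA mulrCA divff ?mulr1; last by rewrite pnatr_eq0 expn_eq0 -leqn0 leqNgt prime_gt0.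
by apply: rpredM => //; exact: rpred_int.
Qed.

(** Infinite divisibility passes to the coefficients of [klin i a], which are integral at the prime
    and must vanish. Conversely, a vector in the kernel is a combination of differences inside the
    fibres of [kap i], and these differences are divisible by construction. *)
Lemma divisible_klin i a : spanned a ->
  (exists2 m, (0 < m)%N & forall n, exists2 c, spanned c & (rel_prime i ^ n)%:R *: c = m%:R *: a) <->
  klin i a = 0.
Proof.
have pp : prime (rel_prime i) by exact: prime_prime_seq.
move=> sa; split=> [[m m0 hm]|ka].
  apply/polyP => c; rewrite coef0; apply: (@mulfI _ (m%:R : rat)).
    by rewrite pnatr_eq0 -lt0n.
  rewrite mulr0; apply: (@pint_divisible0 (rel_prime i)) => // n.
  have [b sb eb] := hm n; exists (klin i b)`_c.
    apply: spanned_pint => // [b'|j b' o /prime_seq_inj/(pcan_inj (@pickleK _)) -> ->].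
      exact: intpoly_vec.
    by case: o.
  by rewrite -!coefZ -!linearZ eb.
(* [r] picks a representative in each fibre of [kap i]. *)
have [r rP] : exists r, forall b c, kap i b = Some c -> kap i (r c) = Some c.
  have /choice[r rP] : forall c, exists b, forall b', kap i b' = Some c -> kap i b = Some c.
    move=> c; have [[b bc]|nb] := pselect (exists b, kap i b = Some c); first by exists b.
    by exists 0%N => b bc; case: nb; exists b.
  by exists r => b c /rP.
pose rho b := omap r (kap i b).
have rhoP b : kap i b = obind (kap i) (rho b).
  by rewrite /rho; case e: (kap i b) => [c|] //=; rewrite (rP _ _ e).
(* The sum of the representatives is the image of [klin i a] under a linear map, hence zero;
   subtracting it leaves [a] unchanged. *)
have aE : a = lin (fun b => vec (Some b) - vec (rho b)) a.
  rewrite linB lin_id [X in _ - X](_ : _ = lin (fun c => 'X^(r c)) (klin i a)).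
    by rewrite ka linear0 subr0.
  rewrite lin_comp; apply: eq_lin => b; rewrite /rho.
  by case: (kap i b) => [c|] /=; rewrite ?linXn ?linear0.
have [m m0 /polyOverP im] := intpoly_multiple a; exists m => // n.
exists (\sum_(b < size a) ((m%:R * a`_b) / (rel_prime i ^ n)%:R) *: (vec (Some (val b)) - vec (rho b))).
  apply: spanned_sum => b; have := im b; rewrite coefZ => /intrP[z ->].
  exact: (@spanned_gvec (z, i, n, val b, rho b) (or_intror (rhoP b))).
rewrite [in RHS]aE /lin !scaler_sumr; apply: eq_bigr => b _; rewrite !scalerA; congr (_ *: _).
by rewrite mulrC divfK // pnatr_eq0 expn_eq0 -leqn0 leqNgt prime_gt0.
Qed.

End GeneratedGroup.

Lemma spanned_lin (kap kap' : rel_index -> nat -> option nat) (f : nat -> nat) :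
  (forall i b b', kap i b = kap i b' -> kap' i (f b) = kap' i (f b')) ->
  (forall i b, kap i b = None -> kap' i (f b) = None) ->
  forall a, spanned kap a -> spanned kap' (lin (fun b => 'X^(f b))%R a).
Proof.
move=> fS fN a [l hl ->]; rewrite linear_sum /=.
elim: l hl => [|g l IH] hl; first by rewrite big_nil; exact: spanned0.
rewrite big_cons; apply: spannedD; last by apply: IH => h hl'; apply: hl; rewrite inE hl' orbT.
have := hl g (mem_head _ _); case: g {hl} => [[[[z i] n] b] o] /= vg.
have fE : lin (fun b => 'X^(f b))%R (gvec (z, i, n, b, o)) = gvec (z, i, n, f b, omap f o).
  rewrite /= linearZ linearB /= linXn; congr (_ *: (_ - _))%R.
  by case: (o) => [c|] /=; rewrite ?linXn ?linear0.
rewrite {}fE; apply: spanned_gvec => /=; case: vg => [->|vg]; [by left|right; move: vg].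
by case: o => [c|] /= vg; [exact: fS|exact: fN].
Qed.

(** * Automorphisms of the tree of finite integer sequences *)

Section Tree.
Local Open Scope ring_scope.
Implicit Types (s t u v : seq int) (H : seq int -> int) (w : word).

(** An automorphism of the tree that translates the children of each node [u] by [H u]. *)
Definition shift H t : seq int :=
  mkseq (fun i => nth 0 t i + H (take i t)) (size t).

Lemma size_shift H t : size (shift H t) = size t.
Proof. exact: size_mkseq. Qed.

Lemma nth_shift H t i : (i < size t)%N ->
  nth 0 (shift H t) i = nth 0 t i + H (take i t).
Proof. exact: nth_mkseq. Qed.

Lemma take_shift H t i : take i (shift H t) = shift H (take i t).
Proof.
apply: (@eq_from_nth _ 0) => [|j]; rewrite size_take_min size_shift.
  by rewrite size_shift size_take_min.
move=> jt.
have [ji jt'] : (j < i)%N /\ (j < size t)%N by move: jt; rewrite leq_min => /andP[].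
rewrite nth_take // nth_shift // nth_shift ?size_take_min ?leq_min ?ji //.
by rewrite nth_take // take_takel // ltnW.
Qed.

Lemma shift_comp H H' t :
  shift H (shift H' t) = shift (fun u => H' u + H (shift H' u)) t.
Proof.
apply: (@eq_from_nth _ 0) => [|i]; rewrite !size_shift // => it.
by rewrite !nth_shift ?size_shift // take_shift addrA.
Qed.

Definition node s (c : int) : seq int -> int := fun t => if t == s then c else 0.

Definition act w t : seq int := foldr (fun g => shift (node g.1 g.2)) t w.

Lemma act_cat w w' t : act (w ++ w') t = act w (act w' t).
Proof. exact: foldr_cat. Qed.

Lemma act_shift w : exists H, act w =1 shift H.
Proof.
elim: w => [|[s c] w [H wH]]; last first.
  by eexists => t; rewrite /= -/(act w t) wH shift_comp.
exists (fun=> 0) => t; apply: (@eq_from_nth _ 0); rewrite ?size_shift // => i it.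
by rewrite nth_shift // addr0.
Qed.

Lemma size_act w t : size (act w t) = size t.
Proof. by have [H ->] := act_shift w; exact: size_shift. Qed.

Lemma take_act w t i : take i (act w t) = act w (take i t).
Proof. by have [H wH] := act_shift w; rewrite !wH; exact: take_shift. Qed.

Definition inverse_word w : word := rev [seq (g.1, - g.2) | g <- w].

Lemma inverse_wordK w : inverse_word (inverse_word w) = w.
Proof.
rewrite /inverse_word map_rev revK -map_comp map_id_in // => -[s c] _ /=.
by rewrite opprK.
Qed.

Lemma act_inverse w : cancel (act w) (act (inverse_word w)).
Proof.
elim: w => // -[s c] w IH t; rewrite /inverse_word /= rev_cons -cats1 act_cat.
rewrite -[in RHS](IH t) -/(inverse_word w) /= -/(act w t); congr act.
set u := act w t; apply: (@eq_from_nth _ 0) => [|i]; rewrite !size_shift // => iu.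
rewrite !nth_shift ?size_shift // take_shift.
(* The letter alters nothing up to length [size s], and longer prefixes differ from [s] before and
   after; so both letters act at the same place. *)
suff -> : node s (- c) (shift (node s c) (take i u)) = - node s c (take i u) by rewrite addrK.
have fix_shift v : (size v <= size s)%N -> shift (node s c) v = v.
  move=> vs; apply: (@eq_from_nth _ 0); rewrite size_shift // => j jv.
  rewrite nth_shift // /node; case: eqP => [e|_]; last by rewrite addr0.
  by move: (leq_trans jv vs); rewrite -e size_take jv ltnn.
have [vs|vs] := leqP (size (take i u)) (size s).
  by rewrite fix_shift // /node; case: eqP => // _; rewrite oppr0.
rewrite /node !ifN ?oppr0 //; apply: contraL vs => /eqP <-; rewrite ?size_shift;
  by rewrite -leqNgt.
Qed.

Lemma act_inverse' w : cancel (act (inverse_word w)) (act w).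
Proof. by move=> t; rewrite -{1}(inverse_wordK w) act_inverse. Qed.

Lemma act_inj w : injective (act w).
Proof. exact: can_inj (act_inverse w). Qed.

(** One letter for each node of length [k] in [l]: such letters act only on entries at position [k]
    or later, and letters at different nodes do not interfere at that position. *)
Lemma act_extend k (l : seq (seq int)) (d : seq int -> int) : uniq l ->
  exists w, (forall t, (size t <= k)%N -> act w t = t) /\
    forall v a, size v = k -> act w (rcons v a) = rcons v (a + if v \in l then d v else 0).
Proof.
elim: l => [_|s l IH] /=; first by exists [::]; split=> // v a _; rewrite addr0.
move=> /andP[sl ul]; have [w [wk wl]] := IH ul.
have [sk|sk] := eqVneq (size s) k; last first.
  exists w; split=> // v a vk; rewrite wl // inE; case: eqP => // e.
  by move: sk; rewrite -e vk eqxx.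
exists ((s, d s) :: w).
have nodeE u : size u != k -> node s (d s) u = 0.
  by move=> uk; rewrite /node; case: eqP => // e; move: uk; rewrite e sk eqxx.
split=> [t tk|v a vk] /=; rewrite -/(act w _).
  rewrite wk //; apply: (@eq_from_nth _ 0); rewrite size_shift // => i it.
  rewrite nth_shift // nodeE ?addr0 // size_take it.
  by rewrite neq_ltn (leq_trans it tk).
rewrite wl //; set b := a + _.
have -> : shift (node s (d s)) (rcons v b) = rcons v (b + node s (d s) v).
  apply: (@eq_from_nth _ 0); rewrite size_shift ?size_rcons // => i ivk.
  rewrite nth_shift ?size_rcons // -cats1 takel_cat // cats1.
  rewrite !nth_rcons; have [iv|iv|->] := ltngtP i (size v); last by rewrite take_size.
  2: by move: ivk iv; rewrite ltnS leqNgt => /negbTE->.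
  rewrite nodeE ?addr0 // size_takel ?(ltnW iv) //.
  by rewrite -vk neq_ltn iv.
rewrite /b /node inE; case: eqP => [->|_] /=; last by rewrite addr0.
by rewrite (negbTE sl) addr0.
Qed.

Definition lexlt u v : Prop :=
  exists i, [/\ (i < size u)%N, take i u = take i v & nth 0 u i < nth 0 v i].

Lemma lexlt_irr u : ~ lexlt u u.
Proof. by case=> i [_ _]; rewrite ltxx. Qed.

Lemma lexlt_trans v u t : lexlt u v -> lexlt v t -> lexlt u t.
Proof.
move=> [i [iu uv uvi]] [j [jv vt vtj]]; have [ij|ji|ij] := ltngtP i j.
- exists i; split=> //.
    by rewrite uv -(take_takel v (ltnW ij)) vt take_takel // ltnW.
  by rewrite (lt_le_trans uvi) // -(nth_take _ ij v) vt nth_take.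
- exists j; split; first exact: ltn_trans ji iu.
    by rewrite -vt -(take_takel u (ltnW ji)) uv take_takel // ltnW.
  by rewrite (le_lt_trans _ vtj) // -(nth_take _ ji u) uv nth_take.
- exists i; split=> //; first by rewrite uv {1}ij vt -ij.
  by rewrite (lt_trans uvi) // ij.
Qed.

Lemma lexlt_total u v : size u = size v -> u <> v -> lexlt u v \/ lexlt v u.
Proof.
move=> uv neq; have ex : exists i, nth 0 u i != nth 0 v i.
  apply: contrapT => nex; apply: neq; apply: (@eq_from_nth _ 0) => // i _.
  by apply/eqP; apply: contrapT => /negP ne; apply: nex; exists i.
have [i ne imin] := ex_minnP ex.
have iu : (i < size u)%N.
  by rewrite ltnNge; apply: contra ne => ui; rewrite !nth_default // -uv.
have te : take i u = take i v.
  apply: (@eq_from_nth _ 0); rewrite ?size_take_min ?uv // => j.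
  rewrite leq_min => /andP[ji _]; rewrite !nth_take //; apply/eqP.
  by apply: contraLR ji => /imin; rewrite leqNgt.
by case: (ltgtP (nth 0 u i) (nth 0 v i)) ne => // lt _; [left|right]; exists i; split; rewrite -?uv.
Qed.

(** Up to the first difference the prefixes agree, so both entries there receive the same
    increment. *)
Lemma lexlt_shift H u v : size u = size v -> lexlt u v -> lexlt (shift H u) (shift H v).
Proof.
move=> suv [i [iu uv lt]]; exists i; rewrite size_shift; split=> //.
  by rewrite !take_shift uv.
by rewrite !nth_shift -?suv // uv ltrD2r.
Qed.

Implicit Types phi psi : seq int -> seq int.

(** For fixed [k] these maps form a group under composition, with unit [take k]; its rational group
    ring is the space of vectors of level [k]. Different words may give the same map. *)
Definition level (k : nat) phi : Prop := exists w, phi = fun t => take k (act w t).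

Lemma size_level k phi t : level k phi -> size (phi t) = minn k (size t).
Proof. by case=> w ->; rewrite size_take_min size_act. Qed.

Lemma level_comp k phi psi : level k phi -> level k psi -> level k (phi \o psi).
Proof.
move=> [w ->] [w' ->]; exists (w ++ w'); apply/funext => t /=.
by rewrite act_cat !take_act take_takel.
Qed.

Lemma level_take k l phi : (l <= k)%N -> level k phi -> level l (take l \o phi).
Proof. by move=> lk [w ->]; exists w; apply/funext => t /=; rewrite take_takel. Qed.

Lemma level_word k w : level k (fun t => take k (act w t)).
Proof. by exists w. Qed.

Lemma level_compr k phi w : level k phi -> level k (phi \o act w).
Proof. by move=> [w' ->]; exists (w' ++ w); apply/funext => t /=; rewrite act_cat. Qed.

Lemma level_cancel k phi phi' psi : level k phi -> level k phi' -> level k psi ->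
  phi \o psi = phi' \o psi -> phi = phi'.
Proof.
move=> [w ->] [w' ->] [v ->] e; apply/funext => t.
have := congr1 (fun f => f (act (inverse_word v) t)) e.
by rewrite /= act_inverse' -!take_act !take_takel.
Qed.

Definition test (n : nat) : seq int := odflt [::] (unpickle n).
Arguments test : simpl never.

Lemma test_pickle t : test (pickle t) = t.
Proof. by rewrite /test pickleK. Qed.

(* A left order: compare at the first tree node that separates. *)
Definition fnlt phi psi : Prop :=
  exists n, (forall m, (m < n)%N -> phi (test m) = psi (test m)) /\
    lexlt (phi (test n)) (psi (test n)).

Lemma fnlt_irr phi : ~ fnlt phi phi.
Proof. by case=> n [_ /lexlt_irr]. Qed.

Lemma fnlt_trans psi phi chi : fnlt phi psi -> fnlt psi chi -> fnlt phi chi.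
Proof.
move=> [m [mE mlt]] [n [nE nlt]]; have [mn|nm|mn] := ltngtP m n.
- exists m; split=> [i im|]; last by rewrite -nE.
  by rewrite mE // nE // (ltn_trans im).
- exists n; split=> [i im|]; last by rewrite mE.
  by rewrite mE ?nE // (ltn_trans im).
- exists m; split=> [i im|]; first by rewrite mE // nE // -mn.
  by apply: lexlt_trans mlt _; rewrite mn.
Qed.

Lemma fnlt_total k phi psi : level k phi -> level k psi -> phi <> psi ->
  fnlt phi psi \/ fnlt psi phi.
Proof.
move=> lphi lpsi ne; have ex : exists n, phi (test n) != psi (test n).
  apply: contrapT => nex; apply: ne; apply/funext => t; apply/eqP.
  by apply: contrapT => /negP ne; apply: nex; exists (pickle t); rewrite test_pickle.
have [n /eqP nn nmin] := ex_minnP ex.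
have mE m : (m < n)%N -> phi (test m) = psi (test m).
  by move=> mn; apply/eqP; apply: contraLR mn => /nmin; rewrite leqNgt.
have [|lt|lt] := lexlt_total _ nn; first by rewrite !(@size_level k).
- by left; exists n.
- by right; exists n; split=> // m /mE.
Qed.

(** Composition on the left changes the compared values by a shift, which preserves [lexlt], and
    leaves the tested nodes alone. Composition on the right would move the tested nodes, so the
    order is invariant on one side only. *)
Lemma fnlt_comp k phi psi psi' : level k phi -> level k psi -> level k psi' ->
  fnlt psi psi' -> fnlt (phi \o psi) (phi \o psi').
Proof.
move=> [w ->] lpsi lpsi' [n [nE nlt]]; exists n; split=> [m mn|] /=; first by rewrite nE.
have [H wH] := act_shift w.
rewrite !take_act !wH !take_oversize ?(@size_level k) ?geq_minl //.
by apply: lexlt_shift => //; rewrite !(@size_level k).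
Qed.

End Tree.

(** * Unique products under a left-invariant order *)

Section UniqueProduct.
Local Open Scope ring_scope.
Variables (I : eqType) (lt : I -> I -> Prop) (D : I -> Prop) (mul : I -> I -> I).
Hypothesis lt_trans : forall y x z, lt x y -> lt y z -> lt x z.
Hypothesis lt_irr : forall x, ~ lt x x.
Hypothesis lt_total : forall x y, D x -> D y -> x <> y -> lt x y \/ lt y x.
Hypothesis mulD : forall x y, D x -> D y -> D (mul x y).
Hypothesis lt_mul : forall x y z, D x -> D y -> D z -> lt y z -> lt (mul x y) (mul x z).
Hypothesis mul_cancel : forall x x' y, D x -> D x' -> D y -> mul x y = mul x' y -> x = x'.

Lemma min_seq (s : seq I) : s != [::] -> (forall x, x \in s -> D x) ->
  exists2 x, x \in s & forall y, y \in s -> x = y \/ lt x y.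
Proof.
elim: s => // x s IH _ Ds; have Dx := Ds x (mem_head _ _).
have [->|s0] := eqVneq s [::].
  by exists x; rewrite ?mem_head // => y; rewrite inE => /eqP; left.
have [|y ys ymin] := IH s0; first by move=> y ys; apply: Ds; rewrite inE ys orbT.
have Dy : D y by apply: Ds; rewrite inE ys orbT.
have [xy|xy] := pselect (lt x y).
  exists x; rewrite ?mem_head // => z; rewrite inE => /predU1P[|/ymin[<-|]]; [by left|by right|].
  by right; exact: lt_trans xy _.
exists y; rewrite ?inE ?ys ?orbT // => z; rewrite inE => /predU1P[->|/ymin//].
by have [e|ne] := pselect (x = y); [left|case: (lt_total Dx Dy ne) => //; right].
Qed.

(** Let [c0] be least in [B] and let [b0] minimize [mul b c0], which need not make [b0] least in
    [A]. Left invariance bounds every product below by [mul b0 c0], and right cancellation shows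
    that only this pair attains it, so its coefficient does not cancel. *)
Lemma min_product (A B : seq I) (al be : I -> rat) :
  uniq A -> uniq B -> A != [::] -> B != [::] ->
  (forall x, x \in A -> D x) -> (forall x, x \in B -> D x) ->
  (forall x, x \in A -> al x != 0) -> (forall x, x \in B -> be x != 0) ->
  exists x, (forall b c, b \in A -> c \in B -> x = mul b c \/ lt x (mul b c)) /\
    \sum_(b <- A) \sum_(c <- B) al b * be c * (mul b c == x)%:R != 0.
Proof.
move=> uA uB A0 B0 DA DB alA beB; have [c0 c0B c0min] := min_seq B0 DB.
have [||_ /mapP[b0 b0A ->] b0min] := @min_seq [seq mul b c0 | b <- A].
- by case: (A) A0.
- by move=> _ /mapP[b bA ->]; apply: mulD; [exact: DA|exact: DB].
have le b c : b \in A -> c \in B -> mul b c0 = mul b c \/ lt (mul b c0) (mul b c).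
  move=> bA cB; have [->|cc] := c0min c cB; first by left.
  by right; apply: lt_mul => //; [exact: DA|exact: DB|exact: DB].
exists (mul b0 c0); split=> [b c bA cB|].
  have [e|l1] := b0min (mul b c0) (map_f _ bA); have [<-|l2] := le b c bA cB.
  - by left.
  - by right; rewrite e.
  - by right.
  - by right; exact: lt_trans l1 l2.
have uniq_pair b c : b \in A -> c \in B -> mul b c = mul b0 c0 -> b = b0 /\ c = c0.
  move=> bA cB e; have cE : c = c0.
    have [//|cc] := c0min c cB; exfalso; apply: (@lt_irr (mul b0 c0)).
    have l2 : lt (mul b c0) (mul b c) by apply: lt_mul => //; [exact: DA|exact: DB|exact: DB].
    rewrite -{2}e; have [->//|l1] := b0min (mul b c0) (map_f _ bA).
    exact: lt_trans l1 l2.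
  split=> //; apply: (@mul_cancel _ _ c0); [exact: DA|exact: DA|exact: DB|].
  by rewrite -e cE.
rewrite (bigD1_seq b0) //= (bigD1_seq c0) //= eqxx mulr1 big1_seq => [|c /andP[cc cB]].
  rewrite addr0 big1_seq ?addr0 => [|b /andP[bb bA]].
    by rewrite mulf_neq0 ?alA ?beB.
  apply: big1_seq => c /andP[_ cB]; case: eqP => [/uniq_pair[] // e|]; last by rewrite mulr0.
  by rewrite e eqxx in bb.
case: eqP => [/uniq_pair[] // _ e|]; last by rewrite mulr0.
by rewrite e eqxx in cc.
Qed.

End UniqueProduct.

(** Both the least and the greatest product have a nonzero coefficient, hence equal [e]. All
    products then equal [e], and right cancellation makes [A] a singleton. *)
Lemma single_product (I : eqType) (lt : I -> I -> Prop) (D : I -> Prop) (mul : I -> I -> I)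
    (A B : seq I) (al be : I -> rat) (e : I) :
  (forall y x z, lt x y -> lt y z -> lt x z) -> (forall x, ~ lt x x) ->
  (forall x y, D x -> D y -> x <> y -> lt x y \/ lt y x) ->
  (forall x y, D x -> D y -> D (mul x y)) ->
  (forall x y z, D x -> D y -> D z -> lt y z -> lt (mul x y) (mul x z)) ->
  (forall x x' y, D x -> D x' -> D y -> mul x y = mul x' y -> x = x') ->
  uniq A -> uniq B -> B != [::] ->
  (forall x, x \in A -> D x) -> (forall x, x \in B -> D x) ->
  (forall x, x \in A -> al x != 0)%R -> (forall x, x \in B -> be x != 0)%R ->
  (forall x, \sum_(b <- A) \sum_(c <- B) al b * be c * (mul b c == x)%:R != 0 -> x = e)%R ->
  forall b b', b \in A -> b' \in A -> b = b'.
Proof.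
move=> ltt lti ltT mD ltm mc uA uB B0 DA DB alA beB he b b' bA b'A.
have A0 : A != [::] by case: (A) bA.
have [x [xmin /he xe]] := min_product ltt lti ltT mD ltm mc uA uB A0 B0 DA DB alA beB.
have gtt y z t : lt y z -> lt t y -> lt t z by move=> yz ty; exact: ltt ty yz.
have gtT u v : D u -> D v -> u <> v -> lt v u \/ lt u v.
  by move=> Du Dv /(ltT _ _ Du Dv)[]; [right|left].
have gtm u v t : D u -> D v -> D t -> lt t v -> lt (mul u t) (mul u v).
  by move=> Du Dv Dt; exact: ltm.
(* The converse order is left-invariant too, so the same lemma yields the greatest product. *)
have [x' [xmax /he xe']] :=
  @min_product _ (fun x y => lt y x) D mul gtt lti gtT mD gtm mc A B al be uA uB A0 B0 DA DB alA beB.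
have all_e a c : a \in A -> c \in B -> mul a c = e.
  move=> aA cB; have := xmin a c aA cB; have := xmax a c aA cB; rewrite xe xe'.
  by move=> [<- //|l1] [<- //|l2]; case: (lti _ (ltt _ _ _ l1 l2)).
case: B B0 DB all_e {uB beB he xmin xmax} => // c B _ DB all_e.
apply: (mc _ _ c); [exact: DA|exact: DA|exact/DB/mem_head|].
by rewrite !all_e // mem_head.
Qed.

(** * The group of a graph *)

Section Basis.

Definition bas : Type := (nat * (seq int -> seq int)) + (nat -> int).

Definition eventually_constant (x : nat -> int) : Prop :=
  exists c N, forall n, N <= n -> x n = c.

Definition in_basis (z : bas) : Prop :=
  match z with
  | inl (k, phi) => level k phi
  | inr x => eventually_constant x
  end.

Definition pad (t : seq int) (c : int) : nat -> int := fun n => nth c t n.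

Lemma pad_eventually t c : eventually_constant (pad t c).
Proof. by exists c, (size t) => n; exact: nth_default. Qed.

Definition precode := ((nat * word) + (seq int * int))%type.

Definition of_precode (p : precode) : bas :=
  match p with
  | inl (k, w) => inl (k, fun t => take k (act w t))
  | inr (t, c) => inr (pad t c)
  end.

Lemma in_basisP z : in_basis z <-> exists p, of_precode p = z.
Proof.
split=> [|[[[k w]|[t c]] <-]]; last 2 first.
- exact: level_word.
- exact: pad_eventually.
case: z => [[k phi] [w ->]|x [c [N xc]]]; first by exists (inl (k, w)).
exists (inr (mkseq x N, c)); congr inr; apply/funext => n; rewrite /pad.
have [nN|Nn] := ltnP n N; first by rewrite nth_mkseq.
by rewrite nth_default ?size_mkseq // xc.
Qed.

(** Many words truncate to the same map and many pairs give the same branch; keeping the least code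
    of each basis element makes [beta] injective. *)
Definition least_code (n : nat) : Prop :=
  exists p : precode, unpickle n = Some p /\
    forall m q, m < n -> unpickle m = Some q -> of_precode q <> of_precode p.

Lemma least_codeP z : in_basis z ->
  exists n, least_code n /\ exists2 p : precode, unpickle n = Some p & of_precode p = z.
Proof.
move=> /in_basisP[p pz].
have ex : exists n, `[< exists2 q : precode, unpickle n = Some q & of_precode q = z >].
  by exists (pickle p); apply/asboolP; exists p; rewrite ?pickleK.
have [n /asboolP[q qn qz] nmin] := ex_minnP ex.
exists n; split; exists q => //; split=> // m r mn rm; rewrite qz => rz.
by move: mn; rewrite ltnNge nmin //; apply/asboolP; exists r.
Qed.

Lemma inj_unbounded (f : nat -> nat) : injective f -> forall m, exists k, m <= f k.
Proof.
move=> f_inj m; apply: contrapT => nex.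
have lt k : f k < m by rewrite ltnNge; apply/negP => mk; apply: nex; exists k.
pose g (i : 'I_m.+1) := Ordinal (lt i).
have g_inj : injective g by move=> i j /(congr1 val) /= /f_inj /val_inj.
by have := leq_card g g_inj; rewrite !card_ord ltnn.
Qed.

Lemma unbounded_least_code : unbounded least_code.
Proof.
have /choice[f fP] : forall k, exists n, least_code n /\
    exists2 p : precode, unpickle n = Some p & of_precode p = inl (k, fun t => take k t).
  by move=> k; apply: least_codeP; exists [::].
have f_inj : injective f.
  move=> k l e; have [_ [p pk pE]] := fP k; have [_ [q qk qE]] := fP l.
  by move: qk qE; rewrite -e pk => -[<-]; rewrite pE => -[].
by move=> m; have [k mk] := inj_unbounded f_inj m; exists (f k); split=> //; case: (fP k).
Qed.

Definition beta (b : nat) : bas :=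
  of_precode (odflt (inl (0, [::])) (unpickle (enum_of least_code b))).

Lemma beta_in b : in_basis (beta b).
Proof. by apply/in_basisP; eexists. Qed.

Lemma beta_inj : injective beta.
Proof.
move=> b c; rewrite /beta.
have [p [pb pmin]] := enum_ofP unbounded_least_code b.
have [q [qc qmin]] := enum_ofP unbounded_least_code c.
rewrite pb qc /= => pq; apply: (enum_of_inj unbounded_least_code).
have [lt|lt|//] := ltngtP (enum_of least_code b) (enum_of least_code c).
  by case: (qmin _ _ lt pb).
by case: (pmin _ _ lt qc).
Qed.

Lemma beta_surj z : in_basis z -> exists b, beta b = z.
Proof.
move=> /least_codeP[n [ln [p pn pz]]].
have [b bn] := enum_of_surj unbounded_least_code ln.
by exists b; rewrite /beta bn pn.
Qed.

Definition code (z : bas) : nat := xget 0 [set b | beta b = z].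

Lemma codeK z : in_basis z -> beta (code z) = z.
Proof. by move=> /beta_surj[b bz]; rewrite /code; case: xgetP => [c _ //|/(_ b)[]]. Qed.

Lemma betaK b : code (beta b) = b.
Proof. by apply: beta_inj; rewrite codeK //; exact: beta_in. Qed.

Lemma code_inj z z' : in_basis z -> in_basis z' -> code z = code z' -> z = z'.
Proof. by move=> /codeK {2}<- /codeK {2}<- ->. Qed.

Definition limit (x : nat -> int) : int :=
  xget 0%R [set c | exists N, forall n, N <= n -> x n = c].

Lemma limitP x c N : (forall n, N <= n -> x n = c) -> limit x = c.
Proof.
move=> xc; rewrite /limit; case: xgetP => [d _ [N' xd]|/(_ c)[]]; last by exists N.
by rewrite -(xd (maxn N N')) ?leq_maxr // xc ?leq_maxl.
Qed.

Lemma limit_pad t c : limit (pad t c) = c.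
Proof. by apply: (@limitP _ _ (size t)) => n; exact: nth_default. Qed.

(** Only the tail counts: every node of the tree lies on branches of every label, so matching finite
    parts of branches never conflicts with labels. *)
Definition label (x : nat -> int) : nat * nat :=
  odflt (0, 0) (unpickle `|limit x|%N).

Definition pad_label (t : seq int) (p : nat * nat) : nat -> int := pad t (Posz (pickle p)).

Lemma label_pad t p : label (pad_label t p) = p.
Proof. by rewrite /label limit_pad /= pickleK. Qed.

Lemma mkseq_pad t c : mkseq (pad t c) (size t) = t.
Proof.
by apply: (@eq_from_nth _ c); rewrite size_mkseq // => i it; rewrite nth_mkseq.
Qed.

Variable H : structure graph_vocabulary.

(* None plays the role of the zero vector: a basis vector sent to None is
   divisible by all the powers of the corresponding prime. *)
Definition kap (i : rel_index) (b : nat) : option nat :=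
  match i, beta b with
  | SortY k, inl (l, _) => if l == k then None else Some b
  | SortX, inr _ => None
  | Proj l d w, inl (k, phi) =>
      if k == l + d.+1 then Some (code (inl (l, take l \o phi \o act w))) else Some b
  | Att k w, inl (l, phi) =>
      if l == k then Some (pickle (phi (act w (nseq k 0%R)))).*2 else Some b.*2.+1
  | Att k _, inr x => Some (pickle (mkseq x k)).*2
  | Lab1, inl _ => Some b.*2.+1
  | Lab1, inr x => Some (label x).1.*2
  | Lab2, inl _ => Some b.*2.+1
  | Lab2, inr x => Some (label x).2.*2
  | Diag, inr x => if (label x).1 == (label x).2 then None else Some b
  | EdgeU, inr x => if edge H (label x).1 (label x).2 then None else Some b
  | _, _ => Some b
  end.

(** Enumerating these codes in increasing order identifies the group with all of [nat], in a way
    that is Borel in the graph. *)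
Definition member_code (n : nat) : Prop :=
  exists a : {poly rat}, n = pickle a /\ spanned kap a.

Lemma unbounded_member_code : unbounded member_code.
Proof.
pose f n := pickle ('X^n : {poly rat})%R.
have f_inj : injective f.
  move=> m n /(pcan_inj (@pickleK _)) /(congr1 (fun p : {poly rat} => size p)).
  by rewrite !size_polyXn => -[].
move=> m; have [k mk] := inj_unbounded f_inj m; exists (f k); split=> //.
by exists 'X^k%R; split=> //; apply: spanned_intpoly; exact: (intpoly_vec (Some k)).
Qed.

Definition elt (n : nat) : {poly rat} := odflt 0%R (unpickle (enum_of member_code n)).

Definition index_of (a : {poly rat}) : nat :=
  next (fun n => enum_of member_code n = pickle a) 0.

Lemma pickle_elt n : pickle (elt n) = enum_of member_code n.
Proof. by rewrite /elt; have [a [-> _]] := enum_ofP unbounded_member_code n; rewrite pickleK. Qed.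

Lemma elt_spanned n : spanned kap (elt n).
Proof.
rewrite /elt; have [a [-> sa]] := enum_ofP unbounded_member_code n.
by rewrite pickleK.
Qed.

Lemma elt_inj : injective elt.
Proof.
by move=> m n /(congr1 pickle); rewrite !pickle_elt; exact: enum_of_inj unbounded_member_code _ _.
Qed.

Lemma index_ofK a : spanned kap a -> elt (index_of a) = a.
Proof.
move=> sa; apply: (pcan_inj (@pickleK _)); rewrite pickle_elt.
have [n hn] := @enum_of_surj _ unbounded_member_code (pickle a) (ex_intro _ a (conj erefl sa)).
have /nextP[[] //|[_ []]] := erefl (next (fun n => enum_of member_code n = pickle a) 0).
by exists n.
Qed.

Definition group_of : gstruct :=
  (fun s => match s return (group_arity s).-tuple nat -> nat with
     | Zero => fun=> index_of 0%R
     | Add => fun t => index_of (elt (nth 0 t 0) + elt (nth 0 t 1))%R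
     | Opp => fun t => index_of (- elt (nth 0 t 0))%R
     end,
   fun r : void => match r with end).

Lemma elt_zero : elt (zero group_of) = 0%R.
Proof. exact/index_ofK/spanned0. Qed.

Lemma elt_add m n : elt (add group_of m n) = (elt m + elt n)%R.
Proof. by apply: index_ofK; apply: spannedD; exact: elt_spanned. Qed.

Lemma elt_opp n : elt (opp group_of n) = (- elt n)%R.
Proof. by apply: index_ofK; apply: spannedN; exact: elt_spanned. Qed.

Lemma elt_nsm k n : elt (nsm group_of k n) = (elt n *+ k)%R.
Proof.
by elim: k => [|k IH]; rewrite ?elt_zero // /nsm iterS elt_add -/(nsm _ k n) IH mulrS.
Qed.

Lemma elt_zsm z n : elt (zsm group_of z n) = (elt n *~ z)%R.
Proof. by case: z => k; rewrite /zsm ?elt_opp elt_nsm. Qed.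

Lemma elt_sb m n : elt (sb group_of m n) = (elt m - elt n)%R.
Proof. by rewrite elt_add elt_opp. Qed.

Lemma group_of_TFAB : TFAB_omega group_of.
Proof.
split; first split.
- by move=> x y z; apply: elt_inj; rewrite !elt_add addrA.
- by move=> x y; apply: elt_inj; rewrite !elt_add addrC.
- by move=> x; apply: elt_inj; rewrite elt_add elt_zero add0r.
- by move=> x; apply: elt_inj; rewrite elt_add elt_opp elt_zero addNr.
move=> n x n0 /(congr1 elt); rewrite -/(nsm group_of n x) elt_nsm elt_zero => /eqP e.
apply: elt_inj; rewrite elt_zero; apply/eqP; move: e.
by rewrite -scaler_nat scaler_eq0 pnatr_eq0 eqn0Ngt n0.
Qed.

Lemma divisibleP i n : divisible group_of i n <-> klin kap i (elt n) = 0%R.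
Proof.
rewrite -divisible_klin; last exact: elt_spanned.
split=> [[m [m0 hm]]|[m m0 hm]]; exists m => //.
  move=> k; have [c hc] := hm k; exists (elt c); first exact: elt_spanned.
  by rewrite !scaler_nat -!elt_nsm hc.
split=> // k; have [c sc hc] := hm k; exists (index_of c).
by apply: elt_inj; rewrite !elt_nsm index_ofK // -!scaler_nat.
Qed.

End Basis.

(** * Borel dependence of the group on the graph *)

Section BorelGroup.

Lemma bpred_edge v w (b : bool) :
  bpred (fun H : structure graph_vocabulary => edge H v w = b).
Proof.
apply: bpred_open.
exact: (@open_meets graph_vocabulary
  (inr (Tagged (fun r : rsym graph_vocabulary => (rarity r).-tuple nat) ([tuple v; w] : (@rarity graph_vocabulary tt).-tuple nat), b))).
Qed.

(** The graph enters only through [EdgeU], and there through a single edge. *)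
Lemma bpred_kap i b o : bpred (fun H => kap H i b = o).
Proof.
rewrite /kap; case: i => [k||l d w|k w||||]; case: (beta b) => [[? ?]|x];
  do ?exact: bpred_cst.
apply: (@bpred_comp _ _ (fun H => edge H (label x).1 (label x).2)
  (fun e _ => (if e then None else Some b) = o)) => e; first exact: bpred_edge.
exact: bpred_cst.
Qed.

Lemma bpred_spanned a : bpred (fun H => spanned (kap H) a).
Proof.
apply: (@bpred_ext _ (fun H => exists l : seq gen,
    (forall g, g \in l -> gvalid (kap H) g) /\ a = \sum_(g <- l) gvec g)%R).
  by move=> H; split=> [[l [hl ->]]|[l hl ->]]; exists l.
apply: bpred_ex => l; apply: bpred_and; last exact: bpred_cst.
apply: bpred_all => g; apply: bpred_imp; first exact: bpred_cst.
case: g => [[[[z i] n] b] o] /=; apply: bpred_or; first exact: bpred_cst.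
apply: (@bpred_comp _ _ (fun H => kap H i b) (fun p H => p = obind (kap H i) o)) => p.
  exact: bpred_kap.
case: o => [c|] /=; last exact: bpred_cst.
by apply: bpred_ext (bpred_kap i c p) => H; split=> ->.
Qed.

Lemma bpred_enum_member n m : bpred (fun H => enum_of (member_code H) n = m).
Proof.
apply: bpred_enum_of => {}n; apply: bpred_ex => a; apply: bpred_and; first exact: bpred_cst.
exact: bpred_spanned.
Qed.

Lemma bpred_elt n a : bpred (fun H => elt H n = a).
Proof.
apply: (@bpred_comp _ _ (fun H => enum_of (member_code H) n)
  (fun m _ => odflt 0%R (unpickle m) = a)) => m; first exact: bpred_enum_member.
exact: bpred_cst.
Qed.

Lemma bpred_index_of a n : bpred (fun H => index_of H a = n).
Proof. by apply: bpred_next => m; exact: bpred_enum_member. Qed.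

Lemma bpred_group_of c : bpred (fun H => meets (group_of H) c).
Proof.
case: c => [[[f a] n]|[[]]//] /=.
case: f a => a /=.
- exact: bpred_index_of.
- apply: (@bpred_comp _ _ (fun H => elt H (nth 0 a 0))
    (fun p H => index_of H (p + elt H (nth 0 a 1)) = n)%R) => p; first exact: bpred_elt.
  apply: (@bpred_comp _ _ (fun H => elt H (nth 0 a 1))
    (fun q H => index_of H (p + q) = n)%R) => q; first exact: bpred_elt.
  exact: bpred_index_of.
- apply: (@bpred_comp _ _ (fun H => elt H (nth 0 a 0))
    (fun p H => index_of H (- p) = n)%R) => p; first exact: bpred_elt.
  exact: bpred_index_of.
Qed.

Lemma borel_group_of : borel_map group_of.
Proof. exact: borel_map_structure bpred_group_of. Qed.

Definition group_map (H : Graphs_omega) : TFAB_omega :=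
  SigSub (mem_set (group_of_TFAB (val H))).

Lemma borel_group_map : borel_map group_map.
Proof.
apply: borel_map_set_type.
exact: (borel_map_comp (@borel_map_val _ Graphs_omega) borel_group_of).
Qed.

End BorelGroup.

(** * The meaning of the formulas in the group of a graph *)

Section Coefficients.
Local Open Scope ring_scope.
Implicit Types (a : {poly rat}) (b c : nat).

Lemma coef_lin (f : nat -> {poly rat}) a c :
  (lin f a)`_c = \sum_(b < size a) a`_b * (f b)`_c.
Proof. by rewrite coef_sum; apply: eq_bigr => b _; rewrite coefZ. Qed.

Lemma coef_lin_vec (kappa : nat -> option nat) a b d :
  kappa b = Some d -> (forall b', a`_b' != 0 -> kappa b' = Some d -> b' = b) ->
  (lin (fun b => vec (kappa b)) a)`_d = a`_b.
Proof.
move=> bd b_uniq; rewrite coef_lin.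
under eq_bigr do rewrite coef_vec.
have [ab|ab] := ltnP b (size a).
  rewrite (bigD1 (Ordinal ab)) //= bd eqxx mulr1 big1 ?addr0 // => -[c ca] /= cb.
  have [->|ac] := eqVneq a`_c 0; first by rewrite mul0r.
  by case: eqP => [/(b_uniq _ ac) e|]; [move: cb; rewrite -val_eqE /= e eqxx|rewrite mulr0].
rewrite nth_default // big1 // => -[c ca] _ /=.
have [->|ac] := eqVneq a`_c 0; first by rewrite mul0r.
case: eqP => [/(b_uniq _ ac) e|]; last by rewrite mulr0.
by move: ca; rewrite e ltnNge ab.
Qed.

Lemma lin_sieve (P : nat -> bool) (kappa : nat -> option nat) a :
  (forall b, kappa b = if P b then None else Some b) ->
  lin (fun b => vec (kappa b)) a = 0 <-> forall b, a`_b != 0 -> P b.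
Proof.
move=> kE; split=> [k0 b ab|aP].
  apply/negPn/negP => nPb; move: ab; rewrite -(@coef_lin_vec kappa a b b) ?k0 ?coef0 ?eqxx //.
    by rewrite kE (negbTE nPb).
  by move=> b' _; rewrite kE; case: ifP => // _ [].
rewrite (@eq_in_lin _ (fun=> 0)) ?lin0 // => b /aP Pb.
by rewrite kE Pb.
Qed.

Definition support a : seq nat := [seq b <- iota 0 (size a) | a`_b != 0].

Lemma mem_support a b : (b \in support a) = (a`_b != 0).
Proof.
rewrite mem_filter mem_iota /= add0n andb_idr // => ab.
by rewrite ltnNge; apply: contra ab => /(nth_default 0)->.
Qed.

Lemma lin_support f a : lin f a = \sum_(b <- support a) a`_b *: f b.
Proof.
rewrite /support big_filter -{1}(subn0 (size a)) -/(index_iota 0 (size a)) big_mkcond /= big_mkord.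
apply: eq_bigr => b _; case: ifP => // /negbFE /eqP ->.
by rewrite scale0r.
Qed.

Lemma support_single a b : (forall c, a`_c != 0 -> c = b) -> a = a`_b *: 'X^b.
Proof.
move=> ab; apply/polyP => c; rewrite coefZ coefXn.
case: eqP => [->|cb]; first by rewrite mulr1.
by rewrite mulr0; apply/eqP; apply: contrapT => /negP /ab.
Qed.

Lemma coef_monomial (c : rat) b b' : (c *: 'X^b : {poly rat})`_b' = if b' == b then c else 0.
Proof. by rewrite coefZ coefXn; case: eqP => _; rewrite ?mulr1 ?mulr0. Qed.

Lemma intpoly_monomial (c : rat) b : c \is a Num.int -> intpoly (c *: 'X^b).
Proof. by move=> ci; apply/polyOverP => i; rewrite coef_monomial; case: ifP. Qed.

End Coefficients.

Opaque group_of elt index_of.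

Section Semantics.
Local Open Scope ring_scope.
Variable H : structure graph_vocabulary.
Notation G := (group_of H).
Notation klin := (klin (kap H)).

Definition at_frame (k : nat) (phi : seq int -> seq int) (c : rat) (n : nat) : Prop :=
  [/\ level k phi, c != 0 & elt H n = c *: 'X^(code (inl (k, phi)))].

Definition at_point (x : nat -> int) (c : rat) (n : nat) : Prop :=
  [/\ eventually_constant x, c != 0 & elt H n = c *: 'X^(code (inr x))].

Definition in_level k b : Prop := exists phi, beta b = inl (k, phi).

Lemma in_level_code k phi : level k phi -> in_level k (code (inl (k, phi))).
Proof. by move=> lphi; exists phi; rewrite codeK. Qed.

Lemma in_levelP k b : in_level k b ->
  exists2 phi, level k phi & b = code (inl (k, phi)).
Proof.
move=> [phi bphi]; exists phi; last by rewrite -bphi betaK.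
by have := beta_in b; rewrite bphi.
Qed.

Lemma klin_sortY k a : klin (SortY k) a = 0 <-> forall b, a`_b != 0 -> in_level k b.
Proof.
rewrite (@lin_sieve (fun b => if beta b is inl (l, _) then l == k else false)).
  split=> h b /h; rewrite /in_level; first by case: (beta b) => // -[l phi] /eqP->; exists phi.
  by move=> [phi ->].
by move=> b; rewrite /kap; case: (beta b) => [[l phi]|x] //; case: eqP.
Qed.

Lemma klin_sortX a :
  klin SortX a = 0 <-> forall b, a`_b != 0 -> exists x, beta b = inr x.
Proof.
rewrite (@lin_sieve (fun b => if beta b is inr _ then true else false)).
  split=> h b /h; first by case: (beta b) => // x _; exists x.
  by move=> [x ->].
by move=> b; rewrite /kap; case: (beta b) => [[l phi]|x].
Qed.

(* The projection of level k > l to level l, followed by a right translation. *)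
Definition translate_vec (l : nat) (w : word) (b : nat) : {poly rat} :=
  if beta b is inl (_, phi) then 'X^(code (inl (l, take l \o phi \o act w))) else 0.

Definition translate (l : nat) (w : word) : {poly rat} -> {poly rat} :=
  lin (translate_vec l w).

HB.instance Definition _ l w := GRing.Linear.copy (translate l w) (lin (translate_vec l w)).

Lemma translate_code k l w phi : level k phi ->
  translate l w 'X^(code (inl (k, phi))) = 'X^(code (inl (l, take l \o phi \o act w))).
Proof. by move=> lphi; rewrite /translate linXn /translate_vec codeK. Qed.

(** The partial map projects on the level of [u] and is the identity on the level of [z]; since
    these levels differ, both parts of [u - z] are treated as intended. *)
Lemma klin_proj l d w u z : klin (SortY (l + d.+1)) u = 0 -> klin (SortY l) z = 0 ->
  klin (Proj l d w) (u - z) = 0 <-> z = translate l w u.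
Proof.
move=> /klin_sortY hu /klin_sortY hz; rewrite linearB /=.
rewrite [X in X - _](_ : _ = translate l w u); last first.
  apply: eq_in_lin => b /hu [phi bphi].
  by rewrite /kap /translate_vec bphi eqxx.
rewrite [X in _ - X](_ : _ = z); last first.
  rewrite -[RHS]lin_id; apply: eq_in_lin => b /hz [phi bphi].
  rewrite /kap bphi ifN //; apply/eqP; lia.
by split=> [/eqP|->]; [rewrite subr_eq0 => /eqP|rewrite subrr].
Qed.

(** Truncation acts on values and translation on arguments, so the two commute: the translated
    projection of a lift depends only on its plain projection, whatever lift is used. *)
Lemma translate_proj k w u : klin (SortY k.+1) u = 0 ->
  translate k w u = translate k w (translate k [::] u).
Proof.
move=> /klin_sortY hu; rewrite /translate lin_comp; apply: eq_in_lin => b /hu /in_levelP[phi lphi ->].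
rewrite /translate_vec codeK //= linXn codeK; last first.
  rewrite /=; have := level_take (leqnSn k) lphi; congr level.
by congr ('X^(code (inl (_, _)))); apply/funext => t /=; rewrite take_takel.
Qed.

Lemma translate_sumP k l x z : klin (SortY k) (elt H x) = 0 ->
  translate_sum G k l x z ->
  elt H z = \sum_(p <- l) p.1%:~R *: translate k p.2 (elt H x).
Proof.
move=> hx; elim: l z => [|[r w] l IH] z /=; first by move=> ->; rewrite big_nil elt_zero.
move=> [y [u [/IH yE [/divisibleP zy [/divisibleP hu [/divisibleP h1 /divisibleP h2]]]]]].
rewrite big_cons -yE; rewrite !elt_sb elt_zsm in zy h1 h2.
have {}hu : klin (SortY (k + 1)) (elt H u) = 0 by rewrite addn1.
have hrx : klin (SortY k) (elt H x *~ r) = 0 by rewrite -scaler_int linearZ /= hx scaler0.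
move/(klin_proj _ hu hrx): h1 => h1; move/(klin_proj _ hu zy): h2.
rewrite translate_proj; last by rewrite -addn1.
by rewrite -h1 -scaler_int linearZ /= => /eqP; rewrite subr_eq => /eqP.
Qed.

End Semantics.

(** * Frames are the multiples of basis vectors of a level *)

Section FrameSemantics.
Local Open Scope ring_scope.
Variable H : structure graph_vocabulary.
Notation G := (group_of H).
Notation klin := (klin (kap H)).

Lemma elt_eq0 n : n <> zero G <-> elt H n != 0.
Proof.
split=> [n0|]; last by move=> /eqP n0 e; apply: n0; rewrite e elt_zero.
by apply/eqP => e; apply: n0; apply: (@elt_inj H); rewrite e elt_zero.
Qed.

Lemma klin_sortY_monomial k phi (c : rat) : level k phi ->
  klin (SortY k) (c *: 'X^(code (inl (k, phi)))) = 0.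
Proof.
move=> lphi; apply/klin_sortY => b; rewrite coef_monomial.
by case: ifP => [/eqP -> _|_]; [exact: in_level_code|rewrite eqxx].
Qed.

Lemma translate_sum_onto k phi c n (s : seq (nat * int)) : at_frame H k phi c n ->
  (forall p, p \in s -> in_level k p.1 /\ p.2%:~R * c \is a Num.int) ->
  exists l, translate_sum G k l n (index_of H (\sum_(p <- s) (p.2%:~R * c) *: 'X^(p.1))).
Proof.
move=> [[w phiE] c0 nE]; elim: s => [_|[b r] s IH hs].
  exists [::]; rewrite big_nil /=; apply: (@elt_inj H); rewrite index_ofK ?elt_zero //.
  exact: spanned0.
have [|l hl] := IH; first by move=> p ps; apply: hs; rewrite inE ps orbT.
have [/in_levelP[psi [v psiE] bE] rc] := hs (b, r) (mem_head _ _).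
(* Chosen so that [phi \o act v0] is [psi]: the word of [phi] is undone, then that of [psi] is
   applied. *)
rewrite /= in bE rc; pose v0 := inverse_word w ++ v.
pose u := index_of H ((r%:~R * c) *: 'X^(code (inl (k.+1, fun t => take k.+1 (act w t))))).
have int_span t : (forall p, p \in t -> p.2%:~R * c \is a Num.int) ->
    spanned (kap H) (\sum_(p <- t) (p.2%:~R * c) *: 'X^(p.1)).
  move=> ht; apply: spanned_intpoly; apply/polyOverP => i; rewrite coef_sum big_seq.
  by apply: rpred_sum => p pt; apply/polyOverP; apply: intpoly_monomial; exact: ht.
have uE : elt H u = (r%:~R * c) *: 'X^(code (inl (k.+1, fun t => take k.+1 (act w t)))).
  by apply: index_ofK; apply/spanned_intpoly/intpoly_monomial.
have hu : klin (SortY (k + 1)) (elt H u) = 0.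
  by rewrite uE addn1; apply: klin_sortY_monomial; exact: level_word.
have phik : level k phi by exists w.
exists ((r, v0) :: l) => /=; set z := index_of H _.
exists (index_of H (\sum_(p <- s) (p.2%:~R * c) *: 'X^(p.1))), u; set y := index_of H _.
have zyE : elt H z - elt H y = (r%:~R * c) *: 'X^b.
  rewrite /z /y !index_ofK; first by rewrite big_cons addrK.
    by apply: int_span => p ps; have [] := hs p _; rewrite // inE ps orbT.
  by apply: int_span => p ps; have [] := hs p ps.
have sortzy : klin (SortY k) (elt H z - elt H y) = 0.
  by rewrite zyE bE; apply: klin_sortY_monomial; exists v.
split=> //; split; first by apply/divisibleP; rewrite elt_sb.
split; first by apply/divisibleP; rewrite -addn1.
have sortn : klin (SortY k) (elt H n *~ r) = 0.
  by rewrite nE -scaler_int linearZ /= klin_sortY_monomial // scaler0.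
split; apply/divisibleP; rewrite elt_sb ?elt_zsm ?elt_sb.
  apply/(@klin_proj H k 0 [::] _ _ hu sortn).
  rewrite uE linearZ /= translate_code; last exact: level_word.
  rewrite nE -scaler_int scalerA; congr (_ *: 'X^(code (inl (_, _)))).
  by rewrite phiE; apply/funext => t /=; rewrite take_takel.
apply/(@klin_proj H k 0 v0 _ _ hu sortzy).
rewrite uE linearZ /= translate_code; last exact: level_word.
rewrite zyE bE psiE; congr (_ *: 'X^(code (inl (_, _)))).
by apply/funext => t /=; rewrite take_takel // act_cat act_inverse'.
Qed.

Lemma at_frame_frame k phi c n : at_frame H k phi c n -> frame G k n.
Proof.
move=> hn; have [lphi c0 nE] := hn; split.
  by apply/elt_eq0; rewrite nE scaler_eq0 negb_or c0 -size_poly_eq0 size_polyXn.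
split; first by apply/divisibleP; rewrite nE klin_sortY_monomial.
move=> z /divisibleP /klin_sortY hz.
(* Two kinds of denominators are cleared: those of the coefficients, so that the summands are in the
   group, and those of their quotients by [c], so that the multipliers of the translates are
   integers. *)
have [m m0 hm] := clear_denominators ((elt H z : seq rat) ++ [seq q / c | q <- elt H z]).
exists m; split=> //.
have zb (b : nat) : b \in support (elt H z) -> (elt H z)`_b \in (elt H z : seq rat).
  rewrite mem_support => zb; apply: mem_nth; rewrite ltnNge.
  by apply: contra zb => /(nth_default 0)->.
pose r b := Num.floor (m%:R * ((elt H z)`_b / c)).
have rE b : b \in support (elt H z) -> (r b)%:~R * c = m%:R * (elt H z)`_b.
  move=> bz; rewrite /r floorK; first by rewrite mulrA divfK.
  by apply: hm; rewrite mem_cat (map_f (fun q => q / c) (zb b bz)) orbT.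
have [|l hl] := @translate_sum_onto k phi c n [seq (b, r b) | b <- support (elt H z)] hn.
  move=> _ /mapP[b bz ->] /=; split; first by apply: hz; rewrite -mem_support.
  by rewrite rE //; apply: hm; rewrite mem_cat zb.
exists l; move: hl; rewrite big_map /=; congr translate_sum.
have -> : \sum_(b <- support (elt H z)) ((r b)%:~R * c) *: 'X^b = elt H z *+ m.
  rewrite -[X in _ = X *+ m]lin_id lin_support -scaler_nat scaler_sumr !big_seq.
  by apply: eq_bigr => b bz; rewrite rE // scalerA.
by apply: (@elt_inj H); rewrite index_ofK ?elt_nsm //; apply: spannedMn; exact: elt_spanned.
Qed.

Definition fn_of (b : nat) : seq int -> seq int :=
  if beta b is inl (_, phi) then phi else id.

Lemma fn_of_code k phi : level k phi -> fn_of (code (inl (k, phi))) = phi.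
Proof. by move=> lphi; rewrite /fn_of codeK. Qed.

(** Applied to the unit [one], the definition gives a vector [R] whose product with [elt H n] is a
    nonzero multiple of the unit. By unique products, [elt H n] has a single basis vector in its
    support. *)
Lemma frame_at_frame k n : frame G k n -> exists phi c, at_frame H k phi c n.
Proof.
move=> [/elt_eq0 n0 [/divisibleP hn hz]].
have /klin_sortY supp_n := hn.
pose one : seq int -> seq int := fun t => take k t.
have lone : level k one by exists [::].
pose z := index_of H 'X^(code (inl (k, one))).
have zE : elt H z = 'X^(code (inl (k, one))).
  by apply: index_ofK; apply: spanned_intpoly; exact: (intpoly_vec (Some _)).
have [|m [m0 [l /(translate_sumP hn)]]] := hz z.
  by apply/divisibleP; rewrite zE -[X in klin _ X]scale1r klin_sortY_monomial.
rewrite elt_nsm zE -scaler_nat => sumE.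
pose mul b c := code (inl (k, fn_of b \o fn_of c)).
pose g c := lin (fun b => 'X^(mul b c)) (elt H n).
(* The double sum is the coefficient at [x] of the group ring product of [elt H n] and [S]. *)
have coefE (S : {poly rat}) x : \sum_(b <- support (elt H n)) \sum_(c <- support S)
    (elt H n)`_b * S`_c * (mul b c == x)%:R = (lin g S)`_x.
  rewrite exchange_big /= lin_support coef_sum; apply: eq_bigr => c _.
  rewrite coefZ /g lin_support coef_sum mulr_sumr; apply: eq_bigr => b _.
  by rewrite coefZ coefXn eq_sym mulrA (mulrC S`_c).
pose cw w := code (inl (k, fun t : seq int => take k (act w t))).
pose R : {poly rat} := \sum_(p <- l) p.1%:~R *: 'X^(cw p.2).
have translE w : translate k w (elt H n) = g (cw w).
  apply: eq_in_lin => b /supp_n /in_levelP[phi lphi ->].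
  rewrite /translate_vec codeK // /mul !fn_of_code //; last exact: level_word.
  congr ('X^(code (inl (_, _)))); apply/funext => t /=; case: lphi => w' ->.
  by rewrite take_takel // -!take_act take_takel.
have gR : lin g R = m%:R *: 'X^(code (inl (k, one))).
  rewrite sumE linear_sum; apply: eq_bigr => p _.
  by rewrite linearZ /= linXn translE.
have supp_R c : R`_c != 0 -> in_level k c.
  move: c; apply/klin_sortY; rewrite linear_sum big1 // => p _.
  by apply: klin_sortY_monomial; exact: level_word.
have lvl b : in_level k b -> level k (fn_of b) by move=> /in_levelP[phi lphi ->]; rewrite fn_of_code.
have fn_inj b b' : in_level k b -> in_level k b' -> fn_of b = fn_of b' -> b = b'.
  by move=> /in_levelP[phi lphi ->] /in_levelP[psi lpsi ->]; rewrite !fn_of_code // => ->.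
have fn_mul b c : in_level k b -> in_level k c -> fn_of (mul b c) = fn_of b \o fn_of c.
  by move=> hb hc; rewrite fn_of_code //; apply: level_comp; exact: lvl.
have single : forall b b', b \in support (elt H n) -> b' \in support (elt H n) -> b = b'.
  apply: (@single_product _ (fun b c => fnlt (fn_of b) (fn_of c)) (in_level k) mul
    _ (support R) (fun b => (elt H n)`_b) (fun c => R`_c) (code (inl (k, one)))).
  - by move=> b c d; exact: fnlt_trans.
  - by move=> b; exact: fnlt_irr.
  - move=> b c hb hc bc; apply: (@fnlt_total k); [exact: lvl|exact: lvl|].
    by move=> /(fn_inj _ _ hb hc).
  - by move=> b c hb hc; apply: in_level_code; apply: level_comp; exact: lvl.
  - by move=> b c d hb hc hd; rewrite !fn_mul //; apply: fnlt_comp; exact: lvl.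
  - move=> b b' c hb hb' hc e; apply: fn_inj => //.
    by apply: (@level_cancel k _ _ (fn_of c)); rewrite -?fn_mul ?e //; exact: lvl.
  - by apply: filter_uniq; exact: iota_uniq.
  - by apply: filter_uniq; exact: iota_uniq.
  - apply/negP => /eqP R0; have := gR; rewrite lin_support R0 big_nil => /esym /eqP.
    by rewrite scaler_eq0 pnatr_eq0 -size_poly_eq0 size_polyXn orbF eqn0Ngt m0.
  - by move=> b; rewrite mem_support => /supp_n.
  - by move=> b; rewrite mem_support => /supp_R.
  - by move=> b; rewrite mem_support.
  - by move=> b; rewrite mem_support.
  - by move=> x; rewrite coefE gR coef_monomial; case: ifP => [/eqP|]; rewrite ?eqxx.
have [b bn] : exists b, (elt H n)`_b != 0.
  by exists (size (elt H n)).-1; rewrite -/(lead_coef _) lead_coef_eq0.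
have /in_levelP[phi lphi bE] := supp_n b bn.
exists phi, (elt H n)`_b; split=> //; rewrite -bE; apply: support_single => c cn.
by apply: single; rewrite mem_support.
Qed.

Lemma frameP k n : frame G k n <-> exists phi c, at_frame H k phi c n.
Proof.
by split=> [/frame_at_frame//|[phi [c]]]; exact: at_frame_frame.
Qed.

End FrameSemantics.

Section TreePaths.
Local Open Scope ring_scope.

Lemma act_rcons w t a : exists b, act w (rcons t a) = rcons (act w t) b.
Proof.
have := size_act w (rcons t a); have := take_act w (rcons t a) (size t).
case/lastP: (act w (rcons t a)) => [|s b]; rewrite !size_rcons // => sE [st]; exists b.
by move: sE; rewrite -{1}st -!cats1 !take_size_cat // => ->.
Qed.

Lemma act_transitive t : exists w, act w (nseq (size t) 0) = t.
Proof.
elim/last_ind: t => [|t a [w wt]]; first by exists [::].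
have -> : nseq (size (rcons t a)) 0 = rcons (nseq (size t) (0 : int)) 0.
  by rewrite size_rcons -[_.+1]addn1 nseqD cats1.
have [b wb] := act_rcons w (nseq (size t) 0) 0.
have [v [_ hv]] := @act_extend (size t) [:: t] (fun=> a - b) isT.
exists (v ++ w); rewrite act_cat wb wt hv // mem_seq1 eqxx.
by rewrite addrC subrK.
Qed.

Lemma separating_level (I : eqType) (f : I -> nat -> int) (s : seq I) :
  (forall b b', b \in s -> b' \in s -> f b = f b' -> b = b') ->
  exists k0, forall k, (k0 <= k)%N -> forall b b', b \in s -> b' \in s ->
    mkseq (f b) k = mkseq (f b') k -> b = b'.
Proof.
move=> f_inj; have /choice[d dP] : forall p : I * I, exists n,
    p.1 \in s -> p.2 \in s -> f p.1 n = f p.2 n -> p.1 = p.2.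
  move=> [b b'] /=; have [e|ne] := pselect (f b = f b').
    by exists 0%N => bs b's _; exact: f_inj.
  have [n hn] : exists n, f b n <> f b' n.
    by apply: contrapT => nex; apply: ne; apply/funext => n; apply: contrapT => h; apply: nex; exists n.
  by exists n.
exists (\max_(b <- s) \max_(b' <- s) d (b, b')).+1 => k k0k b b' bs b's e.
apply: (dP (b, b')) => //=; set n := d (b, b').
have nk : (n < k)%N.
  apply: leq_trans k0k; rewrite ltnS.
  have h1 : (n <= \max_(b' <- s) d (b, b'))%N.
    exact: (@leq_bigmax_seq _ s xpredT (fun b' => d (b, b')) b' b's isT).
  apply: leq_trans h1 _.
  exact: (@leq_bigmax_seq _ s xpredT (fun b => \max_(b' <- s) d (b, b')) b bs isT).
by have := congr1 (fun t => nth 0 t n) e; rewrite !nth_mkseq.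
Qed.

End TreePaths.

(** * Points are the multiples of branches *)

Section PointSemantics.
Local Open Scope ring_scope.
Variable H : structure graph_vocabulary.
Notation G := (group_of H).
Notation klin := (klin (kap H)).

Lemma klin_monomial i (c : rat) b : klin i (c *: 'X^b) = c *: vec (kap H i b).
Proof. by rewrite linearZ /= klinXn. Qed.

Lemma vec_eq0 o : (vec o == 0) = ~~ isSome o.
Proof. by case: o => [b|] /=; rewrite ?eqxx // -size_poly_eq0 size_polyXn. Qed.

Lemma monomial_inj (c d : rat) b b' : c != 0 -> c *: 'X^b = d *: 'X^b' :> {poly rat} ->
  b = b' /\ c = d.
Proof.
move=> c0 e; have := congr1 (fun p : {poly rat} => p`_b) e; rewrite !coef_monomial eqxx.
by case: eqP => [-> ->//|_ cz]; rewrite cz eqxx in c0.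
Qed.

Lemma at_point_inj n x c y d : at_point H x c n -> at_point H y d n -> x = y /\ c = d.
Proof.
move=> [ex c0 nE] [ey d0]; rewrite nE => /(monomial_inj c0)[/code_inj e ->]; split=> //.
by have [] := e ex ey.
Qed.

Lemma int_multiple (c : rat) : exists2 m, (0 < m)%N & m%:R * c \is a Num.int.
Proof.
by have [m m0 hm] := clear_denominators [:: c]; exists m => //; apply: hm; rewrite mem_head.
Qed.

Lemma kap_att_frame k phi w : level k phi ->
  kap H (Att k w) (code (inl (k, phi))) = Some (pickle (phi (act w (nseq k 0)))).*2.
Proof. by move=> lphi; rewrite /kap codeK // eqxx. Qed.

Lemma kap_att_point k x w : eventually_constant x ->
  kap H (Att k w) (code (inr x)) = Some (pickle (mkseq x k)).*2.
Proof. by move=> ex; rewrite /kap codeK. Qed.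

Lemma at_point_point x c n : at_point H x c n -> point G n.
Proof.
move=> [ex c0 nE]; split; first by apply/elt_eq0; rewrite nE scaler_eq0 negb_or c0 -size_poly_eq0 size_polyXn.
split.
  apply/divisibleP/klin_sortX => b; rewrite nE coef_monomial.
  by case: ifP => [/eqP -> _|]; [exists x; rewrite codeK|rewrite eqxx].
move=> k; have [m m0 mc] := int_multiple c; exists m; split=> //.
(* The attached frame must send the zero node to the restriction of [x]; words are transitive on
   each level. *)
have [w wt] := act_transitive (mkseq x k); rewrite size_mkseq in wt.
pose phi t := take k (act w t); have lphi : level k phi by exists w.
pose y := index_of H ((m%:R * c) *: 'X^(code (inl (k, phi)))).
have yE : elt H y = (m%:R * c) *: 'X^(code (inl (k, phi))).
  by apply: index_ofK; apply: spanned_intpoly; exact: intpoly_monomial.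
exists y; split.
  by apply/frameP; exists phi, (m%:R * c); split=> //; rewrite mulf_neq0 // pnatr_eq0 -lt0n.
apply/divisibleP; rewrite elt_sb elt_nsm -scaler_nat nE yE linearB /= scalerA !klin_monomial.
by rewrite kap_att_frame // kap_att_point //= /phi wt take_oversize ?size_mkseq // subrr.
Qed.

(** At a level separating the branches in the support, their restrictions give distinct basis
    vectors, so nothing cancels. Equality with a multiple of one vector, the node [phi o], leaves a
    single branch. *)
Lemma point_at_point n : point G n -> exists x c, at_point H x c n.
Proof.
move=> [/elt_eq0 n0 [/divisibleP/klin_sortX hn hk]].
pose pt b : nat -> int := if beta b is inr x then x else fun=> 0.
have supp_code b : b \in support (elt H n) -> eventually_constant (pt b) /\ b = code (inr (pt b)).
  rewrite mem_support => /hn[x bx]; rewrite /pt bx; split; last by rewrite -bx betaK.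
  by have := beta_in b; rewrite bx.
have [|k /(_ k (leqnn k)) ksep] := @separating_level _ pt (support (elt H n)).
  by move=> b b' /supp_code[_ bE] /supp_code[_ b'E] e; rewrite bE b'E e.
have [m [m0 [y [/frameP[phi [c [lphi c0 yE]]] /divisibleP]]]] := hk k.
rewrite elt_sb elt_nsm -scaler_nat yE linearB /= linearZ /= klin_monomial kap_att_frame //.
set o := act _ _ => /eqP; rewrite subr_eq0 => /eqP klinE.
have ptE b : b \in support (elt H n) -> phi o = mkseq (pt b) k.
  move=> bs; have [ex bE] := supp_code b bs.
  have kapb : kap H (Att k [::]) b = Some (pickle (mkseq (pt b) k)).*2.
    by rewrite {1}bE kap_att_point.
  have := congr1 (fun p : {poly rat} => p`_(pickle (mkseq (pt b) k)).*2) klinE.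
  rewrite coefZ (@coef_lin_vec _ _ _ _ kapb) => [|b' b'n]; last first.
    have b's : b' \in support (elt H n) by rewrite mem_support.
    have [ex' b'E] := supp_code b' b's.
    rewrite [in X in X -> _]b'E kap_att_point // => -[/double_inj/(pcan_inj (@pickleK _)) e].
    exact: ksep.
  rewrite coef_monomial; case: eqP => [/double_inj/(pcan_inj (@pickleK _))->//|_ /eqP].
  rewrite mulf_eq0 pnatr_eq0 eqn0Ngt m0 /= => /eqP nb.
  by rewrite mem_support nb eqxx in bs.
have [b bn] : exists b, (elt H n)`_b != 0.
  by exists (size (elt H n)).-1; rewrite -/(lead_coef _) lead_coef_eq0.
have bs : b \in support (elt H n) by rewrite mem_support.
have [ex bE] := supp_code b bs.
exists (pt b), (elt H n)`_b; split=> //; rewrite -bE; apply: support_single => d dn.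
have ds : d \in support (elt H n) by rewrite mem_support.
by apply: ksep => //; rewrite -!ptE.
Qed.

Lemma pointP n : point G n <-> exists x c, at_point H x c n.
Proof. by split=> [/point_at_point//|[x [c]]]; exact: at_point_point. Qed.

Lemma divisible_at_point i x c n : at_point H x c n ->
  divisible G i n <-> kap H i (code (inr x)) = None.
Proof.
move=> [_ c0 nE]; rewrite divisibleP nE klin_monomial; split.
  by move=> /eqP; rewrite scaler_eq0 (negbTE c0) vec_eq0; case: (kap _ _ _).
by move=> ->; rewrite scaler0.
Qed.

Lemma similarP i x c n y d n' : at_point H x c n -> at_point H y d n' ->
  kap H i (code (inr x)) <> None ->
  similar G i n n' <-> kap H i (code (inr x)) = kap H i (code (inr y)).
Proof.
move=> [_ c0 nE] [_ d0 n'E] hx.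
have simE m m' : divisible G i (sb G (zsm G m n) (zsm G m' n')) <->
    (m%:~R * c) *: vec (kap H i (code (inr x))) = (m'%:~R * d) *: vec (kap H i (code (inr y))).
  rewrite divisibleP elt_sb !elt_zsm nE n'E -!scaler_int !scalerA linearB /= !klin_monomial.
  by split=> [/eqP|->]; [rewrite subr_eq0 => /eqP|rewrite subrr].
split=> [[m [m' [m0 [m'0 /simE]]]]|e]; last first.
  (* Cross-multiplication: both scalars become the product of the numerators of [c] and [d]. *)
  exists (numq d * denq c), (numq c * denq d).
  split; first by apply/eqP; rewrite mulf_neq0 ?numq_eq0 ?denq_neq0.
  split; first by apply/eqP; rewrite mulf_neq0 ?numq_eq0 ?denq_neq0.
  apply/simE; rewrite e; congr (_ *: _); rewrite !intrM.
  have numE (q : rat) : (denq q)%:~R * q = (numq q)%:~R.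
    by rewrite -{2}(divq_num_den q) mulrC divfK // intr_eq0; exact: denq_neq0.
  by rewrite -!mulrA !numE mulrC.
have mc : m%:~R * c != 0 by rewrite mulf_neq0 // intr_eq0; apply/eqP.
case: (kap H i (code (inr x))) hx => // b _ /=.
case: (kap H i (code (inr y))) => [b' /=|/eqP].
  by move=> /(monomial_inj mc)[-> _].
by rewrite scaler0 scaler_eq0 (negbTE mc) -size_poly_eq0 size_polyXn.
Qed.

Lemma similar_lab1 x c n y d n' : at_point H x c n -> at_point H y d n' ->
  similar G Lab1 n n' <-> (label x).1 = (label y).1.
Proof.
move=> hx hy; have [ex _ _] := hx; have [ey _ _] := hy.
rewrite (similarP hx hy) /kap ?codeK //; split=> [[/double_inj]//|-> //].
Qed.

Lemma similar_lab2 x c n y d n' : at_point H x c n -> at_point H y d n' ->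
  similar G Lab2 n n' <-> (label x).2 = (label y).2.
Proof.
move=> hx hy; have [ex _ _] := hx; have [ey _ _] := hy.
rewrite (similarP hx hy) /kap ?codeK //; split=> [[/double_inj]//|-> //].
Qed.

Lemma vertexP n : vertex G n <->
  exists x c, at_point H x c n /\ (label x).1 = (label x).2.
Proof.
split=> [[/pointP[x [c hx]] dx]|[x [c [hx lx]]]].
  exists x, c; split=> //; move: dx; rewrite (divisible_at_point _ hx) /kap.
  by have [ex _ _] := hx; rewrite codeK //; case: eqP.
split; first by apply/pointP; exists x, c.
by rewrite (divisible_at_point _ hx) /kap; have [ex _ _] := hx; rewrite codeK // lx eqxx.
Qed.

Definition pad_point (p : nat * nat) : nat := index_of H 'X^(code (inr (pad_label [::] p))).

Lemma at_pad_point p : at_point H (pad_label [::] p) 1 (pad_point p).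
Proof.
split; [exact: pad_eventually|by []|rewrite scale1r; apply: index_ofK].
by apply: spanned_intpoly; exact: (intpoly_vec (Some _)).
Qed.

Lemma adjacentP x c n y d n' : at_point H x c n -> at_point H y d n' ->
  adjacent G n n' <-> edge H (label x).1 (label y).2.
Proof.
move=> hx hy; split=> [[m [/pointP[z [e hz]] [uz [s1 s2]]]]|exy].
  move: uz s1 s2; rewrite (divisible_at_point _ hz) (similar_lab1 hz hx) (similar_lab2 hz hy).
  by have [ez _ _] := hz; rewrite /kap codeK //; case: ifP => // h _ <- <-.
(* The witness is a branch labelled by the ordered pair of vertices, which exists for every pair. *)
pose p := ((label x).1, (label y).2); have hp := at_pad_point p.
exists (pad_point p); split; first by apply/pointP; exists (pad_label [::] p), 1.
rewrite (divisible_at_point _ hp) (similar_lab1 hp hx) (similar_lab2 hp hy) label_pad.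
by rewrite /kap codeK ?label_pad ?exy //; exact: pad_eventually.
Qed.

End PointSemantics.

(** * Isomorphisms *)

Section Extension.
Local Open Scope ring_scope.
Implicit Types (x y : nat -> int) (t : seq int) (w : word).

Definition state : Type := nat * word * seq ((nat -> int) * (nat -> int)).

Definition label_map (h : nat -> nat) (p : nat * nat) : nat * nat := (h p.1, h p.2).

(** The branches are kept separated at level [k] so that the word can later be corrected along each
    of them independently. *)
Definition approx (h : nat -> nat) (st : state) : Prop :=
  let: (k, w, s) := st in
  (forall p, p \in s -> [/\ eventually_constant p.1, eventually_constant p.2,
      label p.2 = label_map h (label p.1) & mkseq p.2 k = act w (mkseq p.1 k)]) /\
  (forall p q, p \in s -> q \in s -> mkseq p.1 k = mkseq q.1 k -> p = q).

Definition refines (st st' : state) : Prop :=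
  [/\ (st.1.1 <= st'.1.1)%N,
      forall t, (size t <= st.1.1)%N -> act st'.1.2 t = act st.1.2 t &
      {subset st.2 <= st'.2}].

Lemma refines_refl st : refines st st.
Proof. by split. Qed.

#[local] Hint Resolve refines_refl : core.

Lemma refines_trans st2 st1 st3 : refines st1 st2 -> refines st2 st3 -> refines st1 st3.
Proof.
move=> [k12 w12 s12] [k23 w23 s23]; split; first exact: leq_trans k23.
  by move=> t tk; rewrite w23 ?w12 // (leq_trans tk).
by move=> p /s12 /s23.
Qed.

Lemma mkseq_rcons x k : mkseq x k.+1 = rcons (mkseq x k) (x k).
Proof. by rewrite /mkseq -[k.+1]addn1 iotaD map_cat cats1. Qed.

Lemma take_mkseq x k l : (k <= l)%N -> take k (mkseq x l) = mkseq x k.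
Proof. by move=> kl; rewrite /mkseq -map_take take_iota (minn_idPl kl). Qed.

Lemma approx_next h k w s : approx h (k, w, s) ->
  exists w', approx h (k.+1, w', s) /\ refines (k, w, s) (k.+1, w', s).
Proof.
move=> [hs sep].
(* [d] collects the corrections at level [k]. By separation at most one pair passes through a given
   node, so at most one correction is requested there. *)
have /choice[d dP] : forall t, exists c, forall p, p \in s -> mkseq p.2 k = t ->
    act w (mkseq p.1 k.+1) = rcons t (p.2 k - c).
  move=> t; have [[p [ps pt]]|nex] := pselect (exists p, p \in s /\ mkseq p.2 k = t); last first.
    by exists 0 => p ps pt; case: nex; exists p.
  have [_ _ _ pE] := hs p ps.
  have [b bE] := act_rcons w (mkseq p.1 k) (p.1 k).
  exists (p.2 k - b) => q qs qt; have [_ _ _ qE] := hs q qs.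
  have -> : q = p by apply: sep => //; apply: (@act_inj w); rewrite -pE -qE pt.
  by rewrite mkseq_rcons bE -pE pt subKr.
have [v [vk vd]] := @act_extend k (undup [seq mkseq p.2 k | p <- s]) d (undup_uniq _).
exists (v ++ w); split; last first.
  by split=> //= t tk; rewrite act_cat vk // size_act.
split=> [p ps|p q ps qs e]; last first.
  by apply: sep => //; rewrite -!(take_mkseq _ (leqnSn k)) e.
have [e1 e2 lab pE] := hs p ps; split=> //.
rewrite act_cat (dP (mkseq p.2 k)) // vd ?size_mkseq //.
by rewrite mem_undup (map_f (fun p : (nat -> int) * (nat -> int) => mkseq p.2 k) ps) subrK mkseq_rcons.
Qed.

Lemma approx_level h k w s n : approx h (k, w, s) ->
  exists k' w', [/\ (n <= k')%N, approx h (k', w', s) & refines (k, w, s) (k', w', s)].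
Proof.
move=> hk; elim: n => [|n [k' [w' [nk' hk' r]]]].
  by exists k, w; split.
have [w'' [hk'' r']] := approx_next hk'.
exists k'.+1, w''; split=> //; exact: refines_trans r r'.
Qed.

Lemma approx_forth h st x : approx h st -> eventually_constant x ->
  exists st' y, [/\ approx h st', refines st st' & (x, y) \in st'.2].
Proof.
case: st => [[k w] s] hk ex.
have [[y xy]|nex] := pselect (exists y, (x, y) \in s); first by exists (k, w, s), y; split.
have [k0 k0P] := @separating_level _ id (x :: unzip1 s) (fun _ _ _ _ e => e).
have [k' [w' [k0k' [hs sep] r]]] := approx_level k0 hk.
(* The image follows the word up to a level separating [x] from the earlier branches, then is
   constant with the required label as limit. *)
pose y := pad_label (act w' (mkseq x k')) (label_map h (label x)).
have ky : mkseq y k' = act w' (mkseq x k').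
  by rewrite -[X in mkseq y X](size_mkseq x) -{1}(size_act w') mkseq_pad.
have new p : p \in s -> mkseq x k' <> mkseq p.1 k'.
  move=> ps /(k0P k' k0k') e; apply: nex; exists p.2.
  by rewrite e ?mem_head ?inE ?map_f ?orbT // -surjective_pairing.
exists (k', w', (x, y) :: s), y; split; rewrite ?mem_head //.
  split=> [p|p q]; rewrite inE => /predU1P[->|ps].
  - by split=> //; [exact: pad_eventually|rewrite label_pad].
  - exact: hs.
  - rewrite inE => /predU1P[->//|qs] /= e; by case: (new q qs).
  - rewrite inE => /predU1P[->|qs] /= e; last exact: sep.
    by case: (new p ps).
by case: r => r1 r2 r3; split=> // p /r3 ps; rewrite inE ps orbT.
Qed.

Definition reverse (st : state) : state :=
  (st.1.1, inverse_word st.1.2, [seq (p.2, p.1) | p <- st.2]).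

Lemma mem_reverse st p : (p \in (reverse st).2) = ((p.2, p.1) \in st.2).
Proof.
apply/mapP/idP => [[q qs ->]|ps]; first by rewrite -surjective_pairing.
by exists (p.2, p.1) => //; rewrite -surjective_pairing.
Qed.

Lemma reverseK : involutive reverse.
Proof.
move=> [[k w] s]; rewrite /reverse /= inverse_wordK -map_comp map_id_in // => -[] //.
Qed.

Lemma approx_reverse h h' st : cancel h h' -> approx h st -> approx h' (reverse st).
Proof.
move=> hK; case: st => [[k w] s] [hs sep]; split=> [p|p q]; rewrite mem_reverse => ps.
  have [/= e2 e1 lab pE] := hs _ ps; split=> //; last by rewrite pE act_inverse.
  by rewrite lab /label_map !hK -surjective_pairing.
rewrite mem_reverse => qs e; have [/= _ _ _ pE] := hs _ ps; have [/= _ _ _ qE] := hs _ qs.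
have : (p.2, p.1) = (q.2, q.1).
  by apply: sep => //=; apply: (@act_inj w); rewrite -pE -qE.
by case=> e2 e1; rewrite [p]surjective_pairing [q]surjective_pairing e1 e2.
Qed.

Lemma refines_reverse st st' : refines st st' -> refines (reverse st) (reverse st').
Proof.
move=> [k w s]; split=> // [t tk|p] /=; last by rewrite !mem_reverse; exact: s.
apply: (@act_inj st'.1.2); rewrite act_inverse' w ?act_inverse' //.
by rewrite size_act.
Qed.

Lemma approx_back h h' st y : cancel h h' -> cancel h' h -> approx h st ->
  eventually_constant y ->
  exists st' x, [/\ approx h st', refines st st' & (x, y) \in st'.2].
Proof.
move=> hK h'K hst ey.
have [st' [x [hst' r xy]]] := approx_forth (approx_reverse hK hst) ey.
exists (reverse st'), x; split.
- exact: approx_reverse h'K hst'.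
- by rewrite -(reverseK st); exact: refines_reverse.
- by rewrite mem_reverse.
Qed.

(** A limit of words need not be a word; agreement with some word up to each length is what sends
    truncated maps to truncated maps. *)
Definition coherent (q : seq int -> seq int) : Prop :=
  forall n, exists w, forall t, (size t <= n)%N -> q t = act w t.

Definition branch_map (q : seq int -> seq int) x : nat -> int :=
  fun n => nth 0 (q (mkseq x n.+1)) n.

Lemma coherent_take q t n : coherent q -> q (take n t) = take n (q t).
Proof.
move=> cq; have [w wq] := cq (size t).
by rewrite !wq ?take_act // size_take_min geq_minr.
Qed.

Lemma coherent_size q t : coherent q -> size (q t) = size t.
Proof. by move=> /(_ (size t))[w ->//]; exact: size_act. Qed.

Lemma mkseq_branch_map q x n : coherent q -> mkseq (branch_map q x) n = q (mkseq x n).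
Proof.
move=> cq; apply: (@eq_from_nth _ 0); first by rewrite coherent_size // !size_mkseq.
move=> i; rewrite size_mkseq => ni; rewrite nth_mkseq // /branch_map.
rewrite -(take_mkseq x ni) coherent_take // nth_take //.
Qed.

(* q is the limit of the approximations, q' its inverse. *)
Lemma tree_extension h h' k w s : cancel h h' -> cancel h' h -> approx h (k, w, s) ->
  exists q q', [/\ coherent q, coherent q', cancel q q', cancel q' q &
    [/\ forall t, (size t <= k)%N -> q t = act w t,
        forall p, p \in s -> branch_map q p.1 = p.2,
        forall x, eventually_constant x -> eventually_constant (branch_map q x) /\
          label (branch_map q x) = label_map h (label x) &
        forall x, eventually_constant x -> eventually_constant (branch_map q' x) /\
          label (branch_map q' x) = label_map h' (label x)]].
Proof.
move=> hK h'K h0.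
(* Growing levels define [q] on the whole tree; treating each enumerated branch as argument and as
   value makes [q] and its inverse preserve eventual constancy. *)
pose D n (st : state) := (n <= st.1.1)%N /\ forall x, beta n = inr x ->
  (exists y, (x, y) \in st.2) /\ (exists y, (y, x) \in st.2).
have [|u [u0 hu]] := @chain _ (approx h) refines D (k, w, s) h0.
  move=> n [[k1 w1] s1] /(approx_level n)[k2 [w2 [nk2 h2 r2]]].
  have [[x nx]|nex] := pselect (exists x, beta n = inr x); last first.
    by exists (k2, w2, s1); split=> //; split=> // x nx; case: nex; exists x.
  have ex : eventually_constant x by have := beta_in n; rewrite nx.
  have [st3 [y3 [h3 r3 xy3]]] := approx_forth h2 ex.
  have [st4 [y4 [h4 r4 xy4]]] := approx_back hK h'K h3 ex.
  exists st4; split=> //; first by apply: refines_trans r2 _; exact: refines_trans r3 r4.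
  have [r41 _ r43] := r4; have [r31 _ _] := r3.
  split; first by apply: leq_trans r41; exact: leq_trans r31.
  by move=> z; rewrite nx => -[<-]; split; [exists y3; exact: r43|exists y4].
have mono m n : (m <= n)%N -> refines (u m) (u n).
  move=> /subnK <-; elim: (n - m)%N => [|i IH]; first exact: refines_refl.
  by rewrite addSn; have [_ r _] := hu (i + m)%N; exact: refines_trans IH r.
have ku n : (n <= (u n.+1).1.1)%N by have [_ _ []] := hu n.
pose q t := act (u (size t).+1).1.2 t; pose q' t := act (inverse_word (u (size t).+1).1.2) t.
have stable m n t : (size t <= (u m).1.1)%N -> (size t <= (u n).1.1)%N ->
    act (u m).1.2 t = act (u n).1.2 t.
  move=> mt nt; case: (leqP m n) => [mn|/ltnW nm].
    by have [_ e _] := mono _ _ mn; rewrite e.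
  by have [_ e _] := mono _ _ nm; rewrite e.
have qE n t : (size t <= (u n).1.1)%N -> q t = act (u n).1.2 t by move=> tn; exact: stable.
have stable' m n t : (size t <= (u m).1.1)%N -> (size t <= (u n).1.1)%N ->
    act (inverse_word (u m).1.2) t = act (inverse_word (u n).1.2) t.
  move=> mt nt; apply: (@act_inj (u m).1.2); rewrite act_inverse'.
  have -> : act (u m).1.2 (act (inverse_word (u n).1.2) t) =
            act (u n).1.2 (act (inverse_word (u n).1.2) t).
    by apply: stable; rewrite size_act.
  by rewrite act_inverse'.
have q'E n t : (size t <= (u n).1.1)%N -> q' t = act (inverse_word (u n).1.2) t.
  by move=> tn; exact: stable'.
have cq : coherent q.
  by move=> n; exists (u n.+1).1.2 => t tn; apply: qE; exact: leq_trans (ku n).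
have cq' : coherent q'.
  by move=> n; exists (inverse_word (u n.+1).1.2) => t tn; apply: q'E; exact: leq_trans (ku n).
have qK : cancel q q' by move=> t; rewrite /q' size_act act_inverse.
have q'K : cancel q' q by move=> t; rewrite /q size_act act_inverse'.
have pairE n p : p \in (u n).2 -> branch_map q p.1 = p.2.
  move=> pn; apply/funext => i; rewrite /branch_map; pose N := (n + i).+2.
  have [aN _ _] := hu N; have pN : p \in (u N).2.
    by have [_ _ sub] := mono n N (leq_trans (leq_addr i n) (leqW (leqnSn _))); exact: sub.
  have iN : (i.+1 <= (u N).1.1)%N.
    by apply: leq_trans (ku (n + i).+1); rewrite ltnS leq_addl.
  move: aN pN iN (@qE N); case: (u N) => [[kN wN] sN] [/(_ p) hN _] /hN[_ _ _ pE] /= iN qN.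
  rewrite -(take_mkseq _ iN) coherent_take // qN ?size_mkseq // -pE nth_take //.
  by rewrite nth_mkseq.
have indom x : eventually_constant x -> exists y n, (x, y) \in (u n).2.
  move=> ex; have := codeK (ex : in_basis (inr x)); set n := code _ => nx.
  by have [_ _ [_ /(_ x nx)[[y xy] _]]] := hu n; exists y, n.+1.
have inran x : eventually_constant x -> exists y n, (y, x) \in (u n).2.
  move=> ex; have := codeK (ex : in_basis (inr x)); set n := code _ => nx.
  by have [_ _ [_ /(_ x nx)[_ [y xy]]]] := hu n; exists y, n.+1.
have pairP n p : p \in (u n).2 -> [/\ eventually_constant p.1, eventually_constant p.2 &
    label p.2 = label_map h (label p.1)].
  by have [+ _ _] := hu n; case: (u n) => [[kn wn] sn] [hn _] /hn[].
exists q, q'; split=> //; split.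
- by move=> t tk; rewrite (@qE 0%N) u0.
- by move=> p ps; apply: (@pairE 0%N); rewrite u0.
- move=> x ex; have [y [n xy]] := indom x ex; rewrite (pairE n (x, y) xy).
  by have [] := pairP n _ xy.
- move=> x ex; have [y [n yx]] := inran x ex; have [ey _ lab] := pairP n _ yx.
  suff -> : branch_map q' x = y.
    by split=> //; move: lab => /= ->; rewrite /label_map !hK -surjective_pairing.
  have e : branch_map q y = x by exact: pairE n _ yx.
  apply/funext => i; rewrite {1}/branch_map -e.
  by rewrite mkseq_branch_map // qK nth_mkseq.
Qed.

End Extension.

(** * From tree automorphisms to group isomorphisms *)

Section Permutation.
Local Open Scope ring_scope.

Definition bas_map (q : seq int -> seq int) (z : bas) : bas :=
  match z with
  | inl (k, phi) => inl (k, q \o phi)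
  | inr x => inr (branch_map q x)
  end.

Definition perm_of (q : seq int -> seq int) (b : nat) : nat := code (bas_map q (beta b)).

Definition keeps_points (q : seq int -> seq int) : Prop :=
  forall x, eventually_constant x -> eventually_constant (branch_map q x).

Lemma bas_map_in q z : coherent q -> keeps_points q -> in_basis z -> in_basis (bas_map q z).
Proof.
move=> cq kq; case: z => [[k phi] [w ->]|x /kq //].
have [v vq] := cq k; exists (v ++ w); apply/funext => t /=.
by rewrite vq ?size_take_min ?geq_minl // act_cat (take_act v).
Qed.

Lemma beta_perm_of q b : coherent q -> keeps_points q ->
  beta (perm_of q b) = bas_map q (beta b).
Proof. by move=> cq kq; apply: codeK; apply: bas_map_in => //; exact: beta_in. Qed.

Lemma perm_of_code q z : in_basis z -> perm_of q (code z) = code (bas_map q z).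
Proof. by move=> bz; rewrite /perm_of codeK. Qed.

Lemma perm_ofK q q' : coherent q -> keeps_points q -> coherent q' ->
  cancel q q' -> cancel (perm_of q) (perm_of q').
Proof.
move=> cq kq cq' qK b; rewrite /perm_of [beta (code _)]beta_perm_of //.
rewrite -[RHS]betaK; congr code; case: (beta b) => [[k phi]|x] /=.
  by congr (inl (_, _)); apply/funext => t /=; rewrite qK.
congr inr; apply/funext => n; rewrite {1}/branch_map mkseq_branch_map // qK.
by rewrite nth_mkseq.
Qed.

(** [q] is composed on the left, while the partial maps truncate, translate on the right or
    evaluate, so they commute with [q]; labels and edges are respected through [h]. *)
Lemma kap_perm_of (H H' : structure graph_vocabulary) (h : nat -> nat) q :
  coherent q -> keeps_points q -> injective h ->
  (forall v w, edge H v w = edge H' (h v) (h w)) ->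
  (forall x, eventually_constant x -> label (branch_map q x) = label_map h (label x)) ->
  forall i, exists rho, forall b, kap H' i (perm_of q b) = omap rho (kap H i b).
Proof.
move=> cq kq h_inj hE lab.
have bin b := beta_in b.
case=> [k||l d w|k w||||].
- exists (perm_of q) => b; rewrite /kap beta_perm_of //.
  by case: (beta b) => [[l phi]|x] //=; case: eqP.
- exists (perm_of q) => b; rewrite /kap beta_perm_of //.
  by case: (beta b) => [[l phi]|x].
- exists (perm_of q) => b; rewrite /kap beta_perm_of //.
  case: (beta b) (bin b) => [[k phi]|x] //= lphi; case: eqP => //= kl.
  rewrite perm_of_code /=; last first.
    by apply: level_compr; apply: level_take lphi; rewrite kl leq_addr.
  congr (Some (code (inl (_, _)))); apply/funext => t /=.
  by rewrite coherent_take.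
(* Even codes are tree nodes, moved by [q]; odd codes are the basis vectors left apart by [kap],
   moved by [perm_of q]. *)
- exists (fun c => if odd c then (perm_of q c./2).*2.+1
                   else (pickle (q (test c./2))).*2) => b.
  rewrite /kap beta_perm_of //; case: (beta b) => [[l phi]|x] /=.
    case: eqP => _ /=; first by rewrite odd_double doubleK test_pickle.
    by rewrite odd_double /= uphalf_double.
  by rewrite odd_double doubleK test_pickle /= mkseq_branch_map.
- exists (fun c => if odd c then (perm_of q c./2).*2.+1 else (h c./2).*2) => b.
  rewrite /kap beta_perm_of //; case: (beta b) (bin b) => [[l phi]|x] /= ex.
    by rewrite odd_double /= uphalf_double.
  by rewrite odd_double doubleK lab.
- exists (fun c => if odd c then (perm_of q c./2).*2.+1 else (h c./2).*2) => b.
  rewrite /kap beta_perm_of //; case: (beta b) (bin b) => [[l phi]|x] /= ex.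
    by rewrite odd_double /= uphalf_double.
  by rewrite odd_double doubleK lab.
- exists (perm_of q) => b; rewrite /kap beta_perm_of //.
  case: (beta b) (bin b) => [[l phi]|x] //= ex.
  by rewrite lab //= (inj_eq h_inj); case: eqP.
- exists (perm_of q) => b; rewrite /kap beta_perm_of //.
  case: (beta b) (bin b) => [[l phi]|x] //= ex.
  by rewrite lab //= -hE; case: ifP.
Qed.

(** A permutation intertwining all the partial maps preserves their fibres and kernels, hence sends
    generators to generators; the inverse permutation gives the inverse map. *)
Lemma giso_perm (H H' : structure graph_vocabulary) (f f' : nat -> nat) (e : rat) :
  cancel f f' -> cancel f' f -> e * e = 1 ->
  (forall i, exists rho, forall b, kap H' i (f b) = omap rho (kap H i b)) ->
  (forall i, exists rho, forall b, kap H i (f' b) = omap rho (kap H' i b)) ->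
  exists2 g, giso (group_of H) (group_of H') g &
    forall n, elt H' (g n) = e *: lin (fun b => 'X^(f b)) (elt H n).
Proof.
move=> fK f'K ee hf hf'.
have e1 : e = 1 \/ e = -1.
  by have /eqP := ee; rewrite -expr2 sqrf_eq1 => /orP[]/eqP; [left|right].
have sp (K K' : structure graph_vocabulary) (u : nat -> nat) a :
    (forall i, exists rho, forall b, kap K' i (u b) = omap rho (kap K i b)) ->
    spanned (kap K) a -> spanned (kap K') (e *: lin (fun b => 'X^(u b)) a).
  move=> hu sa; have sl : spanned (kap K') (lin (fun b => 'X^(u b)) a).
    apply: spanned_lin sa => [i b b' bb'|i b b0]; have [rho hrho] := hu i; rewrite !hrho.
      by rewrite bb'.
    by rewrite b0.
  by case: e1 => ->; rewrite ?scale1r ?scaleN1r //; exact: spannedN.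
pose g n := index_of H' (e *: lin (fun b => 'X^(f b)) (elt H n)).
pose g' n := index_of H (e *: lin (fun b => 'X^(f' b)) (elt H' n)).
have gE n : elt H' (g n) = e *: lin (fun b => 'X^(f b)) (elt H n).
  by apply: index_ofK; apply: sp hf _; exact: elt_spanned.
have g'E n : elt H (g' n) = e *: lin (fun b => 'X^(f' b)) (elt H' n).
  by apply: index_ofK; apply: sp hf' _; exact: elt_spanned.
exists g => //.
have [aH _] := group_of_TFAB H; have [aH' _] := group_of_TFAB H'.
apply: giso_additive => // [|x y]; last first.
  by apply: (@elt_inj H'); rewrite elt_add !gE elt_add linearD scalerDr.
exists g' => n.
  apply: (@elt_inj H); rewrite g'E gE linearZ /= scalerA ee scale1r lin_comp.
  by rewrite -[RHS]lin_id; apply: eq_lin => b; rewrite linXn fK.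
apply: (@elt_inj H'); rewrite gE g'E linearZ /= scalerA ee scale1r lin_comp.
by rewrite -[RHS]lin_id; apply: eq_lin => b; rewrite linXn f'K.
Qed.

(* The scalar e = 1 or -1 accounts for the automorphism x |-> -x. *)
Lemma giso_extension (H H' : structure graph_vocabulary) (h h' : nat -> nat) k w s (e : rat) :
  cancel h h' -> cancel h' h -> (forall u v, edge H u v = edge H' (h u) (h v)) ->
  e * e = 1 -> approx h (k, w, s) ->
  exists g q, [/\ giso (group_of H) (group_of H') g,
    coherent q, forall t, (size t <= k)%N -> q t = act w t,
    forall p, p \in s -> branch_map q p.1 = p.2 &
    [/\ keeps_points q,
      forall x, eventually_constant x -> label (branch_map q x) = label_map h (label x) &
      forall n, elt H' (g n) = e *: lin (fun b => 'X^(perm_of q b)) (elt H n)]].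
Proof.
move=> hK h'K hE ee /(tree_extension hK h'K)[q [q' [cq cq' qK q'K [qw qs qp q'p]]]].
have kq : keeps_points q by move=> x /qp[].
have kq' : keeps_points q' by move=> x /q'p[].
have [||g ig gE] := @giso_perm H H' (perm_of q) (perm_of q') e
    (perm_ofK cq kq cq' qK) (perm_ofK cq' kq' cq q'K) ee.
- by apply: (@kap_perm_of _ _ h) => //; [exact: can_inj hK|move=> x /qp[]].
- apply: (@kap_perm_of _ _ h') => //; [exact: can_inj h'K| |by move=> x /q'p[]].
  by move=> v u; rewrite hE !h'K.
by exists g, q; split=> //; split=> // x /qp[].
Qed.

End Permutation.

(** * Recovering the graph *)

Section GroupIsomorphisms.

Lemma giso_inv M N g : giso M N g -> exists g', [/\ giso N M g', cancel g g' & cancel g' g].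
Proof.
move=> [[g' gK g'K] g0 gD gN]; exists g'; split=> //; split=> [|||].
- by exists g.
- by rewrite -g0 gK.
- by move=> x y; apply: (can_inj gK); rewrite gD !g'K.
- by move=> x; apply: (can_inj gK); rewrite gN !g'K.
Qed.

Lemma giso_comp M N P f g : giso M N f -> giso N P g -> giso M P (g \o f).
Proof.
move=> [bf f0 fD fN] [bg g0 gD gN]; split=> [|||] /=.
- exact: bij_comp.
- by rewrite f0.
- by move=> x y; rewrite fD gD.
- by move=> x; rewrite fN gN.
Qed.

End GroupIsomorphisms.

Section VertexGraph.

(** Taking the least vertex of each class is a canonical choice, so that the vertices are numbered
    in a Borel way. *)
Definition representative (M : gstruct) (x : nat) : Prop :=
  vertex M x /\ forall y, y < x -> ~ (vertex M y /\ similar M Lab1 y x).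

Definition vertex_of (M : gstruct) : nat -> nat := enum_of (representative M).

(** Symmetry and irreflexivity are forced, so that every structure [M] yields a graph. *)
Definition joined (M : gstruct) (i j : nat) : Prop :=
  i <> j /\ (adjacent M (vertex_of M i) (vertex_of M j) \/
             adjacent M (vertex_of M j) (vertex_of M i)).

Definition vertex_graph (M : gstruct) : structure graph_vocabulary :=
  (fun f : void => match f with end,
   fun (r : unit) (a : 2.-tuple nat) => `[< joined M (nth 0 a 0) (nth 0 a 1) >]).

Lemma edge_vertex_graph M i j : edge (vertex_graph M) i j = `[< joined M i j >].
Proof. by []. Qed.

Lemma vertex_graph_Graphs M : Graphs_omega (vertex_graph M).
Proof.
split=> [i j|i]; rewrite ?edge_vertex_graph; last by apply/negbTE/asboolP => -[].
by apply/asboolP/asboolP => -[ij h]; split; [exact: nesym|case: h; [right|left]|exact: nesym|case: h; [right|left]].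
Qed.

Lemma bpred_vertex_of i n : bpred (fun M => vertex_of M i = n).
Proof.
apply: bpred_enum_of => x; apply: bpred_and; first exact: def1_bpred def_vertex _.
apply: bpred_all => y; apply: bpred_imp; first exact: bpred_cst.
apply: bpred_not; apply: bpred_and; first exact: def1_bpred def_vertex _.
exact: def2_bpred (def_similar _) _ _.
Qed.

Lemma borel_vertex_graph : borel_map vertex_graph.
Proof.
apply: borel_map_structure => -[[[[] //]]|[[r a] b]]; case: r a => a /=.
have badj i j : bpred (fun M => adjacent M (vertex_of M i) (vertex_of M j)).
  apply: (@bpred_comp _ _ (fun M => vertex_of M i)
    (fun x M => adjacent M x (vertex_of M j))) => x; first exact: bpred_vertex_of.
  apply: (@bpred_comp _ _ (fun M => vertex_of M j) (fun y M => adjacent M x y)) => y.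
    exact: bpred_vertex_of.
  exact: def2_bpred def_adjacent _ _.
have bj : bpred (fun M => joined M (nth 0 a 0) (nth 0 a 1)).
  by apply: bpred_and; [exact: bpred_cst|apply: bpred_or; exact: badj].
case: b; [apply: bpred_ext bj|apply: bpred_ext (bpred_not bj)] => M /=.
  by split=> [/asboolP|/asboolP].
by split=> [nj|/asboolP//]; apply/asboolP.
Qed.

(** Pulled back to the group of [H], a vertex is a multiple of a branch labelled [(v, v)], and
    [Lab1] similarity compares the [v]. Each [v] thus has exactly one representative, which matches
    its index in the vertex graph with [v]. *)
Lemma vertex_graph_giso (H : structure graph_vocabulary) M g :
  Graphs_omega H -> giso (group_of H) M g ->
  exists h h', [/\ cancel h h', cancel h' h,
    forall u v, edge H u v = edge (vertex_graph M) (h u) (h v) &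
    forall i, exists n y c, [/\ g n = vertex_of M i, at_point H y c n &
      label y = (h' i, h' i)]].
Proof.
move=> [sH iH] ig; have [g' [ig' gK g'K]] := giso_inv ig.
have /choice[lab labP] : forall y, exists v, vertex M y ->
    exists x c, at_point H x c (g' y) /\ label x = (v, v).
  move=> y; have [vy|nvy] := pselect (vertex M y); last by exists 0.
  have /vertexP[x [c [hx lx]]] : vertex (group_of H) (g' y).
    by rewrite -(def1_giso _ def_vertex ig').
  by exists (label x).1 => _; exists x, c; rewrite {2}lx -surjective_pairing.
have simP y z : vertex M y -> vertex M z -> similar M Lab1 y z <-> lab y = lab z.
  move=> vy vz; have [x [c [hx lx]]] := labP y vy; have [x' [c' [hx' lx']]] := labP z vz.
  by rewrite (def2_giso _ _ (def_similar _) ig') (similar_lab1 hx hx') lx lx'.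
have lab_pad v : vertex M (g (pad_point H (v, v))) /\ lab (g (pad_point H (v, v))) = v.
  have hp := at_pad_point H (v, v).
  have vp : vertex M (g (pad_point H (v, v))).
    rewrite -(def1_giso _ def_vertex ig); apply/vertexP.
    by exists (pad_label [::] (v, v)), 1%R; rewrite label_pad.
  split=> //; have [x [c [hx lx]]] := labP _ vp; rewrite gK in hx.
  by have [xE _] := at_point_inj hx hp; move: lx; rewrite xE label_pad => -[].
have rep_inj y z : representative M y -> representative M z -> lab y = lab z -> y = z.
  move=> [vy ymin] [vz zmin] yz; have [lt|lt|//] := ltngtP y z.
    by case: (zmin y lt); split=> //; apply/simP.
  by case: (ymin z lt); split=> //; apply/simP.
have rep_ex v : exists y, representative M y /\ lab y = v.
  have ex : exists y, `[< vertex M y /\ lab y = v >].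
    by exists (g (pad_point H (v, v))); apply/asboolP; exact: lab_pad.
  have [y /asboolP[vy ly] ymin] := ex_minnP ex.
  exists y; split=> //; split=> // z zy [vz /(simP _ _ vz vy) zl].
  by move: zy; rewrite ltnNge ymin //; apply/asboolP; rewrite zl.
have unb : unbounded (representative M).
  have [r rP] := choice rep_ex.
  have r_inj : injective r.
    by move=> u v e; have [_ <-] := rP u; have [_ <-] := rP v; rewrite e.
  by move=> m; have [k mk] := inj_unbounded r_inj m; exists (r k); split=> //; case: (rP k).
have /choice[h hP] : forall v, exists i, lab (vertex_of M i) = v.
  move=> v; have [y [ry yv]] := rep_ex v; have [i iy] := enum_of_surj unb ry.
  by exists i; rewrite /vertex_of iy.
pose h' i := lab (vertex_of M i).
have repM i : representative M (vertex_of M i) by exact: enum_ofP unb i.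
have hK : cancel h h' by exact: hP.
have h'K : cancel h' h.
  move=> i; apply: (enum_of_inj unb); apply: rep_inj; [exact: repM|exact: repM|].
  exact: hP.
exists h, h'; split=> // [u v|i]; last first.
  have [x [c [hx lx]]] := labP _ (repM i).1.
  by exists (g' (vertex_of M i)), x, c; rewrite g'K.
have adjE i j : adjacent M (vertex_of M i) (vertex_of M j) <-> edge H (h' i) (h' j).
  have [x [c [hx lx]]] := labP _ (repM i).1; have [y [d [hy ly]]] := labP _ (repM j).1.
  by rewrite (def2_giso _ _ def_adjacent ig') (adjacentP hx hy) lx ly.
rewrite edge_vertex_graph; apply/idP/asboolP => [euv|[_]].
  split; first by move/(can_inj hK) => uv; move: euv; rewrite uv iH.
  by left; rewrite adjE !hK.
by rewrite !adjE !hK => -[//|]; rewrite sH.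
Qed.

Lemma graph_isomorphicP (H H' : structure graph_vocabulary) : isomorphic H H' <->
  exists h h', [/\ cancel h h', cancel h' h & forall u v, edge H u v = edge H' (h u) (h v)].
Proof.
split=> [[h [h' hK h'K] [_ hE]]|[h [h' [hK h'K hE]]]].
  exists h, h'; split=> // u v; rewrite /edge (hE tt).
  by congr (rinterp H' tt _); exact: val_inj.
exists h; first by exists h'.
split=> [[]//|[] a] /=.
case/tupleP: a => u a; case/tupleP: a => v a; rewrite (tuple0 a).
have -> : [tuple of u :: [tuple of v :: [tuple]]] = [tuple u; v] by exact: val_inj.
rewrite -[LHS]/(edge H u v) hE; congr (rinterp H' tt _); exact: val_inj.
Qed.

Lemma isomorphic_sym (L : vocabulary) (M N : structure L) : isomorphic M N -> isomorphic N M.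
Proof.
move=> [g [g' gK g'K] [fg rg]]; exists g'; first by exists g.
have mapK n (a : n.-tuple nat) : map_tuple g (map_tuple g' a) = a.
  by apply: val_inj; rewrite /= -map_comp map_id_in // => x _; exact: g'K.
split=> [f a|r a]; last by rewrite rg mapK.
by apply: (can_inj gK); rewrite fg mapK g'K.
Qed.

Lemma isomorphic_trans (L : vocabulary) (M N P : structure L) :
  isomorphic M N -> isomorphic N P -> isomorphic M P.
Proof.
move=> [f bf [ff rf]] [g bg [fg rg]]; exists (g \o f); first exact: bij_comp.
have mapE n (a : n.-tuple nat) : map_tuple g (map_tuple f a) = map_tuple (g \o f) a.
  by apply: val_inj; rewrite /= -map_comp.
by split=> [s a|r a] /=; rewrite ?ff ?fg ?rf ?rg mapE.
Qed.

Lemma group_of_iso (H H' : structure graph_vocabulary) :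
  isomorphic H H' -> isomorphic (group_of H) (group_of H').
Proof.
move=> /graph_isomorphicP[h [h' [hK h'K hE]]]; apply/gisoP.
have h0 : approx h (0, [::], [::]) by split.
have [g [q [ig _ _ _ _]]] := giso_extension hK h'K hE (mulr1 1%R) h0.
by exists g.
Qed.

Lemma vertex_graph_iso (H : structure graph_vocabulary) M : Graphs_omega H ->
  isomorphic (group_of H) M -> isomorphic H (vertex_graph M).
Proof.
move=> gH /gisoP[g ig]; have [h [h' [hK h'K hE _]]] := vertex_graph_giso gH ig.
by apply/graph_isomorphicP; exists h, h'.
Qed.

(** If the groups are isomorphic, both graphs are isomorphic to the vertex graph of the second
    group. *)
Lemma group_map_reduction : borel_reduction group_map.
Proof.
split; first exact: borel_group_map.
have gr (H : Graphs_omega) : Graphs_omega (val H) by case: H => H /= /set_mem.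
move=> H1 H2; split; first exact: group_of_iso.
move=> iso12; apply: isomorphic_trans (vertex_graph_iso (gr H1) iso12) _.
apply: isomorphic_sym; apply: vertex_graph_iso => //.
by apply/gisoP; exists id; split=> //; exists id.
Qed.

End VertexGraph.

Lemma graphs_interpretable : graphs_interpretable_in TFAB_omega.
Proof.
have [dom domP] := def_vertex (defterm_head 0).
have [eqf eqfP] := def_similar Lab1 (defterm_head 1) (defterm_behead (defterm_head 0)).
have [adj adjP] := def_adjacent (defterm_head 1) (defterm_behead (defterm_head 0)).
exists (@InterpretationScheme group_vocabulary 1 isT dom eqf adj), group_map.
split; first exact: group_map_reduction.
move=> HH; set H := val HH.
have /choice[lab labP] : forall n, exists v, vertex (group_of H) n ->
    exists x c, at_point H x c n /\ label x = (v, v).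
  move=> n; have [|nv] := pselect (vertex (group_of H) n); last by exists 0.
  move=> /vertexP[x [c [hx lx]]]; exists (label x).1 => _; exists x, c.
  by rewrite {2}lx -surjective_pairing.
exists (fun a : 1.-tuple nat => lab (thead a)) => [v _|a b].
  have hp := at_pad_point H (v, v).
  have vp : vertex (group_of H) (pad_point H (v, v)).
    by apply/vertexP; exists (pad_label [::] (v, v)), 1%R; rewrite label_pad.
  exists [tuple pad_point H (v, v)]; first exact/domP.
  have [x [c [hx lx]]] := labP _ vp; have [xE _] := at_point_inj hx hp.
  by move: lx; rewrite xE label_pad => -[].
move=> /domP va /domP vb.
have [x [c [hx lx]]] := labP _ va; have [y [d [hy ly]]] := labP _ vb.
have hd : thead [tuple of a ++ b] = thead a.
  by case/tupleP: a {va hx lx} => u a; rewrite !theadE.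
have tl : thead (behead_tuple [tuple of a ++ b]) = thead b.
  case/tupleP: a {va hx lx hd} => u a; case/tupleP: b {vb hy ly} => w b.
  by rewrite (tuple0 a) /thead !(tnth_nth 0).
split; first by rewrite eqfP hd tl (similar_lab1 hx hy) lx ly.
by rewrite adjP hd tl (adjacentP hx hy) lx ly.
Qed.

(** * Types of tuples *)

Definition place := ((nat * word) + nat)%type.

(** The level of a frame; for each of a list of points, a word locating its node at that level and
    its label; for each entry of the tuple, a denominator and an integer combination of places. *)
Definition type_data :=
  (nat * seq (word * (nat * nat)) * seq (nat * seq (int * place)))%type.

Section Types.

(* The element of level l obtained from the frame y of level k by the word w,
   or one of the points. *)
Definition placed (M : gstruct) (k y : nat) (xs : seq nat) (p : place) (z : nat) : Prop :=
  match p with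
  | inl (l, w) => divisible M (SortY l) z /\ divisible M (Proj l (k - l.+1) w) (sb M y z)
  | inr j => z = nth (zero M) xs j
  end.

Fixpoint combination (M : gstruct) (k y : nat) (xs : seq nat) (l : seq (int * place))
    (z : nat) : Prop :=
  if l is (r, p) :: l' then
    exists u z', [/\ placed M k y xs p u, combination M k y xs l' z' &
      add M (zsm M r u) z' = z]
  else zero M = z.

(** A countable family of conditions replaces infinitary types. The [Att] clause carries no
    multipliers, so it forces the points to have the same scalar as the frame; the clause on primes
    then makes this scalar a sign. The map [v] names the vertices, so that labels can be compared
    between two groups. *)
Definition has_type (M : gstruct) (v : nat -> nat) (d : type_data) (s : seq nat) : Prop :=
  let: (k, js, cs) := d in
  exists y (xs : seq nat), [/\ size xs = size js, frame M k y,
    forall x j, (x, j) \in zip xs js -> [/\ point M x,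
      similar M Lab1 x (v j.2.1), similar M Lab2 x (v j.2.2) &
      divisible M (Att k j.1) (sb M x y)],
    forall p x, prime p -> x \in xs ->
      ~ ((exists c, nsm M p c = y) /\ (exists c, nsm M p c = x)) &
    size s = size cs /\ forall z c, (z, c) \in zip s cs ->
      combination M k y xs c.2 (nsm M c.1 z)].

Definition same_type (M : gstruct) (v : nat -> nat) (N : gstruct) (v' : nat -> nat)
    (s t : seq nat) : Prop :=
  [/\ size s = size t,
    forall p q r, p \in zip s t -> q \in zip s t -> r \in zip s t ->
      (p.1 = q.1 <-> p.2 = q.2) /\ (add M p.1 q.1 = r.1 <-> add N p.2 q.2 = r.2) &
    forall d, has_type M v d s <-> has_type N v' d t].

Definition pointed_iso (M : gstruct) (v : nat -> nat) (N : gstruct) (v' : nat -> nat)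
    (g : nat -> nat) : Prop :=
  giso M N g /\ forall x i, point M x ->
    (similar M Lab1 x (v i) <-> similar N Lab1 (g x) (v' i)) /\
    (similar M Lab2 x (v i) <-> similar N Lab2 (g x) (v' i)).

Lemma giso_nsm M N g n x : giso M N g -> g (nsm M n x) = nsm N n (g x).
Proof.
by move=> [_ g0 gD _]; elim: n => [|n IH]; [exact: g0|rewrite /nsm !iterS gD -!/(nsm _ n _) IH].
Qed.

Lemma giso_zsm M N g z x : giso M N g -> g (zsm M z x) = zsm N z (g x).
Proof.
move=> ig; case: z => n; rewrite /zsm; first exact: giso_nsm.
by have [_ _ _ ->] := ig; rewrite (giso_nsm _ _ ig).
Qed.

Lemma giso_sb M N g x y : giso M N g -> g (sb M x y) = sb N (g x) (g y).
Proof. by move=> [_ _ gD gN]; rewrite /sb gD gN. Qed.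

Lemma pointed_iso_inv M v N v' g : pointed_iso M v N v' g ->
  exists g', [/\ pointed_iso N v' M v g', cancel g g' & cancel g' g].
Proof.
move=> [ig hg]; have [g' [ig' gK g'K]] := giso_inv ig; exists g'; split=> //; split=> // x i px.
have px' : point M (g' x) by rewrite -(def1_giso _ def_point ig').
by have [h1 h2] := hg (g' x) i px'; rewrite g'K in h1 h2; split; apply: iff_sym.
Qed.

Lemma pointed_iso_comp M v N v' P v'' f g : pointed_iso M v N v' f ->
  pointed_iso N v' P v'' g -> pointed_iso M v P v'' (g \o f).
Proof.
move=> [jf hf] [jg hg]; split=> [|x i px]; first exact: giso_comp jf jg.
have py : point N (f x) by rewrite -(def1_giso _ def_point jf).
have [f1 f2] := hf x i px; have [g1 g2] := hg (f x) i py.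
by split; [exact: iff_trans f1 g1|exact: iff_trans f2 g2].
Qed.

Lemma combination_giso M N g k y xs l z : giso M N g ->
  combination M k y xs l z -> combination N k (g y) (map g xs) l (g z).
Proof.
move=> ig; have [_ g0 gD _] := ig; elim: l z => [|[r p] l IH] z /=; first by rewrite -g0 => ->.
move=> [u [z' [pu cz' <-]]]; exists (g u), (g z'); split; first last.
- by rewrite gD (giso_zsm _ _ ig).
- exact: IH.
case: p pu => [[m w] [h1 h2]|j ->] /=; last first.
  have [jxs|jxs] := ltnP j (size xs); first by rewrite (nth_map (zero M)).
  by rewrite !nth_default ?size_map.
split; first by rewrite -(def1_giso _ (def_divisible _) ig).
by rewrite -(giso_sb _ _ ig) -(def1_giso _ (def_divisible _) ig).
Qed.

Lemma mem_zip_map (I J : eqType) (f : nat -> I) (s : seq nat) (t : seq J) x y :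
  (x, y) \in zip (map f s) t -> exists2 x', (x', y) \in zip s t & x = f x'.
Proof.
elim: s t => [|a s IH] [|b t] //=; rewrite inE => /predU1P[[-> ->]|/IH[x' xy ->]].
  by exists a; rewrite ?mem_head.
by exists x'; rewrite ?inE ?xy ?orbT.
Qed.

Lemma has_type_giso M v N v' g d s : pointed_iso M v N v' g ->
  has_type M v d s -> has_type N v' d (map g s).
Proof.
move=> [ig hg]; have [g' [_ gK _]] := giso_inv ig.
case: d => [[k js] cs] [y [xs [sz fy hxs hp [ss hs]]]].
exists (g y), (map g xs); split; rewrite ?size_map //.
- by rewrite -(def1_giso _ (def_frame k) ig).
- move=> x j /mem_zip_map[x' xj ->] /=.
  have [px s1 s2 ax] := hxs x' j xj; split.
  + by rewrite -(def1_giso _ def_point ig).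
  + by have [<- _] := hg x' j.2.1 px.
  + by have [_ <-] := hg x' j.2.2 px.
  + by rewrite -(giso_sb _ _ ig) -(def1_giso _ (def_divisible _) ig).
- move=> p x pp /mapP[x' xs' ->] [[c cy] [d dx]]; apply: (hp p x' pp xs').
  have [g'' [ig'' gK'' _]] := giso_inv ig.
  split; [exists (g'' c)|exists (g'' d)].
    by rewrite -(giso_nsm _ _ ig'') cy gK''.
  by rewrite -(giso_nsm _ _ ig'') dx gK''.
split; rewrite ?size_map // => z c /mem_zip_map[z' zc ->] /=.
by rewrite -(giso_nsm _ _ ig); apply: combination_giso; [|exact: hs].
Qed.

Lemma same_type_pointed_iso M v N v' g s : pointed_iso M v N v' g ->
  same_type M v N v' s (map g s).
Proof.
move=> hg; have [g' [hg' gK g'K]] := pointed_iso_inv hg; have [ig _] := hg.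
split=> [|p q r|d]; first by rewrite size_map.
- have zipE x : x \in zip s (map g s) -> x.2 = g x.1.
    rewrite -{1}[s]map_id zip_map => /mapP[a _ ->] //.
  move=> /zipE pE /zipE qE /zipE rE; rewrite pE qE rE; have [_ _ gD _] := ig.
  by split; [split=> [->|/(can_inj gK)]|rewrite -gD; split=> [->|/(can_inj gK)]].
split; first exact: has_type_giso.
by move=> /(has_type_giso hg'); rewrite -map_comp map_id_in // => x _; exact: gK.
Qed.

Lemma same_type_trans M v N v' P v'' s t u : same_type M v N v' s t ->
  same_type N v' P v'' t u -> same_type M v P v'' s u.
Proof.
move=> [st at1 ty1] [tu at2 ty2]; split; first by rewrite st.
- move=> p q r ps qs rs.
  have nthP (x : nat * nat) : x \in zip s u -> exists2 i, i < size s & x = (nth 0 s i, nth 0 u i).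
    move=> /(nthP (0, 0))[i]; rewrite size_zip -tu -st minnn => ilt <-.
    by exists i => //; rewrite nth_zip // st.
  have [i il ->] := nthP p ps; have [j jl ->] := nthP q qs; have [k kl ->] := nthP r rs.
  have in1 l : l < size s -> (nth 0 s l, nth 0 t l) \in zip s t.
    by move=> ll; rewrite -nth_zip //; apply: mem_nth; rewrite size_zip -st minnn.
  have in2 l : l < size s -> (nth 0 t l, nth 0 u l) \in zip t u.
    by move=> ll; rewrite -nth_zip //; apply: mem_nth; rewrite size_zip -tu -st minnn.
  have [a1 b1] := at1 _ _ _ (in1 i il) (in1 j jl) (in1 k kl).
  have [a2 b2] := at2 _ _ _ (in2 i il) (in2 j jl) (in2 k kl).
  by split; [exact: iff_trans a1 a2|exact: iff_trans b1 b2].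
by move=> d; exact: iff_trans (ty1 d) (ty2 d).
Qed.

Lemma same_type_sym M v N v' s t : same_type M v N v' s t -> same_type N v' M v t s.
Proof.
move=> [st at1 ty1]; split=> // [p q r|d]; last exact: iff_sym.
have swap (x : nat * nat) : x \in zip t s -> (x.2, x.1) \in zip s t.
  move=> /(nthP (0, 0))[i]; rewrite size_zip -st minnn => ilt <-.
  by rewrite nth_zip //= -nth_zip //; apply: mem_nth; rewrite size_zip -st minnn.
by move=> /swap ps /swap qs /swap rs; have [/= a b] := at1 _ _ _ ps qs rs; split; apply: iff_sym.
Qed.

Definition back_forth (M : gstruct) (v : nat -> nat) (N : gstruct) (v' : nat -> nat) : Prop :=
  same_type M v N v' [::] [::] /\ forall s t, same_type M v N v' s t ->
    (forall x, exists y, same_type M v N v' (x :: s) (y :: t)) /\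
    (forall y, exists x, same_type M v N v' (x :: s) (y :: t)).

Lemma back_forth_isomorphic M v N v' : is_abelian_group M -> is_abelian_group N ->
  back_forth M v N v' -> isomorphic M N.
Proof.
move=> aM aN [st0 hst].
have [|||g bg gD] := @back_and_forth M N (same_type M v N v') st0.
- by move=> s t /hst[].
- by move=> s t /hst[].
- by move=> s t [].
by apply/gisoP; exists g; exact: giso_additive.
Qed.

(** By homogeneity of [N], any two tuples of the same type are matched by some pointed isomorphism
    from [M] to [N], which answers every new element on either side. *)
Lemma pointed_iso_back_forth M v N v' g : pointed_iso M v N v' g ->
  (forall s t, same_type N v' N v' s t ->
    exists2 f, pointed_iso N v' N v' f & map f s = t) ->
  back_forth M v N v'.
Proof.
move=> hg homog; split; first exact: (same_type_pointed_iso [::] hg).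
move=> s t st.
have [f hf ft] := homog (map g s) t
  (same_type_trans (same_type_sym (same_type_pointed_iso s hg)) st).
have hfg := pointed_iso_comp hg hf.
have [g' [_ gK g'K]] := pointed_iso_inv hfg.
have tE : t = map (f \o g) s by rewrite map_comp.
split=> x; first by exists (f (g x)); rewrite tE; exact: (same_type_pointed_iso (x :: s) hfg).
by exists (g' x); rewrite tE -{2}(g'K x); exact: (same_type_pointed_iso (g' x :: s) hfg).
Qed.

End Types.

(** * Tuples of the same type are conjugate *)

Section Homogeneity.
Local Open Scope ring_scope.
Variable H : structure graph_vocabulary.
Notation G := (group_of H).
Notation klin := (klin (kap H)).

(** Integrality is checked prime by prime. For the prime of relation [i], one of the two vectors
    survives under [kap i], and its image has coefficient [c]; other primes occur in no
    denominator. *)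
Lemma int_scalar k phi x (c : rat) : level k phi -> eventually_constant x ->
  spanned (kap H) (c *: 'X^(code (inl (k, phi)))) ->
  spanned (kap H) (c *: 'X^(code (inr x))) -> c \is a Num.int.
Proof.
move=> lphi ex s1 s2; apply: int_of_pint => p pp.
have [[i ip]|nex] := pselect (exists i, rel_prime i = p); last first.
  suff : pint p (lin (fun b => vec (Some b)) (c *: 'X^(code (inr x))))`_(code (inr x)).
    by rewrite lin_id coef_monomial eqxx.
  apply: spanned_pint s2 => // [b|i b o ip]; first exact: intpoly_vec.
  by case: nex; exists i.
have key b d : kap H i b = Some d -> spanned (kap H) (c *: 'X^b) -> pint p c.
  move=> bd sb; suff : pint p (klin i (c *: 'X^b))`_d.
    by rewrite klin_monomial bd coef_monomial eqxx.
  apply: spanned_pint sb => // [b'|j b' o jp]; first exact: intpoly_vec.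
  have -> : j = i by apply: (pcan_inj (@pickleK _)); apply: prime_seq_inj; rewrite -ip in jp.
  by move=> ->; case: o.
(* Truncated maps are killed only by [SortY], branches only by [SortX], [Diag] and [EdgeU]. *)
have : kap H i (code (inl (k, phi))) <> None \/ kap H i (code (inr x)) <> None.
  by rewrite /kap !codeK //; case: i {ip key} => [l||l d w|l w||||]; by [right|left|left; case: eqP].
case e1 : (kap H i (code (inl (k, phi)))) => [d|]; first by move=> _; exact: key e1 s1.
by case e2 : (kap H i (code (inr x))) => [d|] => [_|[]//]; exact: key e2 s2.
Qed.

(** The scalar is an integer, and a prime factor of it would divide both vectors inside the
    group. *)
Lemma unit_scalar k phi c y x n : at_frame H k phi c y -> at_point H x c n ->
  (forall p, prime p -> ~ ((exists m, nsm G p m = y) /\ (exists m, nsm G p m = n))) ->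
  c * c = 1.
Proof.
move=> [lphi c0 yE] [ex _ nE] hp.
have : c \is a Num.int.
  by apply: (@int_scalar k phi x); rewrite -?yE -?nE //; exact: elt_spanned.
move=> /intrP[z cE].
have z0 : z != 0 by move: c0; rewrite cE intr_eq0.
have [z1|z1] := ltnP 1 `|z|%N; last first.
  by rewrite cE -intrM; case: z z0 z1 {cE} => [[|[|m]]|[|m]].
have [p pp pz] := pdivP z1; case: (hp p pp).
have /dvdzP[z' zE] : (p%:Z %| z)%Z by rewrite dvdzE.
have divided b m : elt H m = c *: 'X^b -> exists m', nsm G p m' = m.
  move=> mE; exists (index_of H (z'%:~R *: 'X^b)); apply: (@elt_inj H).
  rewrite elt_nsm index_ofK; last first.
    by apply: spanned_intpoly; apply: intpoly_monomial; exact: rpred_int.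
  by rewrite mE cE zE -scaler_nat scalerA intrM mulrC.
by split; [exact: divided yE|exact: divided nE].
Qed.

Definition spot (phi : seq int -> seq int) (pts : seq (nat -> int)) (p : place) : nat :=
  match p with
  | inl (l, w) => code (inl (l, take l \o phi \o act w))
  | inr j => code (inr (nth (fun=> 0) pts j))
  end.

Definition place_ok (k n : nat) (p : place) : bool :=
  match p with inl (l, _) => (l < k)%N | inr j => (j < n)%N end.

Section Combination.
Variables (k : nat) (phi : seq int -> seq int) (c : rat) (y : nat) (xs : seq nat).
Variable pts : seq (nat -> int).
Hypothesis hy : at_frame H k phi c y.
Hypothesis hxs : forall j, (j < size xs)%N -> at_point H (nth (fun=> 0) pts j) c (nth 0%N xs j).
Hypothesis cc : c * c = 1.

Lemma scalar_int : c \is a Num.int.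
Proof.
have /eqP := cc; rewrite -expr2 sqrf_eq1 => /orP[]/eqP->; [exact: rpred1|exact: rpredN1].
Qed.

Lemma placedP p z : place_ok k (size xs) p ->
  placed G k y xs p z <-> elt H z = c *: 'X^(spot phi pts p).
Proof.
have [lphi c0 yE] := hy; case: p => [[l w]|j] /= ok; last first.
  have [_ _ jE] := hxs ok; rewrite (set_nth_default 0%N) //.
  by split=> [->//|]; rewrite -jE => /(@elt_inj H).
have kE : k = (l + (k - l.+1).+1)%N by lia.
have sy : klin (SortY (l + (k - l.+1).+1)) (elt H y) = 0.
  by rewrite yE -kE klin_sortY_monomial.
have tE : translate l w (elt H y) = c *: 'X^(code (inl (l, take l \o phi \o act w))).
  by rewrite yE linearZ /= (@translate_code k).
rewrite !divisibleP elt_sb; split=> [[sz]|zE].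
  by move/(klin_proj _ sy sz); rewrite tE.
have sz : klin (SortY l) (elt H z) = 0.
  rewrite zE; apply: klin_sortY_monomial; apply: level_compr; apply: level_take lphi.
  exact: ltnW.
by split=> //; apply/(klin_proj _ sy sz); rewrite tE.
Qed.

Lemma combinationP l z : (forall q, q \in l -> place_ok k (size xs) q.2) ->
  combination G k y xs l z <->
  elt H z = c *: \sum_(q <- l) q.1%:~R *: 'X^(spot phi pts q.2).
Proof.
elim: l z => [|[r p] l IH] z ok /=.
  rewrite big_nil scaler0 -(elt_zero H); split=> [->//|e].
  by apply: (@elt_inj H); rewrite e.
have okp : place_ok k (size xs) p by apply: (ok (r, p)); exact: mem_head.
have {}IH z' : combination G k y xs l z' <->
    elt H z' = c *: \sum_(q <- l) q.1%:~R *: 'X^(spot phi pts q.2).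
  by apply: IH => q ql; apply: ok; rewrite inE ql orbT.
rewrite big_cons scalerDr; split=> [[u [z' [/(placedP _ okp) uE /IH zE <-]]]|zE].
  by rewrite elt_add elt_zsm uE zE /= scalerA mulrC -scalerA scaler_int.
pose u := index_of H (c *: 'X^(spot phi pts p)).
pose z' := index_of H (c *: \sum_(q <- l) q.1%:~R *: 'X^(spot phi pts q.2)).
have uE : elt H u = c *: 'X^(spot phi pts p).
  by apply: index_ofK; apply: spanned_intpoly; apply: intpoly_monomial; exact: scalar_int.
have z'E : elt H z' = c *: \sum_(q <- l) q.1%:~R *: 'X^(spot phi pts q.2).
  apply: index_ofK; apply: spanned_intpoly; apply/polyOverP => i.
  rewrite coefZ coef_sum; apply: rpredM; first exact: scalar_int.
  apply: rpred_sum => q _; rewrite coef_monomial; case: ifP => _; [exact: rpred_int|exact: rpred0].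
exists u, z'; split; [exact/(placedP _ okp)|exact/IH|].
apply: (@elt_inj H); rewrite elt_add elt_zsm uE z'E zE; congr (_ + _).
by rewrite -scaler_int !scalerA mulrC.
Qed.

End Combination.
End Homogeneity.

Section Description.
Local Open Scope ring_scope.
Variable H : structure graph_vocabulary.
Notation G := (group_of H).
Notation klin := (klin (kap H)).
Notation x0 := (fun=> 0 : int).
Notation j0 := ([::] : word, (0%N, 0%N)).

Lemma divisible_att k phi c y x c' n w : at_frame H k phi c y -> at_point H x c' n ->
  divisible G (Att k w) (sb G n y) <-> c' = c /\ mkseq x k = phi (act w (nseq k 0)).
Proof.
move=> [lphi c0 yE] [ex c'0 nE].
rewrite divisibleP elt_sb nE yE linearB /= !klin_monomial kap_att_frame // kap_att_point //.
split=> [/eqP|[-> ->]]; last by rewrite subrr.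
rewrite subr_eq0 => /eqP /(monomial_inj c'0)[/double_inj/(pcan_inj pickleK) ? ?].
by split.
Qed.

Lemma place_spot k pts b : (forall l phi, beta b = inl (l, phi) -> (l < k)%N) ->
  (forall x, beta b = inr x -> x \in pts) ->
  exists p, place_ok k (size pts) p /\ spot (take k) pts p = b.
Proof.
have := beta_in b; rewrite -{4}(betaK b).
case: (beta b) => [[l phi] [w ->]|x ex] hl hx.
  have lk := hl l _ erefl; exists (inl (l, w)); split=> //=.
  congr (code (inl (_, _))); apply/funext => t /=; rewrite take_takel //; exact: ltnW.
exists (inr (index x pts)); rewrite /= index_mem nth_index; first by rewrite hx.
exact: hx.
Qed.

(* Every tuple is a combination, with integer coefficients up to a denominator,
   of projections and translates of a frame and of points separated at its level. *)
Definition described (k : nat) (pts : seq (nat -> int)) (js : seq (word * (nat * nat)))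
    (cs : seq (nat * seq (int * place))) (s : seq nat) : Prop :=
  [/\ (0 < size pts)%N, size js = size pts,
    forall j, (j < size pts)%N -> [/\ eventually_constant (nth x0 pts j),
      (nth j0 js j).2 = label (nth x0 pts j) &
      act (nth j0 js j).1 (nseq k 0) = mkseq (nth x0 pts j) k],
    forall i j, (i < size pts)%N -> (j < size pts)%N ->
      mkseq (nth x0 pts i) k = mkseq (nth x0 pts j) k -> i = j &
    size cs = size s /\ forall z c, (z, c) \in zip s cs ->
      [/\ (0 < c.1)%N, forall q, q \in c.2 -> place_ok k (size pts) q.2 &
        c.1%:R *: elt H z = \sum_(q <- c.2) q.1%:~R *: 'X^(spot (take k) pts q.2)]].

Lemma mem_zip_self (I J : eqType) (f : I -> J) (s : seq I) x y :
  (x, y) \in zip s (map f s) -> x \in s /\ y = f x.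
Proof.
elim: s => //= a s IH; rewrite !inE => /predU1P[[-> ->]|/IH[xs ->]]; first by rewrite eqxx.
by rewrite xs orbT.
Qed.

Lemma description s : exists k pts js cs, described k pts js cs s.
Proof.
pose L := flatten [seq support (elt H z) | z <- s].
pose pt b := if beta b is inr x then x else x0.
(* The zero branch keeps the list nonempty: at least one point is needed beside the frame to
   determine the scalar. *)
pose pts := undup (x0 :: [seq pt b | b <- L]).
have [k0 k0P] := @separating_level _ id pts (fun _ _ _ _ e => e).
(* The successor puts every level of the support strictly below [k], as [Proj] requires. *)
pose lev b := if beta b is inl (l, _) then l.+1 else 0%N.
pose k := maxn k0 (\max_(b <- L) lev b).
have ept x : x \in pts -> eventually_constant x.
  rewrite mem_undup inE => /predU1P[->|/mapP[b _ ->]]; first by exists 0, 0%N.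
  by rewrite /pt; have := beta_in b; case: (beta b) => // *; exists 0, 0%N.
have /choice[w wE] : forall x : nat -> int, exists w, act w (nseq k 0) = mkseq x k.
  by move=> x; have [w] := act_transitive (mkseq x k); rewrite size_mkseq; exists w.
have /choice[pl plE] : forall b, exists p, b \in L ->
    place_ok k (size pts) p /\ spot (take k) pts p = b.
  move=> b; have [bL|_] := boolP (b \in L); last by exists (inr 0%N).
  have [||p hp] := @place_spot k pts b; last by exists p.
    move=> l phi bl; rewrite leq_max; apply/orP; right.
    by have := @leq_bigmax_seq _ L predT lev b bL isT; rewrite {1}/lev bl.
  move=> x bx; rewrite mem_undup inE; apply/orP; right; apply/mapP; exists b => //.
  by rewrite /pt bx.
have /choice[D DP] : forall z, exists m, (0 < m)%N /\ intpoly (m%:R *: elt H z).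
  by move=> z; have [m m0 hm] := intpoly_multiple (elt H z); exists m.
pose cf z := (D z, [seq (Num.floor ((D z)%:R * (elt H z)`_b), pl b) | b <- support (elt H z)]).
exists k, pts, [seq (w x, label x) | x <- pts], [seq cf z | z <- s].
have in_pts j : (j < size pts)%N -> nth x0 pts j \in pts by exact: mem_nth.
split; rewrite ?size_map //.
- have : x0 \in pts by rewrite mem_undup mem_head.
  by case: (pts).
- by move=> j jp; rewrite (nth_map x0) //; split; [apply: ept; exact: in_pts| |exact: wE].
- move=> i j ip jp e; have := k0P k (leq_maxl _ _) _ _ (in_pts i ip) (in_pts j jp) e.
  by move=> /eqP; rewrite nth_uniq ?undup_uniq // => /eqP.
split=> // z c /mem_zip_self[zs ->]; have [m0 mi] := DP z; split=> //=.
  move=> q /mapP[b bz ->] /=.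
  by have [] := plE b => //; apply/flatten_mapP; exists z.
rewrite big_map -[in LHS](lin_id (elt H z)) lin_support scaler_sumr !big_seq.
apply: eq_bigr => b bz /=; rewrite scalerA.
have [|_ ->] := plE b; first by apply/flatten_mapP; exists z.
rewrite Num.Theory.floorK //.
by have /polyOverP/(_ b) := mi; rewrite coefZ.
Qed.

Notation d := (fun i => pad_point H (i, i)).

Lemma mem_zip_nth (I J : eqType) (a : I) (b : J) (s : seq I) (t : seq J) p :
  size s = size t -> reflect (exists2 i, (i < size s)%N & p = (nth a s i, nth b t i))
    (p \in zip s t).
Proof.
move=> st; apply: (iffP (nthP (a, b))) => -[i]; rewrite size_zip st minnn => ilt.
  by rewrite nth_zip // => <-; exists i.
by move=> ->; exists i; rewrite ?nth_zip // size_zip st minnn.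
Qed.

(** Witnessed by the unit [take k] and the branches [pts] themselves, all with scalar 1. *)
Lemma described_has_type k pts js cs s : described k pts js cs s -> has_type G d (k, js, cs) s.
Proof.
move=> [p0 sj hj sep [sc hc]].
pose y := index_of H 'X^(code (inl (k, take k))).
pose xs := [seq index_of H 'X^(code (inr x)) | x <- pts].
have spX b : spanned (kap H) 'X^b by apply: spanned_intpoly; exact: (intpoly_vec (Some _)).
have lk : level k (take k) by exists [::].
have hy : at_frame H k (take k) 1 y by split=> //; rewrite scale1r; exact: index_ofK.
have hxs j : (j < size pts)%N -> at_point H (nth x0 pts j) 1 (nth 0%N xs j).
  move=> jp; have [ej _ _] := hj j jp.
  by split=> //; rewrite scale1r (nth_map x0) //; exact: index_ofK.
have sx : size xs = size pts by rewrite size_map.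
exists y, xs; split; rewrite ?sx //.
- by apply/frameP; exists (take k), 1.
- move=> x j /(@mem_zip_nth _ _ 0%N j0)[|i]; first by rewrite sx sj.
  rewrite sx => ip [-> ->]; have hi := hxs i ip; have [_ lab wi] := hj i ip.
  split; first by apply/pointP; eexists; eexists; exact: hi.
  + by apply/(similar_lab1 hi (at_pad_point H _)); rewrite label_pad lab.
  + by apply/(similar_lab2 hi (at_pad_point H _)); rewrite label_pad lab.
  by apply/(divisible_att _ hy hi); rewrite wi take_oversize // size_mkseq.
- move=> p x pp /(nthP 0%N)[i]; rewrite sx => ip <- [[c1 cy] [c2 cx]].
  have pr : (p%:R : rat) != 0 by rewrite pnatr_eq0 -lt0n prime_gt0.
  have scaled n b c' : elt H n = 1 *: 'X^b -> nsm G p c' = n ->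
      spanned (kap H) (p%:R^-1 *: 'X^b).
    move=> nE cn; have := congr1 (elt H) cn; rewrite elt_nsm nE scale1r => <-.
    by rewrite -scaler_nat scalerA mulVf // scale1r; exact: elt_spanned.
  (* A prime dividing both vectors would put both multiples by the inverse of [p] in the group,
     making this inverse an integer. *)
  have [lphi _ yE] := hy; have [ei _ iE] := hxs i ip.
  have /intrP[z zE] := int_scalar lphi ei (scaled _ _ _ yE cy) (scaled _ _ _ iE cx).
  have : (p%:Z * z = 1)%R.
    by apply: (@intr_inj rat); rewrite intrM -zE mulfV.
  move=> /(congr1 absz); rewrite abszM => /eqP; rewrite muln_eq1 => /andP[/eqP p1 _].
  by move: pp; rewrite -(absz_nat p) p1.
split=> // z c zc; have [c0 okc cE] := hc z c zc.
apply/(@combinationP H k (take k) 1 y xs pts hy) => //; first by rewrite sx.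
- by rewrite sx; exact: okc.
by rewrite scale1r -cE elt_nsm scaler_nat.
Qed.

End Description.

Lemma giso_at_point (H H' : structure graph_vocabulary) g q (e : rat) x c n : (e * e = 1)%R ->
  keeps_points q ->
  (forall n, elt H' (g n) = e *: lin (fun b => 'X^(perm_of q b)) (elt H n))%R ->
  at_point H x c n -> at_point H' (branch_map q x) (e * c)%R (g n).
Proof.
move=> ee kq gE [ex c0 nE]; split; first exact: kq.
  by rewrite mulf_neq0 //; apply/eqP => e0; move/eqP: ee; rewrite e0 mulr0 eq_sym oner_eq0.
by rewrite gE nE linearZ /= linXn scalerA perm_of_code.
Qed.

Lemma pointed_iso_labels (H H' : structure graph_vocabulary) h g v :
  injective h -> giso (group_of H) (group_of H') g ->
  (forall i, exists c y, at_point H y c (v i) /\ label_map h (label y) = (i, i)) ->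
  (forall x c n, at_point H x c n -> exists x' c',
    at_point H' x' c' (g n) /\ label x' = label_map h (label x)) ->
  pointed_iso (group_of H) v (group_of H') (fun i => pad_point H' (i, i)) g.
Proof.
move=> h_inj ig hv hg; split; first exact: ig.
move=> n i /pointP[x [c hx]].
have [cv [y [hy [l1 l2]]]] := hv i; have [x' [c' [hx' lab]]] := hg x c n hx.
have hp := at_pad_point H' (i, i).
rewrite (similar_lab1 hx hy) (similar_lab2 hx hy) (similar_lab1 hx' hp) (similar_lab2 hx' hp).
by rewrite label_pad lab /= -{1}l1 -l2; split; split=> [->|/h_inj].
Qed.

Section Realization.
Local Open Scope ring_scope.
Variable H : structure graph_vocabulary.
Notation G := (group_of H).
Notation x0 := (fun=> 0 : int).
Notation j0 := ([::] : word, (0%N, 0%N)).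
Notation d := (fun i => pad_point H (i, i)).

(** The frame and the points found for [t] are matched with [take k] and [pts]. This is a finite
    approximation with identity on labels, and its extension with sign [c] carries each combination
    describing [s] to the one describing [t]. *)
Lemma type_realized k pts js cs s t : described H k pts js cs s -> size s = size t ->
  has_type G d (k, js, cs) t -> exists2 f, pointed_iso G d G d f & map f s = t.
Proof.
move=> [p0 sj hj sep [sc hc]] st [y [xs [sx fy hx hu [_ ht]]]].
have sxp : size xs = size pts by rewrite sx.
have /frameP[phi [c hy]] := fy; have [[v phiE] c0 yE] := hy.
have /choice[X XP] : forall j, exists x, (j < size pts)%N -> [/\ at_point H x c (nth 0%N xs j),
    label x = label (nth x0 pts j) & mkseq x k = act v (mkseq (nth x0 pts j) k)].
  move=> j; have [jp|_] := boolP (j < size pts)%N; last by exists x0.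
  have [ej lab wj] := hj j jp.
  have [|pj s1 s2 aj] := hx (nth 0%N xs j) (nth j0 js j).
    by apply/(mem_zip_nth 0%N j0) => //; exists j; rewrite ?sxp.
  have /pointP[x [c' hx']] := pj; exists x => _.
  have /(divisible_att _ hy hx')[cc' xk] := aj; rewrite cc' in hx'; split=> //.
    have e1 := (similar_lab1 hx' (at_pad_point H _)).1 s1.
    have e2 := (similar_lab2 hx' (at_pad_point H _)).1 s2.
    rewrite !label_pad lab /= in e1 e2.
    by rewrite [LHS]surjective_pairing e1 e2 -surjective_pairing.
  by rewrite xk wj phiE take_oversize // size_act size_mkseq.
have cc : c * c = 1.
  have [h0 _ _] := XP 0%N p0; apply: (unit_scalar hy h0) => p pp.
  by apply: hu => //; apply: mem_nth; rewrite sxp.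
have hxs j : (j < size xs)%N -> at_point H (nth x0 (mkseq X (size pts)) j) c (nth 0%N xs j).
  by rewrite sxp => jp; rewrite nth_mkseq //; have [] := XP j jp.
have sp : size pts = size (mkseq X (size pts)) by rewrite size_mkseq.
have ap : approx id (k, v, zip pts (mkseq X (size pts))).
  split=> [p|p q] /(mem_zip_nth x0 x0 _ sp)[i ip ->] /=; last first.
    move=> /(mem_zip_nth x0 x0 _ sp)[j jp ->] /= e.
    by have -> : i = j by exact: sep e.
  rewrite nth_mkseq //; have [ei _ _] := hj i ip; have [[ex _ _] lab xk] := XP i ip.
  by split=> //; rewrite lab /label_map -surjective_pairing.
have [g [q [ig cq qw qs [kq ql gE]]]] :=
  @giso_extension H H id id k v _ c (fun=> erefl) (fun=> erefl) (fun _ _ => erefl) cc ap.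
exists g.
  apply: (@pointed_iso_labels _ _ id) => // [i|x c' n hx'].
    exists 1, (pad_label [::] (i, i)); split; [exact: at_pad_point|by rewrite label_pad].
  have [ex _ _] := hx'; exists (branch_map q x), (c * c').
  by split; [exact: giso_at_point hx'|exact: ql].
have spotE p : place_ok k (size pts) p ->
    spot phi (mkseq X (size pts)) p = perm_of q (spot (take k) pts p).
  case: p => [[l w]|j] /= ok; last first.
    rewrite perm_of_code /=; last by have [] := hj j ok.
    congr (code (inr _)); symmetry; rewrite nth_mkseq //.
    apply: (qs (nth x0 pts j, X j)); apply/(mem_zip_nth x0 x0 _ sp); exists j => //.
    by rewrite nth_mkseq.
  have lk := ltnW ok; rewrite perm_of_code /=; last first.
    by exists w; apply/funext => u /=; rewrite take_takel.
  congr (code (inl (_, _))); apply/funext => u /=; rewrite phiE !take_takel //.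
  rewrite qw ?take_act //.
  by rewrite -take_act size_take_min (leq_trans (geq_minl _ _)).
apply: (@eq_from_nth _ 0%N); rewrite size_map // => i si; rewrite (nth_map 0%N) //.
pose e := nth (0%N, [::]) cs i.
have ssc : size s = size cs by [].
have stc : size t = size cs by rewrite -st.
have [|m0 ok sE] := hc (nth 0%N s i) e.
  by apply/(mem_zip_nth 0%N (0%N, [::])) => //; exists i.
have := ht (nth 0%N t i) e; rewrite (combinationP hy hxs cc); last by move=> r /ok; rewrite sxp.
rewrite elt_nsm => tE.
(* The entries are compared after multiplication by their common denominator. *)
apply: (@elt_inj H); apply: (@scalerI _ _ (e.1%:R : rat)); first by rewrite pnatr_eq0 -lt0n.
rewrite [RHS]scaler_nat tE; last first.
  by apply/(mem_zip_nth 0%N (0%N, [::])) => //; exists i; rewrite -?st.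
rewrite gE scalerA mulrC -scalerA; congr (_ *: _).
rewrite -[LHS](linearZ _ (elt H (nth 0%N s i))) sE linear_sum /=.
rewrite !big_seq; apply: eq_bigr => r /ok rok; rewrite linearZ /= linXn spotE //.
Qed.

Lemma homogeneous s t : same_type G d G d s t ->
  exists2 f, pointed_iso G d G d f & map f s = t.
Proof.
move=> [st _ ty]; have [k [pts [js [cs hs]]]] := description H s.
exact: (type_realized hs st ((ty (k, js, cs)).1 (described_has_type hs))).
Qed.

End Realization.

(** * Borel isomorphism classes *)

Section BorelTypes.
Variable T : topologicalType.

Lemma bpred_and3 (P Q R : T -> Prop) : bpred P -> bpred Q -> bpred R ->
  bpred (fun t => [/\ P t, Q t & R t]).
Proof.
move=> bP bQ bR; apply: (@bpred_ext _ (fun t => P t /\ Q t /\ R t)) => [t|].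
  by split=> [[? []]|[]].
by apply: bpred_and => //; exact: bpred_and.
Qed.

Lemma bpred_and4 (P Q R S : T -> Prop) : bpred P -> bpred Q -> bpred R -> bpred S ->
  bpred (fun t => [/\ P t, Q t, R t & S t]).
Proof.
move=> bP bQ bR bS; apply: (@bpred_ext _ (fun t => P t /\ [/\ Q t, R t & S t])) => [t|].
  by split=> [[? []]|[]].
by apply: bpred_and => //; exact: bpred_and3.
Qed.

Lemma bpred_and5 (P Q R S U : T -> Prop) : bpred P -> bpred Q -> bpred R -> bpred S ->
  bpred U -> bpred (fun t => [/\ P t, Q t, R t, S t & U t]).
Proof.
move=> bP bQ bR bS bU; apply: (@bpred_ext _ (fun t => P t /\ [/\ Q t, R t, S t & U t])) => [t|].
  by split=> [[? []]|[]].
by apply: bpred_and => //; exact: bpred_and4.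
Qed.

Definition bfun (u : T -> nat) : Prop := forall n, bpred (fun t => u t = n).

Lemma bfun_cst n : bfun (fun=> n).
Proof. by move=> m; exact: bpred_cst. Qed.

Lemma bpred_eq u w : bfun u -> bfun w -> bpred (fun t => u t = w t).
Proof.
move=> bu bw; apply: (@bpred_comp _ _ u (fun n t => n = w t)) => // n.
by apply: bpred_ext (bw n) => t; split=> ->.
Qed.

Variable M : T -> gstruct.
Hypothesis bM : borel_map M.

Lemma bfun_finterp (f : fsym group_vocabulary) (a : (farity f).-tuple nat) :
  bfun (fun t => finterp (M t) f a).
Proof.
move=> n; apply: (bpred_preimage (P := fun G => finterp G f a = n) bM); apply: bpred_open.
exact: (@open_meets group_vocabulary
  (inl (Tagged (fun f : fsym group_vocabulary => (farity f).-tuple nat) a, n))).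
Qed.

Lemma bfun_zero : bfun (fun t => zero (M t)).
Proof. exact: (@bfun_finterp Zero [tuple]). Qed.

Lemma bfun_add u w : bfun u -> bfun w -> bfun (fun t => add (M t) (u t) (w t)).
Proof.
move=> bu bw n; apply: (@bpred_comp _ _ u (fun x t => add (M t) x (w t) = n)) => // x.
apply: (@bpred_comp _ _ w (fun y t => add (M t) x y = n)) => // y.
exact: (@bfun_finterp Add [tuple x; y]).
Qed.

Lemma bfun_opp u : bfun u -> bfun (fun t => opp (M t) (u t)).
Proof.
move=> bu n; apply: (@bpred_comp _ _ u (fun x t => opp (M t) x = n)) => // x.
exact: (@bfun_finterp Opp [tuple x]).
Qed.

Lemma bfun_nsm k u : bfun u -> bfun (fun t => nsm (M t) k (u t)).
Proof. by move=> bu; elim: k => [|k IH]; [exact: bfun_zero|exact: bfun_add bu IH]. Qed.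

Lemma bfun_zsm z u : bfun u -> bfun (fun t => zsm (M t) z (u t)).
Proof. by case: z => k bu; [exact: bfun_nsm|exact: bfun_opp (bfun_nsm k.+1 bu)]. Qed.

Lemma bfun_sb u w : bfun u -> bfun w -> bfun (fun t => sb (M t) (u t) (w t)).
Proof. by move=> bu bw; apply: bfun_add => //; exact: bfun_opp. Qed.

Lemma bpred_def1 P u : def1 P -> bfun u -> bpred (fun t => P (M t) (u t)).
Proof.
move=> dP bu; apply: (@bpred_comp _ _ u (fun x t => P (M t) x)) => // x.
exact: (bpred_preimage bM (def1_bpred dP x)).
Qed.

Lemma bpred_def2 P u w : def2 P -> bfun u -> bfun w -> bpred (fun t => P (M t) (u t) (w t)).
Proof.
move=> dP bu bw; apply: (@bpred_comp _ _ u (fun x t => P (M t) x (w t))) => // x.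
apply: (@bpred_comp _ _ w (fun y t => P (M t) x y)) => // y.
exact: (bpred_preimage bM (def2_bpred dP x y)).
Qed.

Lemma bpred_placed k y xs p z : bpred (fun t => placed (M t) k y xs p z).
Proof.
case: p => [[l w]|j] /=.
  by apply: bpred_and; apply: bpred_def1 (def_divisible _) _; [exact: bfun_cst|
    apply: bfun_sb; exact: bfun_cst].
apply: (@bpred_comp _ _ (fun t => zero (M t)) (fun o _ => z = nth o xs j)); first exact: bfun_zero.
by move=> o; exact: bpred_cst.
Qed.

Lemma bpred_combination k y xs l u : bfun u ->
  bpred (fun t => combination (M t) k y xs l (u t)).
Proof.
elim: l u => [|[r p] l IH] u bu /=; first by apply: bpred_eq => //; exact: bfun_zero.
apply: bpred_ex => z; apply: bpred_ex => z'; apply: bpred_and3.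
- exact: bpred_placed.
- by apply: (IH (fun=> z')); exact: bfun_cst.
by apply: bpred_eq => //; apply: bfun_add; [apply: bfun_zsm|]; exact: bfun_cst.
Qed.

Variable v : T -> nat -> nat.
Hypothesis bv : forall i, bfun (fun t => v t i).

Lemma bpred_has_type d s : bpred (fun t => has_type (M t) (v t) d s).
Proof.
case: d => [[k js] cs]; apply: bpred_ex => y; apply: bpred_ex => xs; apply: bpred_and5.
- exact: bpred_cst.
- exact: bpred_def1 (def_frame k) (bfun_cst y).
- apply: bpred_all => x; apply: bpred_all => j; apply: bpred_imp; first exact: bpred_cst.
  apply: bpred_and4.
  + exact: bpred_def1 def_point (bfun_cst x).
  + exact: bpred_def2 (def_similar _) (bfun_cst x) (bv _).
  + exact: bpred_def2 (def_similar _) (bfun_cst x) (bv _).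
  + by apply: bpred_def1 (def_divisible _) _; apply: bfun_sb; exact: bfun_cst.
- apply: bpred_all => p; apply: bpred_all => x; do 2!(apply: bpred_imp; first exact: bpred_cst).
  apply: bpred_not; apply: bpred_and; apply: bpred_ex => c;
    by apply: bpred_eq; rewrite ?/bfun; [apply: bfun_nsm|]; exact: bfun_cst.
apply: bpred_and; first exact: bpred_cst.
apply: bpred_all => z; apply: bpred_all => c; apply: bpred_imp; first exact: bpred_cst.
by apply: bpred_combination; apply: bfun_nsm; exact: bfun_cst.
Qed.

End BorelTypes.

Section BorelBackForth.
Variable T : topologicalType.
Variables (M N : T -> gstruct) (v v' : T -> nat -> nat).
Hypotheses (bM : borel_map M) (bN : borel_map N).
Hypotheses (bv : forall i, bfun (fun t => v t i)) (bv' : forall i, bfun (fun t => v' t i)).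

Lemma bpred_same_type s s' : bpred (fun t => same_type (M t) (v t) (N t) (v' t) s s').
Proof.
apply: bpred_and3; first exact: bpred_cst.
  do 3!apply: bpred_all => ?; do 3!(apply: bpred_imp; first exact: bpred_cst).
  apply: bpred_and; first exact: bpred_cst.
  by apply: bpred_iff; apply: bpred_eq; try exact: bfun_cst; apply: bfun_add => //; exact: bfun_cst.
by apply: bpred_all => d; apply: bpred_iff; exact: bpred_has_type.
Qed.

Lemma bpred_back_forth : bpred (fun t => back_forth (M t) (v t) (N t) (v' t)).
Proof.
apply: bpred_and; first exact: bpred_same_type.
apply: bpred_all => s; apply: bpred_all => s'; apply: bpred_imp; first exact: bpred_same_type.
by apply: bpred_and; apply: bpred_all => x; apply: bpred_ex => y; exact: bpred_same_type.
Qed.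

End BorelBackForth.

Definition vertex_graph_map (M : TFAB_omega) : Graphs_omega :=
  SigSub (mem_set (vertex_graph_Graphs (val M))).

Lemma borel_vertex_graph_map : borel_map vertex_graph_map.
Proof.
apply: borel_map_set_type.
exact: (borel_map_comp (@borel_map_val _ TFAB_omega) borel_vertex_graph).
Qed.

Definition diagonal_point (H : structure graph_vocabulary) (i : nat) : nat := pad_point H (i, i).

(* Among countable groups, this says that M is isomorphic to the group of its own
   vertex graph by an isomorphism that matches the vertices. *)
Definition self_coded (M : gstruct) : Prop :=
  back_forth M (vertex_of M) (group_of (vertex_graph M)) (diagonal_point (vertex_graph M)).

Lemma bpred_self_coded : bpred (fun M : TFAB_omega => self_coded (val M)).
Proof.
have bM := @borel_map_val _ TFAB_omega.
have bV := borel_map_comp bM borel_vertex_graph.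
apply: bpred_back_forth => // [|i|i n].
- exact: borel_map_comp bV borel_group_of.
- move=> n; exact: (bpred_preimage bM (bpred_vertex_of i n)).
exact: (bpred_preimage bV (bpred_index_of _ n)).
Qed.

(** The extension [f] of the relabelling [h] sends branches labelled by vertices of [H] to branches
    labelled by their indices in the vertex graph of [M]; composed with the inverse of [g] it is a
    pointed isomorphism, and homogeneity concludes. *)
Lemma group_of_self_coded (H : structure graph_vocabulary) M : Graphs_omega H ->
  isomorphic (group_of H) M -> self_coded M.
Proof.
move=> gH /gisoP[g ig]; have [h [h' [hK h'K hE hv]]] := vertex_graph_giso gH ig.
have [g' [ig' gK g'K]] := giso_inv ig.
have h0 : approx h (0, [::], [::]) by split.
have [f [q [jf _ _ _ [kq ql fE]]]] := giso_extension hK h'K hE (mulr1 1%R) h0.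
have fg : pointed_iso (group_of H) (g' \o vertex_of M) (group_of (vertex_graph M))
    (diagonal_point (vertex_graph M)) f.
  apply: (pointed_iso_labels (can_inj hK) jf) => [i|x c n hx].
    have [n [y [c [nE hy ly]]]] := hv i; exists c, y.
    by rewrite /= -nE gK ly /label_map /= h'K.
  have [ex _ _] := hx; exists (branch_map q x), (1 * c)%R.
  by split; [exact: giso_at_point (mulr1 _) kq fE hx|exact: ql].
apply: (@pointed_iso_back_forth _ _ _ _ (f \o g')); last exact: homogeneous.
apply: pointed_iso_comp fg; split=> // x i px.
have e := g'K (vertex_of M i).
by rewrite !(def2_giso _ _ (def_similar _) ig') /=.
Qed.

Lemma iso_closure_group_map (X : set Graphs_omega) : invariant X ->
  iso_closure (group_map @` X) = [set M | X (vertex_graph_map M) /\ self_coded (val M)].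
Proof.
move=> invX; apply/seteqP; split=> [M [_ [H XH <-] iM]|M [XM sM]] /=.
  have gH : Graphs_omega (val H) by case: (H) => K /= /set_mem.
  split; last exact: group_of_self_coded gH iM.
  by apply: (invX H) XH; exact: vertex_graph_iso gH iM.
exists (group_map (vertex_graph_map M)); first by exists (vertex_graph_map M).
have tM : TFAB_omega (val M) by case: (M) => K /= /set_mem.
apply: isomorphic_sym; apply: back_forth_isomorphic sM; first by have [] := tM.
by have [] := group_of_TFAB (vertex_graph (val M)).
Qed.

Theorem theorem1p1 :
  faithfully_borel_complete TFAB_omega /\ graphs_interpretable_in TFAB_omega.
Proof.
split; last exact: graphs_interpretable.
exists group_map; split=> [|X bX invX]; first exact: group_map_reduction.
rewrite iso_closure_group_map //; apply: bpred_and; last exact: bpred_self_coded.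
exact: borel_vertex_graph_map bX.
Qed.
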